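(* Let $n\ge1$ and $\alpha:\{0,1\}\to\{0,1\}$. The spaces $\mathbf{H}_\alpha^+$, $\mathbf{U}_\alpha^+$ and $\mathcal{F}_\alpha(\ell^2(\mathbb{Z}_{\ge0};\mathcal{C}))$ are all equal.
   Context: $\mathbb{T}$ is the unit circle with uniform probability measure, $\mathbb{D}$ the open unit disc; measurable functions are identified if equal a.e. $\mathrm{Id}$ is the identity matrix, ${}^*$ the conjugate transpose. For a matrix, $\|\cdot\|_\infty$ is the operator norm and $\|\cdot\|_2$ the Hilbert--Schmidt norm. $\mathcal{C}$ is the set of complex $n\times n$ matrices with $\|F\|_\infty<1$ (contractive matrices). $\ell^2(\mathbb{Z}_{\ge0};\mathcal{C})$ is the set of sequences $(F_j)_{j\ge0}$ in $\mathcal{C}$ with $\sum_j\|F_j\|_2^2<\infty$ (extended by $0$ to $j<0$). $\mathcal{G}_0$ ($\mathcal{G}_1$) is the group of upper (lower) triangular complex $n\times n$ matrices with positive diagonal entries. For $F\in\mathcal{C}$, $Y_\alpha(F)$ is the unique matrix $\begin{pmatrix} E & F \\ G & H \end{pmatrix}\in SU(2n)$ ($n\times n$ blocks) with upper right block $F$, $E\in\mathcal{G}_{\alpha(0)}$, $H\in\mathcal{G}_{\alpha(1)}$. For $z\in\mathbb{T}$ put formally $Z=\begin{pmatrix} z^{1/2}\mathrm{Id} & 0 \\ 0 & z^{-1/2}\mathrm{Id} \end{pmatrix}$, so that $Z^j\begin{pmatrix} E & F \\ G & H \end{pmatrix}Z^{-j}=\begin{pmatrix} E & z^jF \\ z^{-j}G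 & H \end{pmatrix}$. For a finitely supported sequence $F$ in $\mathcal{C}$, $\mathcal{F}_\alpha(F)(z)=\prod_{j\in\mathbb{Z}}Z^jY_\alpha(F_j)Z^{-j}$, ordered with $j$ increasing from left to right. For $F\in\ell^2(\mathbb{Z}_{\ge0};\mathcal{C})$, $\mathcal{F}_\alpha(F)$ is the limit as $N\to\infty$ of $\mathcal{F}_\alpha(F\mathbf{1}_{[0,N]})$ (which exists) in the metric $d(M,M')=(\int_{\mathbb{T}}\|M-M'\|_2^2)^{1/2}+|\log\det A(\infty)-\log\det A'(\infty)|$, where $A,A'$ are the upper left blocks of $M,M'$. A matrix function is in $H^2(\mathbb{D})$ if each entry is; it is identified with its analytic extension to $\mathbb{D}$. If $A^*\in H^2(\mathbb{D})$, then $A(\infty):=(A^*(0))^*$. $\mathbf{H}_\alpha^+$ is the set of measurable functions $M=\begin{pmatrix} A & B \\ C & D \end{pmatrix}:\mathbb{T}\to SU(2n)$ such that: (1) $A^*,C^*,B,D\in H^2(\mathbb{D})$; (2) $A(\infty)\in\mathcal{G}_{\alpha(0)}$ and $D(0)\in\mathcal{G}_{\alpha(1)}$; (3) whenever $I_1^*,I_2\in H^2(\mathbb{D})$ are $n\times n$ matrix functions, both unitary a.e. on $\mathbb{T}$, and $M':\mathbb{T}\to SU(2n)$ satisfies (1) and (2) and $M=M'\begin{pmatrix} I_1 & 0 \\ 0 & I_2 \end{pmatrix}$, then $I_1=I_2=\mathrm{Id}$. $\mathbf{U}_\alpha^+$ is defined in the same way with $SU(2n)$ replaced by $U(2n)$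 throughout (both for $M$ and for $M'$). *)

(* Defs.v *)
From HB Require Import structures.
From mathcomp Require Import all_boot all_order all_algebra.
From mathcomp Require Import complex.
From mathcomp Require Import all_classical all_reals all_analysis.
From mathcomp Require Import measurable_realfun.

Set Implicit Arguments.
Unset Strict Implicit.
Unset Printing Implicit Defensive.

Import Order.TTheory GRing.Theory Num.Theory.
Import numFieldNormedType.Exports.
Local Open Scope classical_set_scope.
Local Open Scope ring_scope.
Local Open Scope sesquilinear_scope.

Definition circle (R : realType) := {z : R[i] | `|z| == 1}.

Section circle.
Context {R : realType}.

Lemma norm1_circle : `|1 : R[i]| == 1. Proof. by rewrite normr1. Qed.

HB.instance Definition _ := Choice.on (circle R).
HB.instance Definition _ := isPointed.Build (circle R) (exist _ 1 norm1_circle).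

(* The coordinate maps generate the Borel sets of the circle. *)
Definition circle_gen : set (set (circle R)) :=
  preimage_set_system setT (fun z : circle R => complex.Re (val z)) measurable
  `|` preimage_set_system setT (fun z : circle R => complex.Im (val z)) measurable.

HB.instance Definition _ :=
  @isMeasurable.Build default_measure_display (circle R) <<s circle_gen >>
    (@sigma_algebra0 _ setT circle_gen) (@sigma_algebraC _ circle_gen)
    (@sigma_algebra_bigcup _ setT circle_gen).

Lemma circle_exp_subproof (t : R) :
  `|Complex (cos (2 * pi * t)) (sin (2 * pi * t))| == 1.
Proof. by rewrite normc_def /= cos2Dsin2 sqrtr1. Qed.

Definition circle_exp (t : measurableTypeR R) : circle R :=
  exist (fun z : R[i] => `|z| == 1) _ (circle_exp_subproof t).

Lemma measurable_circle_exp : measurable_fun setT circle_exp.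
Proof.
have mt : measurable_fun setT (fun t : R => 2 * pi * t).
  by apply: mulrl_measurable.
apply: (measurability circle_gen) => //.
move=> _ [_ [[B mB <-]|[B mB <-]] <-]; rewrite setTI.
- have mc : measurable_fun setT (fun t : R => cos (2 * pi * t)).
    apply: (measurableT_comp _ mt); apply: continuous_measurable_fun.
    exact: continuous_cos.
  by have := mc measurableT B mB; rewrite !setTI.
- have ms : measurable_fun setT (fun t : R => sin (2 * pi * t)).
    apply: (measurableT_comp _ mt); apply: continuous_measurable_fun.
    exact: continuous_sin.
  by have := ms measurableT B mB; rewrite !setTI.
Qed.

HB.instance Definition _ := isMeasurableFun.Build _ _ _ _ circle_exp
  measurable_circle_exp.

(* The law of exp (2 i pi t) for t uniform in [0, 1]. *)
Definition circle_prob : probability (circle R) R :=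
  distribution (uniform_prob (@ltr01 R)) circle_exp.

End circle.

Section matrices.
Context {R : realType}.
Local Notation C := R[i].

Definition hsnorm m n (M : 'M[C]_(m, n)) : R :=
  Num.sqrt (\sum_i \sum_j Normc.normc (M i j) ^+ 2).

(* On column vectors [hsnorm] is the Euclidean norm. *)
Definition opnorm m n (M : 'M[C]_(m, n)) : R :=
  sup [set hsnorm (M *m x) | x in [set x : 'cV[C]_n | hsnorm x <= 1]].

Definition contractive n : set 'M[C]_n := [set F | opnorm F < 1].

Definition ell2_contractive n : set (nat -> 'M[C]_n) :=
  [set F | (forall j, contractive (F j)) /\
           (\sum_(0 <= j <oo) (hsnorm (F j) ^+ 2)%:E < +oo)%E].

(* [is_trig_mx] is lower triangularity; [0 < z] in [R[i]] entails that [z] is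
   real. *)
Definition triG n (a : 'I_2) : set 'M[C]_n :=
  [set M | (if a == 0 then is_trig_mx M^T else is_trig_mx M) /\
           forall i, 0 < M i i].

Definition Ugroup n : set 'M[C]_n := [set M | M \is unitarymx].
Definition SUgroup n : set 'M[C]_n := [set M | M \is unitarymx /\ \det M = 1].

(* The default value 0 of [xget] is irrelevant when F is contractive. *)
Definition Ymx n (alpha : 'I_2 -> 'I_2) (F : 'M[C]_n) : 'M[C]_(n + n) :=
  xget 0 [set M | [/\ SUgroup M, ursubmx M = F,
                      triG (alpha 0) (ulsubmx M) & triG (alpha 1) (drsubmx M)]].

(* [Z ^ j M Z ^ -j]; the half-integral powers of z in Z cancel out. *)
Definition Zconj n (z : circle R) (j : nat) (M : 'M[C]_(n + n)) :=
  block_mx (ulsubmx M) (val z ^+ j *: ursubmx M)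
           (val z ^- j *: dlsubmx M) (drsubmx M).

End matrices.

Section functions.
Context {R : realType}.
Local Notation C := R[i].
Local Notation mu := (@circle_prob R).

Definition cmeasurable (f : circle R -> C) :=
  measurable_fun setT (fun z => complex.Re (f z)) /\
  measurable_fun setT (fun z => complex.Im (f z)).

Definition cintegral (f : circle R -> C) : C :=
  Complex (\int[mu]_z complex.Re (f z)) (\int[mu]_z complex.Im (f z)).

Definition fourier_coef (f : circle R -> C) (k : int) : C :=
  cintegral (fun z => f z * val z ^ (- k)).

(* H^2 of the disc, realized through boundary values: the square integrable
   functions on the circle without negative frequencies. *)
Definition H2 : set (circle R -> C) :=
  [set f | [/\ cmeasurable f,
               (\int[mu]_z (Normc.normc (f z) ^+ 2)%:E < +oo)%E &
               forall k : int, k < 0 -> fourier_coef f k = 0]].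

(* The analytic extension to the disc of a function in [H2]. *)
Definition disc_ext (f : circle R -> C) (w : C) : C :=
  lim (series (fun k : nat => fourier_coef f k%:Z * w ^+ k : C^o) @ \oo).

Definition mx_measurable m n (M : circle R -> 'M[C]_(m, n)) :=
  forall i j, cmeasurable (fun z => M z i j).

Definition mxH2 m n (M : circle R -> 'M[C]_(m, n)) :=
  forall i j, H2 (fun z => M z i j).

Definition mx_disc_ext m n (M : circle R -> 'M[C]_(m, n)) (w : C) : 'M[C]_(m, n) :=
  \matrix_(i, j) disc_ext (fun z => M z i j) w.

Definition at_infty m n (A : circle R -> 'M[C]_(m, n)) : 'M[C]_(m, n) :=
  (mx_disc_ext (fun z => (A z)^t*) 0)^t*.

End functions.

Section spaces.
Context {R : realType} {n : nat}.
Local Notation C := R[i].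
Local Notation mu := (@circle_prob R).
Implicit Types (G : set 'M[C]_(n + n)) (M : circle R -> 'M[C]_(n + n)).

(* Functions on the circle are only considered up to a.e. equality, so a
   measurable map with values in G is required to be in G a.e. *)
Definition admissible G (alpha : 'I_2 -> 'I_2) M :=
  [/\ mx_measurable M, {ae mu, forall z, G (M z)},
      [/\ mxH2 (fun z => (ulsubmx (M z))^t*), mxH2 (fun z => (dlsubmx (M z))^t*),
          mxH2 (fun z => ursubmx (M z)) & mxH2 (fun z => drsubmx (M z))] &
      triG (alpha 0) (at_infty (fun z => ulsubmx (M z))) /\
      triG (alpha 1) (mx_disc_ext (fun z => drsubmx (M z)) 0)].

Definition no_common_inner_factor G alpha M :=
  forall (I1 I2 : circle R -> 'M[C]_n) M',
    mxH2 (fun z => (I1 z)^t*) -> mxH2 I2 ->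
    {ae mu, forall z, Ugroup (I1 z)} -> {ae mu, forall z, Ugroup (I2 z)} ->
    admissible G alpha M' ->
    {ae mu, forall z, M z = M' z *m block_mx (I1 z) 0 0 (I2 z)} ->
    {ae mu, forall z, I1 z = 1%:M} /\ {ae mu, forall z, I2 z = 1%:M}.

Definition outer_space G alpha : set (circle R -> 'M[C]_(n + n)) :=
  [set M | admissible G alpha M /\ no_common_inner_factor G alpha M].

Definition Hplus := outer_space (@SUgroup R (n + n)).
Definition Uplus := outer_space (@Ugroup R (n + n)).

(* F_alpha(F 1_[0,N]); the factors with j outside [0,N] are the identity,
   since the matrix Y_alpha(0) is. *)
Definition nlft_trunc (alpha : 'I_2 -> 'I_2) (F : nat -> 'M[C]_n) (N : nat)
    (z : circle R) : 'M[C]_(n + n) :=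
  \prod_(0 <= j < N.+1) Zconj z j (Ymx alpha (F j)).

Definition det_infty M : C := \det (at_infty (fun z => ulsubmx (M z))).

(* Where the metric makes sense: A(infty) is defined and log det A(infty) is a
   real logarithm. *)
Definition metric_dom : set (circle R -> 'M[C]_(n + n)) :=
  [set M | [/\ mx_measurable M, mxH2 (fun z => (ulsubmx (M z))^t*) &
               0 < det_infty M]].

Definition nlft_dist M M' : \bar R :=
  ((\int[mu]_z (hsnorm (M z - M' z) ^+ 2)%:E) `^ 2^-1 +
   `|ln (complex.Re (det_infty M)) - ln (complex.Re (det_infty M'))|%:E)%E.

Definition is_nlft alpha (F : nat -> 'M[C]_n) M :=
  metric_dom M /\ nlft_dist (nlft_trunc alpha F N) M @[N --> \oo] --> 0%E.

(* The elements of the image are a.e. classes of functions, represented here by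
   all their members. *)
Definition nlft_image alpha : set (circle R -> 'M[C]_(n + n)) :=
  [set M | exists2 F, ell2_contractive F & is_nlft alpha F M].

End spaces.

Arguments Hplus R n alpha : clear implicits.
Arguments Uplus R n alpha : clear implicits.
Arguments nlft_image R n alpha : clear implicits.

(* Main.v *)
Require Import Defs.
From HB Require Import structures.
From mathcomp Require Import all_boot all_order all_algebra.
From mathcomp Require Import complex.
From mathcomp Require Import all_classical all_reals all_analysis.
From mathcomp Require Import measurable_realfun zify ring lra.

(* A function M satisfying (1) and (2), with values in U(2n), can be
   layer-stripped: [M = Y(F_0) Z M_1 Z^-1], where F_0 is determined by
   [F H^-1 = B(0) D(0)^-1] for the blocks F, H of [Y(F_0)], and M_1 satisfies
   (1) and (2) again.  The evaluations at 0 and infinity are means over the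
   circle, and [A(oo) = E_0 ... E_k A_k+1(oo)] bounds the product of the
   determinants of the E_j from below, so the stripped sequence F is square
   summable.  Conversely the L2 distance between partial products is computed
   exactly by the means of their diagonal blocks, so that they converge to a
   function T; and [T^* M] is the limit of the [Z^k M_k Z^-k], which is block
   diagonal because [z^k B_k] has no Fourier coefficients below k.  Hence every M
   factors as [T diag(I1, I2)], and equals T when it has no common inner factor.
   Finally, if [T = M' diag(I1, I2)] then T and M' are stripped by the same
   sequence, so the diagonal of [A'(oo)] has at most the product of that of
   [A(oo) = A'(oo) I1(oo)]; this forces the diagonal of I1(oo) to be 1, hence
   I1 = Id, because the L2 distance of a unitary function to Id is a function of
   the real trace of its mean. *)

Set Implicit Arguments.
Unset Strict Implicit.
Unset Printing Implicit Defensive.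

Import Order.TTheory GRing.Theory Num.Theory.
Import numFieldNormedType.Exports.
Local Open Scope classical_set_scope.
Local Open Scope ring_scope.
Local Open Scope sesquilinear_scope.
Local Notation "x %:C" := (real_complex _ x) (format "x %:C").

(** * Bounded measurable functions on the circle *)

Section bounded_measurable.
Context {R : realType}.
Local Notation C := R[i].
Local Notation mu := (@circle_prob R).
Implicit Types (u v : circle R -> R) (f g : circle R -> C).

(** [H2] is defined by vanishing Fourier coefficients, so the multiplicativity of means, on which
    every evaluation at 0 and infinity rests, has to be proved. Unitary values bound all entries by
    1, so it suffices to treat products of bounded analytic functions. These are handled by
    polynomial approximation in square mean, which in turn rests on the density of the trigonometric
    polynomials; that density is derived from the two coordinate functions generating the
    sigma-algebra of the circle.

    The triangular normalizations serve twice. Diagonal entries multiply, so products of matrices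
    are controlled by products of positive numbers; these stay away from 0 because a diagonal entry
    of Y(F) is at least 1 - |F|^2. And a unitary matrix in a triangular group is the identity, which
    identifies the blocks of Y(F).

    The limit of the partial products has determinant 1, while the inner factors may be any unitary
    functions. The argument therefore applies to every set of matrices between SU(2n) and U(2n), and
    the two outer spaces are compared through their common description as an image. *)

Definition rbm u := measurable_fun setT u /\ exists K : R, forall z, `|u z| <= K.

Lemma rbm_integrable u : rbm u -> mu.-integrable setT (EFin \o u).
Proof.
move=> [mf [K hK]]; apply: measurable_bounded_integrable => //.
  by have := @probability_setT _ _ R mu => /= ->; rewrite ltry.
by exists K; split; [exact: num_real|move=> x Kx z _ /=; apply: le_trans (hK z) (ltW Kx)].
Qed.

Lemma rbm_cst (a : R) : rbm (fun=> a).
Proof. by split; [exact: measurable_cst|exists `|a|]. Qed.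

Lemma rbmD u v : rbm u -> rbm v -> rbm (fun z => u z + v z).
Proof.
move=> [mu1 [K hK]] [mv [L hL]]; split; first exact: measurable_funD.
by exists (K + L) => z; rewrite (le_trans (ler_normD _ _)) // lerD.
Qed.

Lemma rbmM u v : rbm u -> rbm v -> rbm (fun z => u z * v z).
Proof.
move=> [mu1 [K hK]] [mv [L hL]]; split; first exact: measurable_funM.
by exists (K * L) => z; rewrite normrM ler_pM.
Qed.

Lemma rbmN u : rbm u -> rbm (fun z => - u z).
Proof.
move=> hu; have := rbmM (rbm_cst (-1)) hu.
by under eq_fun do rewrite mulN1r.
Qed.

Lemma rbmB u v : rbm u -> rbm v -> rbm (fun z => u z - v z).
Proof. by move=> hu /rbmN; exact: rbmD. Qed.

Lemma rintD u v : rbm u -> rbm v ->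
  \int[mu]_z (u z + v z) = \int[mu]_z u z + \int[mu]_z v z.
Proof. by move=> hu hv; rewrite RintegralD //; exact: rbm_integrable. Qed.

Lemma rintZ a u : rbm u -> \int[mu]_z (a * u z) = a * \int[mu]_z u z.
Proof. by move=> hu; rewrite RintegralZl //; exact: rbm_integrable. Qed.

Lemma rintN u : rbm u -> \int[mu]_z (- u z) = - \int[mu]_z u z.
Proof.
by move=> hu; rewrite -mulN1r -rintZ //; under [RHS]eq_Rintegral do rewrite mulN1r.
Qed.

Lemma rintB u v : rbm u -> rbm v ->
  \int[mu]_z (u z - v z) = \int[mu]_z u z - \int[mu]_z v z.
Proof. by move=> hu hv; rewrite rintD ?rintN //; exact: rbmN. Qed.

Lemma rint_cst a : \int[mu]_z a = a.
Proof. by have h := @probability_setT _ _ R mu; rewrite Rintegral_cst //= [X in fine X]h mulr1. Qed.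

Lemma le_rint u v : rbm u -> rbm v -> (forall z, u z <= v z) ->
  \int[mu]_z u z <= \int[mu]_z v z.
Proof. by move=> hu hv uv; apply: le_Rintegral => //; exact: rbm_integrable. Qed.

Definition bm f := rbm (fun z => complex.Re (f z)) /\ rbm (fun z => complex.Im (f z)).

Lemma cReD (x y : C) : complex.Re (x + y) = complex.Re x + complex.Re y.
Proof. by case: x y => ? ? []. Qed.
Lemma cImD (x y : C) : complex.Im (x + y) = complex.Im x + complex.Im y.
Proof. by case: x y => ? ? []. Qed.
Lemma cReN (x : C) : complex.Re (- x) = - complex.Re x.
Proof. by case: x. Qed.
Lemma cImN (x : C) : complex.Im (- x) = - complex.Im x.
Proof. by case: x. Qed.
Lemma cReM (x y : C) : complex.Re (x * y) =
  complex.Re x * complex.Re y - complex.Im x * complex.Im y.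
Proof. by case: x y => ? ? []. Qed.
Lemma cImM (x y : C) : complex.Im (x * y) =
  complex.Re x * complex.Im y + complex.Im x * complex.Re y.
Proof. by case: x y => ? ? []. Qed.
Lemma cReJ (x : C) : complex.Re (x^* ) = complex.Re x.
Proof. by case: x. Qed.
Lemma cImJ (x : C) : complex.Im (x^* ) = - complex.Im x.
Proof. by case: x. Qed.
Lemma complex_ext (x y : C) :
  complex.Re x = complex.Re y -> complex.Im x = complex.Im y -> x = y.
Proof. by case: x y => ? ? [? ?] /= -> ->. Qed.

Lemma normc2E (x : C) :
  Normc.normc x ^+ 2 = complex.Re x ^+ 2 + complex.Im x ^+ 2.
Proof. by case: x => a b /=; rewrite sqr_sqrtr // addr_ge0 ?sqr_ge0. Qed.

Lemma normc2J (x : C) : (Normc.normc x ^+ 2)%:C = x * (x^* ).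
Proof.
by rewrite normc2E; apply: complex_ext; rewrite ?cReM ?cImM ?cReJ ?cImJ /=; ring.
Qed.

Lemma bm_cmeasurable f : bm f -> cmeasurable f.
Proof. by move=> [[] + _ [] + _]. Qed.

Lemma bm_normc f : bm f -> rbm (fun z => Normc.normc (f z) ^+ 2).
Proof.
move=> [h1 h2]; under eq_fun do rewrite normc2E.
by apply: rbmD; under eq_fun do rewrite expr2; apply: rbmM.
Qed.

Lemma bm_bound f : bm f -> exists2 K, 0 <= K & forall z, Normc.normc (f z) ^+ 2 <= K.
Proof.
move=> /bm_normc [_ [K hK]]; exists `|K| => // z.
by rewrite (le_trans (ler_norm _)) // (le_trans (hK z)) ?ler_norm.
Qed.

Lemma bmP f (K : R) : cmeasurable f -> (forall z, Normc.normc (f z) ^+ 2 <= K) -> bm f.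
Proof.
move=> [m1 m2] hK; split; split=> //; exists (Num.sqrt K) => z; rewrite -sqrtr_sqr ler_wsqrtr //.
  by rewrite (le_trans _ (hK z)) // normc2E lerDl sqr_ge0.
by rewrite (le_trans _ (hK z)) // normc2E lerDr sqr_ge0.
Qed.

Lemma bm_cst (a : C) : bm (fun=> a).
Proof. by split; exact: rbm_cst. Qed.

Lemma bmD f g : bm f -> bm g -> bm (fun z => f z + g z).
Proof.
by move=> [h1 h2] [h3 h4]; split; [under eq_fun do rewrite cReD|under eq_fun do rewrite cImD];
  apply: rbmD.
Qed.

Lemma bmM f g : bm f -> bm g -> bm (fun z => f z * g z).
Proof.
by move=> [h1 h2] [h3 h4]; split; [under eq_fun do rewrite cReM|under eq_fun do rewrite cImM];
  [apply: rbmB|apply: rbmD]; apply: rbmM.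
Qed.

Lemma bmZ (a : C) f : bm f -> bm (fun z => a * f z).
Proof. by move=> hf; apply: bmM => //; exact: bm_cst. Qed.

Lemma bmN f : bm f -> bm (fun z => - f z).
Proof.
by move=> [h1 h2]; split; [under eq_fun do rewrite cReN|under eq_fun do rewrite cImN]; apply: rbmN.
Qed.

Lemma bmB f g : bm f -> bm g -> bm (fun z => f z - g z).
Proof. by move=> hf /bmN; exact: bmD. Qed.

Lemma bmJ f : bm f -> bm (fun z => ((f z)^* )).
Proof.
by move=> [h1 h2]; split; [under eq_fun do rewrite cReJ|under eq_fun do rewrite cImJ; apply: rbmN].
Qed.

Lemma bm_sum (I : Type) (r : seq I) (P : pred I) (F : I -> circle R -> C) :
  (forall i, bm (F i)) -> bm (fun z => \sum_(i <- r | P i) F i z).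
Proof.
move=> hF; elim: r => [|i r IH]; first by under eq_fun do rewrite big_nil; exact: bm_cst.
under eq_fun do rewrite big_cons; case: (P i) => //; exact: bmD.
Qed.

Lemma circle_normc (z : circle R) : Normc.normc (val z) = 1.
Proof. by apply/eqP; have := valP z; rewrite normc_def -(inj_eq (@complexI R)); case: (val z). Qed.

Lemma circle_conjM (z : circle R) : val z * ((val z)^* ) = 1.
Proof. by rewrite -normc2J circle_normc expr1n. Qed.

Lemma circle_neq0 (z : circle R) : val z != 0.
Proof. by apply/eqP => z0; have /eqP := circle_conjM z; rewrite z0 mul0r eq_sym oner_eq0. Qed.

Lemma circle_conjE (z : circle R) : ((val z)^* ) = (val z)^-1.
Proof.
by apply: (mulfI (circle_neq0 z)); rewrite circle_conjM mulfV ?circle_neq0.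
Qed.

Lemma bm_val : bm (fun z : circle R => val z).
Proof.
apply: (@bmP _ 1) => [|z]; last by rewrite circle_normc expr1n.
split; move=> _ B mB; rewrite setTI; apply: sub_gen_smallest; [left|right];
  by exists B => //; rewrite setTI.
Qed.

Lemma bm_exp k : bm (fun z : circle R => val z ^+ k).
Proof.
elim: k => [|k IH]; first by under eq_fun do rewrite expr0; exact: bm_cst.
by under eq_fun do rewrite exprS; exact: bmM bm_val IH.
Qed.

Lemma bm_expV k : bm (fun z : circle R => val z ^- k).
Proof.
have := bmJ (bm_exp k); congr bm; apply/funext => z.
by rewrite rmorphXn /= circle_conjE exprVn.
Qed.

Lemma cintD f g : bm f -> bm g ->
  cintegral (fun z => f z + g z) = cintegral f + cintegral g.
Proof.
move=> [h1 h2] [h3 h4]; apply: complex_ext => /=.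
  by under eq_Rintegral do rewrite cReD; rewrite rintD.
by under eq_Rintegral do rewrite cImD; rewrite rintD.
Qed.

Lemma cintZ a f : bm f -> cintegral (fun z => a * f z) = a * cintegral f.
Proof.
move=> [h1 h2]; apply: complex_ext; rewrite ?cReM ?cImM /=.
  by under eq_Rintegral do rewrite cReM; rewrite rintB ?rintZ //; apply: rbmM => //; exact: rbm_cst.
by under eq_Rintegral do rewrite cImM; rewrite rintD ?rintZ //; apply: rbmM => //; exact: rbm_cst.
Qed.

Lemma cintN f : bm f -> cintegral (fun z => - f z) = - cintegral f.
Proof.
by move=> hf; rewrite -mulN1r -cintZ //; congr cintegral; apply/funext => z; rewrite mulN1r.
Qed.

Lemma cintB f g : bm f -> bm g ->
  cintegral (fun z => f z - g z) = cintegral f - cintegral g.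
Proof. by move=> hf hg; rewrite cintD ?cintN //; exact: bmN. Qed.

Lemma cintJ f : bm f -> cintegral (fun z => ((f z)^* )) = ((cintegral f)^* ).
Proof.
move=> [h1 h2]; apply: complex_ext; rewrite ?cReJ ?cImJ /=.
  by under eq_Rintegral do rewrite cReJ.
by under eq_Rintegral do rewrite cImJ; rewrite rintN.
Qed.

Lemma cint_cst (a : C) : cintegral (fun=> a) = a.
Proof. by apply: complex_ext; rewrite /= rint_cst. Qed.

Lemma cint_sum (I : Type) (r : seq I) (P : pred I) (F : I -> circle R -> C) :
  (forall i, bm (F i)) ->
  cintegral (fun z => \sum_(i <- r | P i) F i z) = \sum_(i <- r | P i) cintegral (F i).
Proof.
move=> hF; elim: r => [|i r IH].
  by rewrite big_nil; under eq_fun do rewrite big_nil; rewrite cint_cst.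
rewrite big_cons; under eq_fun do rewrite big_cons; case: (P i) => //.
by rewrite cintD ?IH //; exact: bm_sum.
Qed.

Definition N2 f : R := \int[mu]_z (Normc.normc (f z) ^+ 2).

Lemma N2_ge0 f : 0 <= N2 f.
Proof. by apply: Rintegral_ge0 => z _; rewrite sqr_ge0. Qed.

Lemma N2E f : bm f -> (N2 f)%:C = cintegral (fun z => f z * ((f z)^* )).
Proof.
move=> hf; apply: complex_ext => /=.
  by apply: eq_Rintegral => z _; rewrite -normc2J.
rewrite -[LHS](rint_cst 0); apply: eq_Rintegral => z _; by rewrite -normc2J.
Qed.

Lemma N2_bound f (K : R) : bm f -> (forall z, Normc.normc (f z) ^+ 2 <= K) -> N2 f <= K.
Proof.
move=> hf hK; rewrite -[leRHS]rint_cst; apply: le_rint => //; first exact: bm_normc.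
exact: rbm_cst.
Qed.

Lemma normc2D (x y : C) :
  Normc.normc (x + y) ^+ 2 <= 2 * Normc.normc x ^+ 2 + 2 * Normc.normc y ^+ 2.
Proof.
rewrite !normc2E cReD cImD.
have := sqr_ge0 (complex.Re x - complex.Re y); have := sqr_ge0 (complex.Im x - complex.Im y).
lra.
Qed.

Lemma N2D f g : bm f -> bm g -> N2 (fun z => f z + g z) <= 2 * N2 f + 2 * N2 g.
Proof.
move=> hf hg; have hn := bm_normc.
rewrite -rintZ -?rintZ -?rintD; last 4 first.
- by apply: rbmM; [exact: rbm_cst|exact: hn].
- by apply: rbmM; [exact: rbm_cst|exact: hn].
- exact: hn.
- exact: hn.
apply: le_rint => [||z]; last exact: normc2D.
  by apply: hn; exact: bmD.
by apply: rbmD; apply: rbmM; [exact: rbm_cst|exact: hn|exact: rbm_cst|exact: hn].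
Qed.

Lemma normc2M (x y : C) : Normc.normc (x * y) ^+ 2 = Normc.normc x ^+ 2 * Normc.normc y ^+ 2.
Proof. by rewrite Normc.normcM exprMn. Qed.

Lemma N2Ml f g K : bm f -> bm g -> (forall z, Normc.normc (f z) ^+ 2 <= K) ->
  N2 (fun z => f z * g z) <= K * N2 g.
Proof.
move=> hf hg hK; rewrite -rintZ; last exact: bm_normc.
apply: le_rint => [||z].
- by apply: bm_normc; exact: bmM.
- by apply: rbmM; [exact: rbm_cst|exact: bm_normc].
by rewrite normc2M ler_wpM2r ?sqr_ge0.
Qed.

Lemma N2Z a f : bm f -> N2 (fun z => a * f z) = Normc.normc a ^+ 2 * N2 f.
Proof.
move=> hf; rewrite -rintZ; last exact: bm_normc.
by apply: eq_Rintegral => z _; rewrite normc2M.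
Qed.

Lemma N2N f : N2 (fun z => - f z) = N2 f.
Proof. by apply: eq_Rintegral => z _; rewrite !normc2E cReN cImN !sqrrN. Qed.

Lemma N2_sym f g : N2 (fun z => f z - g z) = N2 (fun z => g z - f z).
Proof. by rewrite -N2N; congr N2; apply/funext => z; rewrite opprB. Qed.

(** The gap between the two sides is the variance of [f], the mean square of [f - a] for [a] the
    mean. *)
Lemma normc_cint f : bm f -> Normc.normc (cintegral f) ^+ 2 <= N2 f.
Proof.
move=> hf; have [a ca] : exists a, a = cintegral f by exists (cintegral f).
rewrite -ca -subr_ge0.
suff -> : N2 f - Normc.normc a ^+ 2 = N2 (fun z => f z - a) by exact: N2_ge0.
have ha := bm_cst a; have hfa := bmB hf ha.
apply: (@complexI R); rewrite rmorphB /= normc2J N2E // N2E //.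
have -> : (fun z => (f z - a) * (f z - a)^* ) =
  (fun z => f z * ((f z)^* ) - ((a^* ) * f z + a * ((f z)^* ) - a * (a^* ))).
  by apply/funext => z; rewrite rmorphB /=; ring.
have hJ := bmJ hf.
rewrite cintB; [|exact: bmM|by apply: bmB; [apply: bmD; exact: bmZ|exact: bm_cst]].
rewrite cintB; [|by apply: bmD; exact: bmZ|exact: bm_cst].
rewrite cintD; [|exact: bmZ|exact: bmZ].
by rewrite !cintZ ?cintJ ?cint_cst -?ca //; [ring|exact: bm_cst].
Qed.

End bounded_measurable.

(** * Means of the characters of the circle *)

Section characters.
Context {R : realType}.
Local Notation C := R[i].
Local Notation mu := (@circle_prob R).

Lemma circle_expX (t : R) k : val (circle_exp t) ^+ k =
  Complex (cos (2 * pi * t * k%:R)) (sin (2 * pi * t * k%:R)).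
Proof.
elim: k => [|k IH]; first by rewrite expr0 !mulr0 cos0 sin0.
have -> : 2 * pi * t * k.+1%:R = 2 * pi * t * k%:R + 2 * pi * t :> R by rewrite -(natr1 k); ring.
rewrite exprS IH cosD sinD.
by apply: complex_ext; rewrite ?cReM ?cImM /=; ring.
Qed.

Lemma is_derive_mulrl (c t : R) : is_derive t 1 (fun t : R => c * t) c.
Proof.
have := @is_deriveZ _ _ _ id c t 1 1 (is_derive_id t 1).
by rewrite [c *: 1]mulr1.
Qed.

Lemma rint_circle (u : circle R -> R) (F f : R -> R) :
  rbm u -> (forall t : R, u (circle_exp t) = f t) ->
  continuous f -> (forall t : R, is_derive t 1 F (f t)) ->
  \int[mu]_z u z = F 1 - F 0.
Proof.
move=> hu huf cf dF; have [mu_ [K hK]] := hu.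
have K0 : 0 <= K by rewrite (le_trans _ (hK point)).
(* Adding the bound [K] makes the integrand nonnegative, as the change of variables along
   [circle_exp] and the integral against the uniform law require. *)
suff : \int[mu]_z (u z + K) = F 1 - F 0 + K.
  by rewrite rintD ?rint_cst //; [move/addIr|exact: rbm_cst].
rewrite /Rintegral.
have mK : measurable_fun setT (fun z : circle R => (u z + K)%:E).
  by apply/measurable_EFinP; apply: measurable_funD.
have uK0 z : 0 <= u z + K.
  by rewrite -lerBlDr sub0r; have := hK z; rewrite ler_norml => /andP[].
rewrite ge0_integral_distribution; [|by []|by move=> y; rewrite lee_fin].
rewrite integral_uniform; last 2 first.
- apply: (measurableT_comp mK); exact: measurable_circle_exp.
- by move=> x /=; rewrite lee_fin.
rewrite subr0 invr1 mul1e.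
have -> : (fun y : circle R => (u y + K)%:E) \o circle_exp = (fun t : R => (f t + K)%:E).
  by apply/funext => t /=; rewrite huf.
have dG (t : R) : is_derive t 1 (fun t => F t + K * t) (f t + K).
  exact: is_deriveD (is_derive_mulrl K t).
have cG : continuous (fun t => F t + K * t).
  by move=> t; apply/differentiable_continuous/derivable1_diffP; have [] := dG t.
have h := @continuous_FTC2 _ (fun t => f t + K) (fun t => F t + K * t) 0 1 ltr01.
transitivity (fine ((F 1 + K * 1)%:E - (F 0 + K * 0)%:E)); last by rewrite -EFinD /=; ring.
congr fine; apply: h.
- apply: continuous_subspaceT => t; apply: cvgD; [exact: cf|exact: cvg_cst].
- split.
  + by move=> t _; have [] := dG t.
  + exact: cvg_at_right_filter (cG 0).
  + exact: cvg_at_left_filter (cG 1).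
- by move=> t _; rewrite derive1E; have [_ ->] := dG t.
Qed.

Lemma cint_exp k : cintegral (fun z : circle R => val z ^+ k.+1) = 0.
Proof.
pose c : R := 2 * pi * k.+1%:R.
have c0 : c != 0 by rewrite /c mulf_neq0 ?mulf_neq0 ?pnatr_eq0 // gt_eqF // pi_gt0.
(* By [circle_expX] this says [cos c = 1] and [sin c = 0], so the antiderivatives below take equal
   values at 0 and 1. *)
have e1 : val (circle_exp (1 : R)) ^+ k.+1 = 1.
  have -> : val (circle_exp (1 : R)) = 1.
    by apply: complex_ext; rewrite /= mulr1 mulr_natl ?cos2pi ?sin2pi.
  by rewrite expr1n.
have [b1 b2] := bm_exp (R:=R) k.+1.
have lin := is_derive_mulrl c.
have d1 (t : R) : is_derive t 1 (c^-1 \*: (sin \o (fun t => c * t))) (cos (c * t)).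
  have -> : cos (c * t) = c^-1 *: (cos (c * t) * c) by rewrite -[RHS]/(c^-1 * (cos (c * t) * c)) mulrCA mulVf // mulr1.
  by apply: is_deriveZ; apply: is_derive1_comp.
have d2 (t : R) : is_derive t 1 ((- c^-1) \*: (cos \o (fun t => c * t))) (sin (c * t)).
  have -> : sin (c * t) = - c^-1 *: (- sin (c * t) * c).
    by rewrite -[RHS]/(- c^-1 * (- sin (c * t) * c)) mulrCA [- c^-1 * c]mulNr mulVf // mulrN1 opprK.
  by apply: is_deriveZ; apply: is_derive1_comp.
have cl : continuous (fun t : R => c * t) by exact: mulrl_continuous.
apply: complex_ext; rewrite /=.
- rewrite (rint_circle b1 _ _ d1) /=.
  + move/(congr1 (@complex.Im R)): e1; rewrite circle_expX mulr1 -/c /= => s1.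
    by rewrite mulr0 sin0 mulr1 s1 subrr.
  + by move=> t; rewrite circle_expX /= /c; congr cos; ring.
  + by move=> t; apply: continuous_comp; [exact: cl|exact: continuous_cos].
- rewrite (rint_circle b2 _ _ d2) /=.
  + move/(congr1 (@complex.Re R)): e1; rewrite circle_expX mulr1 -/c /= => s1.
    by rewrite mulr0 cos0 mulr1 s1 subrr.
  + by move=> t; rewrite circle_expX /= /c; congr sin; ring.
  + by move=> t; apply: continuous_comp; [exact: cl|exact: continuous_sin].
Qed.

End characters.

(** * Density of the trigonometric polynomials *)

Section density.
Context {R : realType}.
Local Notation C := R[i].
Local Notation mu := (@circle_prob R).
Implicit Types (u v : circle R -> R) (f g h : circle R -> C).

Lemma rint_cvg0 (u : nat -> circle R -> R) (K : R) :
  (forall n, measurable_fun setT (u n)) -> (forall n z, `|u n z| <= K) ->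
  {ae mu, forall z, u n z @[n --> \oo] --> 0} ->
  \int[mu]_z u n z @[n --> \oo] --> 0.
Proof.
move=> mu_ hK hu.
have mcst : mu.-integrable setT (EFin \o (fun=> K) : circle R -> \bar R).
  by apply: rbm_integrable; exact: rbm_cst.
have [] := @dominated_convergence _ _ R mu setT measurableT
  (fun n z => (u n z)%:E) (fun=> 0%E) (fun=> K%:E) _ _ _ mcst _.
- by move=> n; apply/measurable_EFinP.
- exact: measurable_cst.
- apply: filterS hu => z hz _; by apply/fine_cvgP; split; [exact: nearW|exact: hz].
- by apply: aeW => z n _ /=; rewrite lee_fin.
move=> _ _ h; apply: (@fine_cvg R _ _ _ _ 0).
by move: h; rewrite integral0.
Qed.

Lemma N2_cvg0 (f : nat -> circle R -> C) (K : R) :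
  (forall n, bm (f n)) -> (forall n z, Normc.normc (f n z) ^+ 2 <= K) ->
  {ae mu, forall z, Normc.normc (f n z) ^+ 2 @[n --> \oo] --> (0 : R)} ->
  N2 (f n) @[n --> \oo] --> (0 : R).
Proof.
move=> bf hK hf; apply: (@rint_cvg0 _ K) => //.
  by move=> n; have [] := bm_normc (bf n).
by move=> n z; rewrite ger0_norm ?sqr_ge0.
Qed.

Lemma bm_horner (q : {poly C}) : bm (fun z : circle R => q.[val z]).
Proof.
under eq_fun do rewrite horner_coef.
by apply: bm_sum => i; apply: bmZ; exact: bm_exp.
Qed.

Definition trig (q r : {poly C}) (z : circle R) := q.[val z] + r.[(val z)^*].

Lemma bm_trig q r : bm (trig q r).
Proof.
apply: bmD; first exact: bm_horner.
have := bmJ (bm_horner (map_poly Num.conj r)); congr bm; apply/funext => z.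
by rewrite -horner_map /= -map_poly_comp /= map_poly_id // => x _; exact: conjCK.
Qed.

Definition appr f := bm f /\ forall e : R, 0 < e ->
  exists q r, N2 (fun z => f z - trig q r z) < e.

(* The multipliers of [appr] form an algebra closed under bounded limits, so the
   sets with indicator in [mult] form a sigma-algebra; it contains the half-planes
   because the polynomials [step n] converge to indicators of half-lines. *)
Definition mult h := bm h /\ forall f, appr f -> appr (fun z => f z * h z).

Lemma apprD f g : appr f -> appr g -> appr (fun z => f z + g z).
Proof.
move=> [bf hf] [bg hg]; split=> [|e e0]; first exact: bmD.
have e4 : 0 < e / 4 by rewrite divr_gt0.
have [q1 [r1 h1]] := hf _ e4; have [q2 [r2 h2]] := hg _ e4.
exists (q1 + q2), (r1 + r2).
have -> : (fun z => f z + g z - trig (q1 + q2) (r1 + r2) z) =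
  (fun z => (f z - trig q1 r1 z) + (g z - trig q2 r2 z)).
  by apply/funext => z; rewrite /trig !hornerD; ring.
apply: le_lt_trans (N2D (bmB bf (bm_trig _ _)) (bmB bg (bm_trig _ _))) _.
lra.
Qed.

Lemma appr_lim f : bm f ->
  (forall e : R, 0 < e -> exists2 g, appr g & N2 (fun z => f z - g z) < e) -> appr f.
Proof.
move=> bf hf; split=> // e e0.
have e4 : 0 < e / 4 by rewrite divr_gt0.
have [g [bg hg] fg] := hf _ e4; have [q [r h]] := hg _ e4.
exists q, r.
have -> : (fun z => f z - trig q r z) = (fun z => (f z - g z) + (g z - trig q r z)).
  by apply/funext => z; ring.
apply: le_lt_trans (N2D (bmB bf bg) (bmB bg (bm_trig _ _))) _.
lra.
Qed.

Lemma multP f g : appr f -> mult g -> appr (fun z => f z * g z).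
Proof. by move=> hf [_]; exact. Qed.

Lemma multD g h : mult g -> mult h -> mult (fun z => g z + h z).
Proof.
move=> [bg hg] [bh hh]; split=> [|f hf]; first exact: bmD.
by under eq_fun do rewrite mulrDr; apply: apprD; [exact: hg|exact: hh].
Qed.

Lemma multM g h : mult g -> mult h -> mult (fun z => g z * h z).
Proof.
move=> [bg hg] [bh hh]; split=> [|f hf]; first exact: bmM.
by under eq_fun do rewrite mulrA; apply: hh; exact: hg.
Qed.

Lemma mult_cst a : mult (fun=> a).
Proof.
split=> [|f [bf hf]]; first exact: bm_cst.
split=> [|e e0]; first by apply: bmM => //; exact: bm_cst.
have k0 : 0 < Normc.normc a ^+ 2 + 1 by rewrite ltr_wpDl ?sqr_ge0.
have [q [r h]] := hf (e / (Normc.normc a ^+ 2 + 1)) (divr_gt0 e0 k0).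
exists (a *: q), (a *: r).
have -> : (fun z => f z * a - trig (a *: q) (a *: r) z) = (fun z => a * (f z - trig q r z)).
  by apply/funext => z; rewrite /trig !hornerZ; ring.
rewrite N2Z; last by apply: bmB; [by []|exact: bm_trig].
move: h; rewrite ltr_pdivlMr // => /(le_lt_trans _); apply.
by rewrite mulrC ler_wpM2l ?N2_ge0 // lerDl.
Qed.

Lemma mult_exp h k : mult h -> mult (fun z => h z ^+ k).
Proof.
move=> hh; elim: k => [|k IH]; first by under eq_fun do rewrite expr0; exact: mult_cst.
by under eq_fun do rewrite exprS; exact: multM.
Qed.

Lemma multN h : mult h -> mult (fun z => - h z).
Proof.
by move=> hh; under eq_fun do rewrite -mulN1r; apply: multM => //; exact: mult_cst.
Qed.

Lemma multB g h : mult g -> mult h -> mult (fun z => g z - h z).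
Proof. by move=> hg /multN; exact: multD. Qed.

Lemma mult_sum (I : Type) (r : seq I) (F : I -> circle R -> C) :
  (forall i, mult (F i)) -> mult (fun z => \sum_(i <- r) F i z).
Proof.
move=> hF; elim: r => [|i r IH]; first by under eq_fun do rewrite big_nil; exact: mult_cst.
by under eq_fun do rewrite big_cons; exact: multD.
Qed.

(** With [w] the conjugate of [z], on the circle [z * (r(w) * w + c) = r(w) + c * z]: multiplication
    by [z] lowers the degree in [w] and hands the constant term over to the polynomial in [z]. The
    error keeps its size because [z] has modulus 1. *)
Lemma mult_val : mult (fun z => val z).
Proof.
split=> [|f [bf hf]]; first exact: bm_val.
split=> [|e e0]; first by apply: bmM; [by []|exact: bm_val].
have [q [r]] := hf _ e0; elim/poly_ind: r => [|r c _] h.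
- exists (q * 'X), 0.
  have -> : (fun z => f z * val z - trig (q * 'X) 0 z) = (fun z => val z * (f z - trig q 0 z)).
    by apply/funext => z; rewrite /trig !(hornerD,hornerM,hornerX,hornerC,hornerZ); ring.
  apply: le_lt_trans (@N2Ml _ _ _ 1 _ _ _) _.
  + exact: bm_val.
  + by apply: bmB; [by []|exact: bm_trig].
  + by move=> z; rewrite circle_normc expr1n.
  by rewrite mul1r.
- exists (q * 'X + c *: 'X), r.
  have -> : (fun z => f z * val z - trig (q * 'X + c *: 'X) r z) =
      (fun z => val z * (f z - trig q (r * 'X + c%:P) z)).
    apply/funext => z; rewrite /trig !(hornerD,hornerM,hornerX,hornerC,hornerZ); have := circle_conjM z => hz.
    move: (f z) (val z) hz => F w hz.
    have e1 : r.[w^*] = w * w^* * r.[w^*] by rewrite hz mul1r.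
    by rewrite {1}e1; ring.
  apply: le_lt_trans (@N2Ml _ _ _ 1 _ _ _) _.
  + exact: bm_val.
  + by apply: bmB; [by []|exact: bm_trig].
  + by move=> z; rewrite circle_normc expr1n.
  by rewrite mul1r.
Qed.

Lemma apprJ f : appr f -> appr (fun z => (f z)^*).
Proof.
move=> [bf hf]; split=> [|e e0]; first exact: bmJ.
have [q [r h]] := hf _ e0; exists (map_poly Num.conj r), (map_poly Num.conj q).
rewrite (le_lt_trans _ h) // le_eqVlt; apply/orP; left; apply/eqP.
apply: eq_Rintegral => z _; rewrite /trig -[val z in X in _ - X]conjCK !horner_map /= conjCK.
by rewrite !normc2E !(cReD, cReN, cReJ, cImD, cImN, cImJ); ring.
Qed.

Lemma multJ h : mult h -> mult (fun z => (h z)^*).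
Proof.
move=> [bh hh]; split=> [|f /apprJ/hh/apprJ]; first exact: bmJ.
by under eq_fun do rewrite rmorphM /= conjCK.
Qed.

Lemma mult_lim h : bm h ->
  (forall e : R, 0 < e -> exists2 g, mult g & N2 (fun z => h z - g z) < e) -> mult h.
Proof.
move=> bh hlim; split=> // f hf; have [bf _] := hf.
have [K K0 hK] := bm_bound bf.
apply: appr_lim => [|e e0]; first exact: bmM.
have k0 : 0 < K + 1 by rewrite ltr_wpDl.
have [g mg hg] := hlim (e / (K + 1)) (divr_gt0 e0 k0).
exists (fun z => f z * g z); first exact: multP.
under eq_fun do rewrite -mulrBr.
have bhg : bm (fun z => h z - g z) by apply: bmB => //; case: mg.
apply: le_lt_trans (N2Ml bf bhg hK) _.
move: hg; rewrite ltr_pdivlMr // => /(le_lt_trans _); apply.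
by rewrite mulrC ler_wpM2l ?N2_ge0 // lerDl.
Qed.

Lemma mult_cvg (h : nat -> circle R -> C) g (K : R) : bm g ->
  (forall n, mult (h n)) -> (forall n z, Normc.normc (g z - h n z) ^+ 2 <= K) ->
  (forall z, Normc.normc (g z - h n z) ^+ 2 @[n --> \oo] --> (0 : R)) -> mult g.
Proof.
move=> bg hh hK hl; apply: mult_lim => // e e0.
have : N2 (fun z => g z - h n z) @[n --> \oo] --> (0 : R).
  apply: (@N2_cvg0 _ K) => // [n|]; last exact: aeW.
  by apply: bmB => //; case: (hh n).
move/cvgr_lt => /(_ e e0) [N _ /(_ N (leqnn N))] hN.
by exists (h N).
Qed.

End density.

(** * Polynomial approximation of step functions on the unit interval *)

Section steps.
Context {R : realType}.
Implicit Types (x y d : R).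

Lemma bernoulli_ge d m : 0 <= d -> 1 + m%:R * d <= (1 + d) ^+ m.
Proof.
move=> d0; elim: m => [|m IH]; first by rewrite mul0r addr0 expr0.
rewrite exprS (le_trans _ (ler_wpM2l _ IH)) ?addr_ge0 //.
rewrite -natr1; have : 0 <= m%:R * d * d by rewrite !mulr_ge0.
lra.
Qed.

Lemma bernoulli_le d m : 0 <= d <= 1 -> 1 - m%:R * d <= (1 - d) ^+ m.
Proof.
move=> /andP[d0 d1]; elim: m => [|m IH]; first by rewrite mul0r subr0 expr0.
rewrite exprS (le_trans _ (ler_wpM2l _ IH)) ?subr_ge0 //.
rewrite -natr1; have : 0 <= m%:R * d * d by rewrite !mulr_ge0.
lra.
Qed.

(** Bernoulli for [1 + d = s^-1], with [s] the square root of [x], bounds [n * s ^+ n]; the other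
    factor [s ^+ n] tends to 0. *)
Lemma cvg_natmul_exp x : 0 <= x < 1 -> n%:R * x ^+ n @[n --> \oo] --> (0 : R).
Proof.
move=> /andP[x0 x1]; pose s := Num.sqrt x.
have s0 : 0 <= s by exact: sqrtr_ge0.
have s1 : s < 1 by rewrite -sqrtr1 ltr_sqrt.
have [->|sN0] := eqVneq x 0.
  apply: cvg_near_cst; near=> n; rewrite expr0n; suff /negbTE -> : n != 0 by rewrite mulr0.
  by rewrite -lt0n; near: n; exact: nbhs_infty_gt.
have sp : 0 < s by rewrite sqrtr_gt0 lt_neqAle eq_sym sN0.
pose d := s^-1 - 1.
have dp : 0 < d by rewrite subr_gt0 invf_gt1.
have ns n : n%:R * s ^+ n <= d^-1.
  have := bernoulli_ge n (ltW dp).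
  have -> : 1 + d = s^-1 by rewrite /d addrC subrK.
  rewrite exprVn => h.
  rewrite -[leRHS]mul1r ler_pdivlMr // mulrAC -ler_pdivlMr ?exprn_gt0 // mul1r.
  by rewrite (le_trans _ h) // lerDr.
apply: (@squeeze_cvgr _ _ _ _ (fun=> 0) (fun n => d^-1 * s ^+ n)).
- near=> n; rewrite mulr_ge0 ?exprn_ge0 //=.
  have -> : x = s * s by rewrite -expr2 sqr_sqrtr.
  by rewrite exprMn mulrA ler_wpM2r // exprn_ge0.
- exact: cvg_cst.
- by apply: cvg_geometric; rewrite ger0_norm.
Unshelve. all: by end_near. Qed.

(* On [0, 1] this tends to the indicator of [y < 1/2]; with the exponent [2 ^ n]
   alone the limit at [1/2] would be [1/e]. *)
Definition step n y : R := (1 - y ^+ n) ^+ (n * 2 ^ n).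

Lemma step01 n y : 0 <= y <= 1 -> 0 <= step n y <= 1.
Proof.
move=> /andP[y0 y1]; have h1 : y ^+ n <= 1 by exact: exprn_ile1.
have h0 : 0 <= y ^+ n by exact: exprn_ge0.
by rewrite /step exprn_ge0 ?subr_ge0 //= exprn_ile1 ?subr_ge0 // lerBlDr lerDl.
Qed.

(** Below 1/2, Bernoulli gives [1 - step n y <= n * (2 * y) ^+ n]. From 1/2 on, [step n y] times
    [(1 + y ^+ n) ^+ (n * 2 ^ n)] is at most 1, and the second factor is at least [n + 1], again by
    Bernoulli. *)
Lemma step_cvg y : 0 <= y <= 1 ->
  ((y < 2^-1)%R%:R - step n y) ^+ 2 @[n --> \oo] --> (0 : R).
Proof.
move=> y01; have /andP[y0 y1] := y01.
suff [b hb bl] : exists2 b : nat -> R, (forall n, `|(y < 2^-1)%R%:R - step n y| <= b n)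
    & b @ \oo --> (0 : R).
  apply: (@squeeze_cvgr _ _ _ _ (fun=> 0) b) => //; last exact: cvg_cst.
  near=> n; rewrite sqr_ge0 //= -real_normK ?num_real // expr2.
  rewrite (le_trans _ (hb n)) // ler_piMr //.
  have /andP[h0 h1] := step01 n y01.
  by case: (y < _); rewrite ler_norml ?mulr1n ?mulr0n; lra.
have h0 n : 0 <= y ^+ n by exact: exprn_ge0.
have h1 n : y ^+ n <= 1 by exact: exprn_ile1.
have [y2|y2] := ltP y 2^-1; rewrite ?mulr1n ?mulr0n.
- exists (fun n => n%:R * (2 * y) ^+ n); last by apply: cvg_natmul_exp; lra.
  move=> n; have /andP[s0 s1] := step01 n y01.
  rewrite ger0_norm ?subr_ge0 //.
  have : 0 <= y ^+ n <= 1 by rewrite h0 h1.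
  move=> /(bernoulli_le (n * 2 ^ n)); rewrite natrM natrX -/(step n y) exprMn; lra.
- exists harmonic; last exact: cvg_harmonic.
  move=> n; have /andP[s0 s1] := step01 n y01.
  rewrite sub0r normrN ger0_norm // /harmonic /= -[leRHS]mul1r ler_pdivlMr ?ltr0n //.
  have hn : n.+1%:R <= (1 + y ^+ n) ^+ (n * 2 ^ n).
    apply: le_trans (bernoulli_ge _ (h0 n)); rewrite -natr1 addrC lerD2l natrM natrX -mulrA.
    rewrite ler_peMr // -exprMn exprn_ege1 //; lra.
  apply: le_trans (ler_wpM2l s0 hn) _.
  rewrite /step -exprMn exprn_ile1 //.
    by rewrite mulr_ge0 ?subr_ge0 // addr_ge0.
  rewrite -subr_sqr expr1n lerBlDr lerDl sqr_ge0 //.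
Unshelve. all: by end_near. Qed.

(** For [x = N * u] with [u] in [0, 1] and [N > 0], it says that the mean of the [N] indicators of
    [k / N < u] is within [1 / N] of [u]. *)
Lemma count_bounds N x : 0 <= x ->
  Num.min x N%:R <= \sum_(k < N) (k%:R < x)%R%:R <= x + 1.
Proof.
move=> x0; pose c n : R := \sum_(k < n) (k%:R < x)%R%:R.
(* The exact count for [x > N] is added for the induction: it settles all three claims when the next
   term is 1. *)
suff [-> h1 h2] : [/\ c N <= x + 1, x <= N%:R -> x <= c N & N%:R < x -> c N = N%:R].
  rewrite andbT -/(c N); have [xN|Nx] := lerP x N%:R.
    exact: h1.
  by rewrite h2.
have cS n : c n.+1 = c n + (n%:R < x)%R%:R by rewrite /c big_ord_recr.
elim: N => [|N [IH1 IH2 IH3]]; first by rewrite /c big_ord0; split => //; lra.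
rewrite cS -natr1; case: ltP => [Nx|xN].
  by rewrite (IH3 Nx) mulr1n; split => //; lra.
by rewrite mulr0n addr0; split => //; [move=> _; exact: IH2|lra].
Qed.

End steps.

(** * Indicators and bounded functions as multipliers *)

Section density.
Context {R : realType}.
Local Notation C := R[i].
Local Notation mu := (@circle_prob R).
Implicit Types (u v : circle R -> R) (f g h : circle R -> C).

Definition ind (S : set (circle R)) (z : circle R) : C := `[< S z >]%:R.

Lemma ind_set0 : ind set0 = fun=> 0.
Proof. by apply/funext => z; rewrite /ind; case: asboolP. Qed.

Lemma ind_setC S : ind (~` S) = fun z => 1 - ind S z.
Proof.
apply/funext => z; rewrite /ind; case: asboolP => h1; case: asboolP => h2 //=; rewrite ?subr0 ?subrr //.
Qed.

Lemma ind_setU S T : ind (S `|` T) = fun z => ind S z + ind T z - ind S z * ind T z.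
Proof.
apply/funext => z; rewrite /ind; case: asboolP => h; case: asboolP => h1; case: asboolP => h2 //=;
  rewrite ?mulr0 ?mul0r ?mulr1 ?subr0 ?addr0 ?add0r ?addrK //.
- by case: h.
- by exfalso; apply: h; left.
- by exfalso; apply: h; left.
- by exfalso; apply: h; right.
Qed.

Lemma normc_ind_sub S T z : Normc.normc (ind S z - ind T z) ^+ 2 <= (1 : R).
Proof.
rewrite /ind; case: asboolP => h; case: asboolP => h2;
 by rewrite ?subrr ?subr0 ?sub0r ?normc2E ?cReN ?cImN /=; lra.
Qed.

Lemma bm_ind S : measurable S -> bm (ind S).
Proof.
move=> mS; apply: (@bmP _ _ 1); last first.
  by move=> z; have := normc_ind_sub S set0 z; rewrite ind_set0 subr0.
split.
- have -> : (fun z => complex.Re (ind S z)) = \1_S.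
    by apply/funext => z; rewrite /ind indicE; case: asboolP => h; [rewrite mem_set|rewrite memNset].
  exact: measurable_indic.
- have -> : (fun z => complex.Im (ind S z)) = fun=> 0; last exact: measurable_cst.
  by apply/funext => z; rewrite /ind; case: asboolP.
Qed.

Lemma sigma_mult_ind : sigma_algebra setT [set S | measurable S /\ mult (ind S)].
Proof.
split=> [|A [mA hA]|A hA]; rewrite /mkset.
- by split => //; rewrite ind_set0; exact: mult_cst.
- rewrite setTD; split; first exact: measurableC.
  by rewrite ind_setC; apply: multB => //; exact: mult_cst.
have mA : measurable (\bigcup_k A k) by apply: bigcupT_measurable => k; case: (hA k).
split=> //.
pose B n := \big[setU/set0]_(k < n) A k.
apply: (@mult_cvg _ (fun n => ind (B n)) _ 1); first exact: bm_ind.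
- elim=> [|n hn]; first by rewrite /B big_ord0 ind_set0; exact: mult_cst.
  rewrite /B big_ord_recr /= ind_setU -/(B n).
  have [_ hm] := hA n.
  by apply: multB; [exact: multD|exact: multM].
- by move=> n z; exact: normc_ind_sub.
move=> z; apply: cvg_near_cst; case: (pselect ((\bigcup_k A k) z)) => [[k _ Akz]|nA].
- near=> n; suff : B n z.
    move=> Bz; rewrite /ind !asboolT // ?subrr ?Normc.normc0 ?expr0n //; by exists k.
  rewrite /B -bigcup_mkord; exists k => //=; near: n; exact: nbhs_infty_gt.
- near=> n; rewrite /ind !asboolF ?subrr ?Normc.normc0 ?expr0n //.
  by rewrite /B -bigcup_mkord => -[k _ Ak]; apply: nA; exists k.
Unshelve. all: by end_near. Qed.

Lemma mult_ind_ray (u : circle R -> R) (a : R) : measurable_fun setT u ->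
  (forall z, `|u z| <= 1) -> mult (fun z => (u z)%:C) ->
  mult (ind (u @^-1` [set x | x < a])).
Proof.
move=> mu1 u1 mu_; pose b := 1 + `|a|; have b0 : 0 < b by rewrite ltr_pwDl.
(* Affine rescaling to the setting of [step]: [b] bounds [|u z - a|], so [y] lies in [0, 1], and
   [u z < a] becomes [y z < 2^-1]. *)
pose y z := ((u z - a) / b + 1) / 2.
have y01 z : 0 <= y z <= 1.
  have : `|(u z - a) / b| <= 1.
    rewrite normrM normfV ler_pdivrMr ?normr_gt0 ?gt_eqF // mul1r (gtr0_norm b0).
    by rewrite (le_trans (ler_normB (u z) a)) // lerD2r.
  by rewrite ler_norml /y; lra.
have yE z : (y z < 2^-1) = (u z < a).
  rewrite /y ltr_pdivrMr // mulVf // -ltrBrDr subrr pmulr_llt0 ?invr_gt0 //.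
  by rewrite subr_lt0.
have my : mult (fun z => (y z)%:C).
  under eq_fun do rewrite /y !(rmorphM, rmorphD) /=.
  apply: multM; last exact: mult_cst.
  apply: multD; last exact: mult_cst.
  apply: multM; last exact: mult_cst.
  by apply: multD => //; exact: mult_cst.
have mS : measurable (u @^-1` [set x | x < a]).
  have := mu1 measurableT _ (measurable_itv `]-oo, a[); rewrite setTI.
  by congr measurable; apply/seteqP; split => z /=; rewrite in_itv.
have e n z : Normc.normc (ind (u @^-1` [set x | x < a]) z - (step n (y z))%:C) ^+ 2 =
    ((y z < 2^-1)%R%:R - step n (y z)) ^+ 2.
  rewrite yE normc2E !(cReD, cImD, cReN, cImN) /= subr0 /ind.
  have -> : `[< (u @^-1` [set x | x < a]) z >] = (u z < a) by apply/asboolP/idP.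
  by case: (u z < a); rewrite ?mulr1n ?mulr0n /= ?oppr0 ?expr0n /= ?addr0.
apply: (@mult_cvg _ (fun n z => (step n (y z))%:C) _ 1).
- exact: bm_ind.
- move=> n; under eq_fun do rewrite /step rmorphXn rmorphB rmorphXn rmorph1.
  by apply: mult_exp; apply: multB; [exact: mult_cst|exact: mult_exp].
- move=> n z; rewrite e; have /andP[s0 s1] := step01 n (y01 z).
  rewrite -real_normK ?num_real // exprn_ile1 // ler_norml.
  by case: (y z < _); rewrite ?mulr1n ?mulr0n; lra.
- by move=> z; under eq_fun do rewrite e; exact: step_cvg.
Qed.

Lemma mult_ind_preimage (u : circle R -> R) (B : set R) : measurable_fun setT u ->
  (forall z, `|u z| <= 1) -> mult (fun z => (u z)%:C) -> measurable B ->
  mult (ind (u @^-1` B)).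
Proof.
move=> mu1 u1 mu_ mB.
suff : [set B | measurable (u @^-1` B) /\ mult (ind (u @^-1` B))] B by case.
have [s0 sC sU] := sigma_mult_ind.
have : (RGenInftyO.G (R:=R)).-sigma.-measurable B.
  by rewrite -RGenInftyO.measurableE.
apply: smallest_sub.
- split => [|A|A]; rewrite /mkset.
  + by rewrite preimage_set0.
  + by move=> /sC; rewrite !setTD preimage_setC.
  + by move=> hA; rewrite preimage_bigcup; apply: (sU (fun k => u @^-1` A k)) => k; exact: hA.
- move=> _ [a ->]; have : u @^-1` `]-oo, a[ = u @^-1` [set x | x < a].
    by apply/seteqP; split => z /=; rewrite in_itv.
  move=> e; rewrite /mkset e; split; last exact: mult_ind_ray.
  by rewrite -e -[X in measurable X]setTI; apply: mu1.
Qed.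

Lemma addJ_half (w : C) : (w + w^*) * (2^-1 : R)%:C = (complex.Re w)%:C.
Proof. by case: w => a b; apply/eqP; rewrite eq_complex /=; apply/andP; split; apply/eqP; lra. Qed.

Lemma subJ_half (w : C) : (w - w^*) * (2^-1 : R)%:C * Complex 0 (-1) = (complex.Im w)%:C.
Proof. by case: w => a b; apply/eqP; rewrite eq_complex /=; apply/andP; split; apply/eqP; lra. Qed.

Lemma normr_Re_le (z : circle R) : `|complex.Re (val z)| <= 1.
Proof.
rewrite -(@ler_pXn2r _ 2) // ?nnegrE // expr1n real_normK ?num_real //.
have := normc2E (val z); rewrite circle_normc expr1n => ->; rewrite lerDl sqr_ge0 //.
Qed.

Lemma normr_Im_le (z : circle R) : `|complex.Im (val z)| <= 1.
Proof.
rewrite -(@ler_pXn2r _ 2) // ?nnegrE // expr1n real_normK ?num_real //.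
have := normc2E (val z); rewrite circle_normc expr1n => ->; rewrite lerDr sqr_ge0 //.
Qed.

Lemma mult_ind S : measurable S -> mult (ind S).
Proof.
move=> mS; suff : [set S | measurable S /\ mult (ind S)] S by case.
move: S mS; apply: smallest_sub; first exact: sigma_mult_ind.
have [[mr _] [mi _]] := @bm_val R.
have mv := @mult_val R; have mJ := multJ mv.
have half : mult (fun=> (2^-1 : R)%:C) by exact: (mult_cst (2^-1 : R)%:C).
move=> _ [] [B mB <-]; rewrite setTI; split.
- by rewrite -[X in measurable X]setTI; apply: mr.
- apply: mult_ind_preimage => //; first exact: normr_Re_le.
  have := multM (multD mv mJ) half; congr mult; apply/funext => z.
  exact: addJ_half.
- by rewrite -[X in measurable X]setTI; apply: mi.
- apply: mult_ind_preimage => //; first exact: normr_Im_le.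
  have := multM (multM (multB mv mJ) half) (mult_cst (Complex 0 (-1))); congr mult; apply/funext => z.
  exact: subJ_half.
Qed.

(** Layer cake: [u] is the uniform limit of [h N], the mean of the indicators of [u > k / N.+1] for
    [k] up to [N], with error at most [N.+1%:R^-1]. *)
Lemma mult_unit_interval u : measurable_fun setT u -> (forall z, 0 <= u z <= 1) ->
  mult (fun z => (u z)%:C).
Proof.
move=> mu_ u01.
pose S (N : nat) (k : nat) := u @^-1` `](k%:R / N.+1%:R), +oo[.
have mS N k : measurable (S N k) by rewrite -[X in measurable X]setTI; apply: mu_.
pose h N z : C := (N.+1%:R^-1)%:C * \sum_(k < N.+1) ind (S N k) z.
have e N z : Normc.normc ((u z)%:C - h N z) ^+ 2 <= N.+1%:R^-1 ^+ 2.
  pose c : R := \sum_(k < N.+1) (k%:R < N.+1%:R * u z)%R%:R.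
  have -> : h N z = (N.+1%:R^-1 * c)%:C.
    rewrite /h /c rmorphM rmorph_sum; congr (_ * _); apply: eq_bigr => k _.
    rewrite rmorph_nat /ind; congr ((_ : bool)%:R); apply/asboolP/idP;
      by rewrite /S /= in_itv /= andbT ltr_pdivrMr // mulrC.
  have /andP[u0 u1] := u01 z.
  have := @count_bounds R N.+1 (N.+1%:R * u z); rewrite -/c mulr_ge0 // => /(_ isT).
  rewrite min_l ?ler_piMr // => /andP[c1 c2].
  rewrite normc2E !(cReD, cImD, cReN, cImN) /= subrr expr0n addr0.
  have -> : u z - N.+1%:R^-1 * c = N.+1%:R^-1 * (N.+1%:R * u z - c).
    by rewrite mulrBr mulKf // pnatr_eq0.
  rewrite exprMn ler_piMr ?sqr_ge0 // -real_normK ?num_real // exprn_ile1 // ler_norml; lra.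
apply: (@mult_cvg _ h _ 1).
- apply: (@bmP _ _ 1) => [|z].
    by split => //=; exact: measurable_cst.
  rewrite normc2E /= expr0n addr0 -real_normK ?num_real // exprn_ile1 // ler_norml.
  by have := u01 z; lra.
- move=> N; apply: multM; first exact: mult_cst.
  by apply: mult_sum => k; exact: mult_ind.
- move=> N z; apply: le_trans (e N z) _; rewrite exprn_ile1 // ?invr_ge0 // invf_le1 // ler1n //.
- move=> z; apply: (@squeeze_cvgr _ _ _ _ (fun=> 0) (fun n => harmonic n * harmonic n)).
  + near=> N; rewrite sqr_ge0 /=; exact: e.
  + exact: cvg_cst.
  + rewrite -[X in _ --> X](mulr0 (0 : R)); apply: cvgM; exact: cvg_harmonic.
Unshelve. all: by end_near. Qed.

Lemma mult_rbm u : rbm u -> mult (fun z => (u z)%:C).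
Proof.
move=> [mu_ [K hK]]; have K0 : 0 <= K by rewrite (le_trans _ (hK point)).
pose L := 2 * (K + 1); have L0 : 0 < L by rewrite /L; lra.
have := @mult_unit_interval (fun z => (u z + K) / L) _ _.
have -> : (fun z => (u z)%:C) = (fun z => L%:C * ((u z + K) / L)%:C - K%:C).
  by apply/funext => z; rewrite -rmorphM -rmorphB /= mulrCA mulfV ?gt_eqF // mulr1 addrK.
move=> h; apply: multB; last exact: mult_cst.
apply: multM; first exact: mult_cst.
apply: h => [|z].
  by apply: measurable_funM; [exact: measurable_funD|exact: measurable_cst].
have := hK z; rewrite ler_norml => /andP[h1 h2].
rewrite ler_pdivlMr // ler_pdivrMr // /L; lra.
Qed.

(** [f] is a multiplier, and it is applied to the constant 1, which is itself a trigonometric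
    polynomial. *)
Lemma bm_appr f : bm f -> appr f.
Proof.
move=> [h1 h2]; have [_ hm] : mult f.
  have -> : f = fun z => (complex.Re (f z))%:C + Complex 0 1 * (complex.Im (f z))%:C.
    by apply/funext => z; apply: complex_ext; rewrite !(cReD, cImD, cReM, cImM) /=; ring.
  apply: multD; first exact: mult_rbm.
  by apply: multM; [exact: mult_cst|exact: mult_rbm].
have h : appr (fun=> 1 : C).
  split=> [|e e0]; first exact: bm_cst.
  exists 1, 0; have -> : (fun z : circle R => 1 - trig 1 0 z) = fun=> 0.
    by apply/funext => z; rewrite /trig !hornerE subrr.
  by apply: le_lt_trans (N2_bound (bm_cst 0) _) e0 => z; rewrite Normc.normc0 expr0n.
by have := hm _ h; under eq_fun do rewrite mul1r.
Qed.

End density.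

(** * Bounded analytic functions *)

Section holomorphic.
Context {R : realType}.
Local Notation C := R[i].
Local Notation mu := (@circle_prob R).
Implicit Types (f g h : circle R -> C).

(** The bounded elements of [H2], which are closed under products; the integral for [m] is the
    Fourier coefficient of index [-(m + 1)]. *)
Definition hol f := bm f /\ forall m : nat, cintegral (fun z => f z * val z ^+ m.+1) = 0.

Lemma hol_bm f : hol f -> bm f. Proof. by case. Qed.

Lemma hol_exp f i : hol f -> cintegral (fun z => f z * val z ^+ i) = 0 ^+ i * cintegral f.
Proof.
move=> [bf hf]; case: i => [|i]; last by rewrite hf expr0n mul0r.
by rewrite expr0 mul1r; congr cintegral; apply/funext => z; rewrite mulr1.
Qed.

Lemma hol_cst a : hol (fun=> a).
Proof.
split=> [|m]; first exact: bm_cst.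
by rewrite (cintZ _ (bm_exp _)) cint_exp mulr0.
Qed.

Lemma holD f g : hol f -> hol g -> hol (fun z => f z + g z).
Proof.
move=> [bf hf] [bg hg]; split=> [|m]; first exact: bmD.
under eq_fun do rewrite mulrDl.
by rewrite (cintD (bmM bf (bm_exp _)) (bmM bg (bm_exp _))) hf hg addr0.
Qed.

Lemma hol_sum (I : Type) (r : seq I) (P : pred I) (F : I -> circle R -> C) :
  (forall i, hol (F i)) -> hol (fun z => \sum_(i <- r | P i) F i z).
Proof.
move=> hF; elim: r => [|i r IH]; first by under eq_fun do rewrite big_nil; exact: hol_cst.
by under eq_fun do rewrite big_cons; case: (P i) => //; exact: holD.
Qed.

Lemma cint_hol_horner f (q : {poly C}) : hol f ->
  cintegral (fun z => f z * q.[val z]) = q.[0] * cintegral f.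
Proof.
move=> hf; have bf := hol_bm hf.
under eq_fun do rewrite horner_coef mulr_sumr.
rewrite cint_sum => [|i]; last by apply: bmM; [by []|apply: bmZ; exact: bm_exp].
rewrite horner_coef mulr_suml; apply: eq_bigr => i _.
under eq_fun do rewrite mulrCA.
by rewrite (cintZ _ (bmM bf (bm_exp _))) (hol_exp _ hf) mulrA.
Qed.

(** In a trigonometric approximation of [g], the part [p1] of strictly negative frequencies is
    orthogonal to [g - q], so dropping it can only decrease the distance. *)
Lemma hol_approx g (e : R) : hol g -> 0 < e ->
  exists q : {poly C}, N2 (fun z => g z - q.[val z]) < e.
Proof.
move=> hg e0; have bg := hol_bm hg; have [_ /(_ e e0)] := bm_appr bg.
move=> [q0 [r0]].
(* The constant term of [r0] goes to the analytic part, since the orthogonality needs the conjugate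
   of [p1] to vanish at 0. *)
have [q [r]] : exists q r : {poly C}, trig q0 r0 = fun z => q.[val z] + (val z)^* * r.[(val z)^*].
  elim/poly_ind: r0 => [|r c _]; [exists q0, 0|exists (q0 + c%:P), r]; apply/funext => z;
    rewrite /trig !(hornerD, hornerM, hornerX, hornerC); ring.
move=> ->; set p1 := fun z : circle R => (val z)^* * r.[(val z)^*] => hq; exists q.
apply: le_lt_trans hq.
have bq := bm_horner q.
pose s := map_poly Num.conj r.
have p1J z : (p1 z)^* = ('X * s).[val z].
  by rewrite /p1 rmorphM /= conjCK hornerM hornerX /s -[val z in RHS]conjCK horner_map /= conjCK.
have bp1 : bm p1.
  have := bmJ (bm_horner ('X * s)); congr bm; apply/funext => z.
  by rewrite -p1J conjCK.
pose d z := g z - q.[val z]; have bd : bm d by exact: bmB.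
have -> : (fun z => g z - (q.[val z] + p1 z)) = (fun z => d z - p1 z).
  by apply/funext => z; rewrite /d; ring.
have orth : cintegral (fun z => d z * (p1 z)^*) = 0.
  under eq_fun do rewrite p1J /d mulrBl -hornerM.
  rewrite cintB; [|by apply: bmM; [by []|exact: bm_horner]|exact: bm_horner].
  rewrite cint_hol_horner //.
  have := @cint_hol_horner (fun=> 1) (q * ('X * s)) (hol_cst 1).
  under eq_fun do rewrite mul1r.
  by move=> ->; rewrite !(hornerM, hornerX, mul0r, mulr0, subr0).
have orth' : cintegral (fun z => (d z)^* * p1 z) = 0.
  have -> : (fun z => (d z)^* * p1 z) = (fun z => (d z * (p1 z)^*)^*).
    by apply/funext => z; rewrite rmorphM /= conjCK.
  by rewrite cintJ ?orth ?conjC0 //; exact: bmM bd (bmJ bp1).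
have -> : N2 (fun z => d z - p1 z) = N2 d + N2 p1; last by rewrite lerDl N2_ge0.
have bdJ := bmJ bd; have bpJ := bmJ bp1.
apply: (@complexI R); rewrite rmorphD /= !N2E //; last exact: bmB.
have -> : (fun z => (d z - p1 z) * (d z - p1 z)^*) =
  (fun z => (d z * (d z)^* + p1 z * (p1 z)^*) - (d z * (p1 z)^* + (d z)^* * p1 z)).
  by apply/funext => z; rewrite rmorphB /=; ring.
rewrite cintB; [|by apply: bmD; exact: bmM|by apply: bmD; exact: bmM].
rewrite !cintD; try exact: bmM.
by rewrite orth orth' addr0 subr0.
Qed.

Lemma small_eq0 (a : C) (K : R) :
  (forall e : R, 0 < e -> Normc.normc a ^+ 2 <= K * e) -> a = 0.
Proof.
move=> h; apply: Normc.eq0_normc; apply/eqP; rewrite -sqrf_eq0 eq_le sqr_ge0 andbT.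
apply/ler_addgt0Pr => e e0; rewrite add0r.
have [K0|K0] := leP K 0.
  by rewrite (le_trans (h 1 ltr01)) // mulr1 (le_trans K0) // ltW.
by rewrite (le_trans (h (e / K) _)) ?divr_gt0 // mulrCA mulfV ?mulr1 // gt_eqF.
Qed.

(* [f z^m] times [g - q], for a polynomial [q] close to [g], has small mean. *)
Lemma cint_holM_exp f g m : hol f -> hol g ->
  cintegral (fun z => f z * g z * val z ^+ m) = 0 ^+ m * (cintegral f * cintegral g).
Proof.
move=> hf hg; have bf := hol_bm hf; have bg := hol_bm hg; have bz := @bm_exp R m.
pose h z := f z * val z ^+ m - 0 ^+ m * cintegral f.
have bh : bm h by apply: bmB; [exact: bmM|exact: bm_cst].
have [K K0 hK] := bm_bound bh.
apply/eqP; rewrite -subr_eq0; apply/eqP; apply: (@small_eq0 _ K) => e e0.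
have [q hq] := hol_approx hg e0; have bq := bm_horner q.
have bgq := bmB bg bq.
suff -> : cintegral (fun z => f z * g z * val z ^+ m) - 0 ^+ m * (cintegral f * cintegral g) =
    cintegral (fun z => h z * (g z - q.[val z])).
  apply: le_trans (normc_cint _) _; first exact: bmM.
  apply: le_trans (N2Ml _ _ hK) _ => //; rewrite ler_wpM2l // ltW //.
have -> : (fun z => h z * (g z - q.[val z])) =
  (fun z => (f z * g z * val z ^+ m - f z * (q * 'X^m).[val z]) -
            0 ^+ m * cintegral f * (g z - q.[val z])).
  by apply/funext => z; rewrite /h hornerM hornerXn; ring.
have bqm := bm_horner (q * 'X^m).
have b1 : bm (fun z => f z * g z * val z ^+ m) by apply: bmM => //; exact: bmM.
have b2 : bm (fun z => f z * (q * 'X^m).[val z]) by exact: bmM.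
rewrite cintB; [|exact: bmB|exact: bmZ].
rewrite cintB // cintZ // cintB // cint_hol_horner //.
have := @cint_hol_horner (fun=> 1) q (hol_cst 1).
under eq_fun do rewrite mul1r.
by move=> ->; rewrite cint_cst hornerM hornerXn; ring.
Qed.

Lemma holM f g : hol f -> hol g -> hol (fun z => f z * g z).
Proof.
move=> hf hg; split=> [|m]; first by apply: bmM; exact: hol_bm.
by rewrite cint_holM_exp // expr0n mul0r.
Qed.

Lemma cint_holM f g : hol f -> hol g ->
  cintegral (fun z => f z * g z) = cintegral f * cintegral g.
Proof.
move=> hf hg; have := cint_holM_exp 0 hf hg; rewrite expr0 mul1r => <-.
by congr cintegral; apply/funext => z; rewrite mulr1.
Qed.

Lemma circle_normcX (z : circle R) k : Normc.normc (val z ^+ k) = 1.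
Proof.
elim: k => [|k IH]; first exact: Normc.normc1.
by rewrite exprS Normc.normcM IH circle_normc mulr1.
Qed.

Lemma hol_lim f : bm f ->
  (forall e : R, 0 < e -> exists2 g, hol g & N2 (fun z => f z - g z) < e) -> hol f.
Proof.
move=> bf hl; split=> // m; apply: (@small_eq0 _ 1) => e e0.
have [g [bg hg] fg] := hl _ e0.
have -> : cintegral (fun z => f z * val z ^+ m.+1) =
    cintegral (fun z => val z ^+ m.+1 * (f z - g z)).
  under [in RHS]eq_fun do rewrite mulrBr mulrC [X in _ - X]mulrC.
  by rewrite (cintB (bmM bf (bm_exp _)) (bmM bg (bm_exp _))) hg subr0.
have be := bm_exp (R:=R) m.+1; have bfg := bmB bf bg.
apply: le_trans (normc_cint _) _; first exact: bmM.
apply: le_trans (@N2Ml _ _ _ 1 _ _ _) _ => //; last by rewrite ler_wpM2l // ltW.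
by move=> z; rewrite circle_normcX expr1n.
Qed.

Lemma N2_eq0 f : bm f -> N2 f = 0 -> {ae mu, forall z, f z = 0}.
Proof.
move=> bf; rewrite /N2 /Rintegral => h.
have [mf _] := bm_normc bf.
have mf' : measurable_fun setT (fun z => (Normc.normc (f z) ^+ 2)%:E) by exact/measurable_EFinP.
have : (\int[mu]_z `|(Normc.normc (f z) ^+ 2)%:E| = 0)%E.
  under eq_integral do rewrite gee0_abs ?lee_fin ?sqr_ge0 //.
  have := rbm_integrable (bm_normc bf) => /integrable_fin_num => hfin.
  by rewrite -[LHS]fineK ?h //; apply: hfin.
move/ae_eq_integral_abs => /(_ measurableT mf'); apply: filterS => z /(_ I) /= [].
by move=> /eqP; rewrite sqrf_eq0 => /eqP /Normc.eq0_normc.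
Qed.

(** Multiplicativity of the mean, applied to [f] and its conjugate, shows that the variance of [f]
    is 0. *)
Lemma hol_conj_cst f : hol f -> hol (fun z => (f z)^*) ->
  {ae mu, forall z, f z = cintegral f}.
Proof.
move=> hf hJ; have bf := hol_bm hf; have bJ := hol_bm hJ.
have [a ca] : exists a, a = cintegral f by exists (cintegral f).
have ba := bm_cst (R:=R) a.
have : N2 (fun z => f z - a) = 0.
  apply: (@complexI R); rewrite N2E; last exact: bmB.
  have -> : (fun z => (f z - a) * (f z - a)^*) =
    (fun z => f z * (f z)^* - (a^* * f z + a * ((f z)^* - a^*))).
    by apply/funext => z; rewrite rmorphB /=; ring.
  have bc := bm_cst (R:=R) a^*; have bcJ := bmB bJ bc.
  rewrite cintB; [|exact: bmM|by apply: bmD; exact: bmZ].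
  rewrite cintD; [|exact: bmZ|exact: bmZ].
  rewrite !cintZ // cintB // cint_holM // cintJ // cint_cst -ca /=; ring.
move/N2_eq0 => /(_ (bmB bf ba)); apply: filterS => z /eqP.
by rewrite subr_eq0 -ca => /eqP.
Qed.

Lemma cint_ae f g : cmeasurable f -> cmeasurable g -> {ae mu, forall z, f z = g z} ->
  cintegral f = cintegral g.
Proof.
move=> [f1 f2] [g1 g2] fg; apply: complex_ext; rewrite /= /Rintegral; congr fine;
  apply: ae_eq_integral => //; try exact/measurable_EFinP;
  by apply: filterS fg => z -> _.
Qed.

Lemma fourier_coefE f (k : nat) : fourier_coef f (Negz k) = cintegral (fun z => f z * val z ^+ k.+1).
Proof. by rewrite /fourier_coef; congr cintegral; apply/funext => z; rewrite NegzE opprK. Qed.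

(** Together with [H2_hol], the bridge between the square integrable functions of the statement,
    known up to null sets, and their bounded representatives. *)
Lemma hol_H2 f g : cmeasurable f -> {ae mu, forall z, f z = g z} -> hol g -> H2 f.
Proof.
move=> mf fg [bg hg]; have mg := bm_cmeasurable bg; split=> //.
- have e1 : (\int[mu]_z (Normc.normc (f z) ^+ 2)%:E = \int[mu]_z (Normc.normc (g z) ^+ 2)%:E)%E.
    apply: ae_eq_integral => //.
    + apply/measurable_EFinP; under eq_fun do rewrite normc2E.
      by have [f1 f2] := mf; apply: measurable_funD; exact: measurable_funX.
    + by apply/measurable_EFinP; have [] := bm_normc bg.
    + by apply: filterS fg => z -> _.
  by rewrite e1; apply: integrable_lty => //; exact: (rbm_integrable (bm_normc bg)).
- case=> // k _; rewrite fourier_coefE -(hg k); apply: cint_ae.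
  + have [e1 e2] := bm_cmeasurable (@bm_exp R k.+1); have [f1 f2] := mf.
    split; [under eq_fun do rewrite cReM|under eq_fun do rewrite cImM].
      by apply: measurable_funB; apply: measurable_funM.
    by apply: measurable_funD; apply: measurable_funM.
  + by apply: bm_cmeasurable; apply: bmM; [by []|exact: bm_exp].
  + by apply: filterS fg => z ->.
Qed.

Lemma H2_hol f g : {ae mu, forall z, f z = g z} -> H2 f -> bm g -> hol g.
Proof.
move=> fg [mf _ hf] bg; split=> [|k]; first exact: bg.
rewrite -(hf (Negz k) isT) fourier_coefE; apply: cint_ae.
+ by apply: bm_cmeasurable; apply: bmM; [by []|exact: bm_exp].
+ have [e1 e2] := bm_cmeasurable (@bm_exp R k.+1); have [f1 f2] := mf.
  split; [under eq_fun do rewrite cReM|under eq_fun do rewrite cImM].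
    by apply: measurable_funB; apply: measurable_funM.
  by apply: measurable_funD; apply: measurable_funM.
+ by apply: filterS fg => z ->.
Qed.

(** Only the term of index 0 of the power series survives, since [0 ^+ 0 = 1]. This turns conditions
    at 0 and infinity into conditions on means. *)
Lemma disc_ext0 f : disc_ext f 0 = cintegral f.
Proof.
rewrite /disc_ext; apply: (@cvg_lim C^o) => //; apply: cvg_near_cst; near=> N.
rewrite seriesEnat /=; have -> : N = N.-1.+1 by rewrite prednK //; near: N; exact: nbhs_infty_gt.
rewrite big_nat_recl // big1 ?addr0 => [|i _]; last by rewrite expr0n mulr0.
rewrite expr0 mulr1 /fourier_coef oppr0; congr cintegral; apply/funext => z.
by rewrite expr0z mulr1.
Unshelve. all: by end_near. Qed.

End holomorphic.

(** * Constant matrices *)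

Section adjoint.
Context {R : realType}.
Local Notation C := R[i].

Lemma adjM m n p (A : 'M[C]_(m, n)) (B : 'M[C]_(n, p)) : (A *m B)^t* = B^t* *m A^t*.
Proof. by rewrite trmx_mul map_mxM. Qed.

Lemma adjD m n (A B : 'M[C]_(m, n)) : (A + B)^t* = A^t* + B^t*.
Proof. by rewrite linearD /= map_mxD. Qed.

Lemma adjN m n (A : 'M[C]_(m, n)) : (- A)^t* = - A^t*.
Proof. by rewrite linearN /= map_mxN. Qed.

Lemma adjB m n (A B : 'M[C]_(m, n)) : (A - B)^t* = A^t* - B^t*.
Proof. by rewrite adjD adjN. Qed.

Lemma adjZ m n a (A : 'M[C]_(m, n)) : (a *: A)^t* = a^* *: A^t*.
Proof. by rewrite linearZ /= map_mxZ. Qed.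

Lemma adj1 n : (1%:M : 'M[C]_n)^t* = 1%:M.
Proof. by rewrite trmx1 map_mx1. Qed.

Lemma adj0 m n : (0 : 'M[C]_(m, n))^t* = 0.
Proof. by rewrite trmx0 map_mx0. Qed.

Lemma adjE m n (A : 'M[C]_(m, n)) i j : A^t* i j = (A j i)^*.
Proof. by rewrite !mxE. Qed.

Lemma adj_inv n (A : 'M[C]_n) : (invmx A)^t* = invmx (A^t*).
Proof. by rewrite trmx_inv map_invmx. Qed.

Lemma adj_block m1 m2 n1 n2 (A : 'M[C]_(m1, n1)) (B : 'M[C]_(m1, n2)) (D : 'M[C]_(m2, n1)) (E : 'M[C]_(m2, n2)) :
  (block_mx A B D E)^t* = block_mx (A^t*) (D^t*) (B^t*) (E^t*).
Proof. by rewrite tr_block_mx map_block_mx. Qed.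

Lemma det_adj n (A : 'M[C]_n) : \det (A^t*) = (\det A)^*.
Proof. by rewrite det_map_mx det_tr. Qed.

Lemma unitmx_adj n (A : 'M[C]_n) : (A^t* \in unitmx) = (A \in unitmx).
Proof. by rewrite map_unitmx unitmx_tr. Qed.

Lemma unitarymxPl n (M : 'M[C]_n) : M \is unitarymx -> M^t* *m M = 1%:M.
Proof. by move/unitarymxP/mulmx1C. Qed.

Lemma unitarymx_adjP n (M : 'M[C]_n) : M^t* *m M = 1%:M -> M \is unitarymx.
Proof. by move/mulmx1C/unitarymxP. Qed.

Lemma unitary1 n : (1%:M : 'M[C]_n) \is unitarymx.
Proof. by apply/unitarymxP; rewrite adj1 mulmx1. Qed.

Definition hs2 m n (M : 'M[C]_(m, n)) : R := \sum_i \sum_j Normc.normc (M i j) ^+ 2.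

Lemma hsnorm2 m n (M : 'M[C]_(m, n)) : hsnorm M ^+ 2 = hs2 M.
Proof.
by rewrite /hsnorm sqr_sqrtr // sumr_ge0 // => i _; rewrite sumr_ge0 // => j _; rewrite sqr_ge0.
Qed.

Lemma hs2_ge0 m n (M : 'M[C]_(m, n)) : 0 <= hs2 M.
Proof. by rewrite -hsnorm2 sqr_ge0. Qed.

Lemma hs2E m n (M : 'M[C]_(m, n)) : (hs2 M)%:C = \tr (M *m M^t*).
Proof.
rewrite /hs2 rmorph_sum; apply: eq_bigr => i _; rewrite rmorph_sum mxE.
by apply: eq_bigr => j _; rewrite adjE -normc2J.
Qed.

Lemma hs2_adj m n (M : 'M[C]_(m, n)) : hs2 (M^t*) = hs2 M.
Proof. by apply: (@complexI R); rewrite !hs2E trmxCK mxtrace_mulC. Qed.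

Lemma hs2_unitaryl m n (U : 'M[C]_m) (M : 'M[C]_(m, n)) : U \is unitarymx ->
  hs2 (U *m M) = hs2 M.
Proof.
move=> /unitarymxPl hU; apply: (@complexI R).
by rewrite !hs2E adjM mxtrace_mulC -mulmxA (mulmxA (U^t*)) hU mul1mx mxtrace_mulC.
Qed.

Lemma hs2_unitaryr m n (U : 'M[C]_n) (M : 'M[C]_(m, n)) : U \is unitarymx ->
  hs2 (M *m U) = hs2 M.
Proof.
move=> /unitarymxP hU; apply: (@complexI R).
by rewrite !hs2E adjM mulmxA -(mulmxA M) hU mulmx1.
Qed.

Lemma le_hs2_entry m n (M : 'M[C]_(m, n)) i j : Normc.normc (M i j) ^+ 2 <= hs2 M.
Proof.
rewrite /hs2 (bigD1 i) //= (bigD1 j) //= -addrA lerDl addr_ge0 //.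
  by apply: sumr_ge0 => k _; rewrite sqr_ge0.
by apply: sumr_ge0 => k _; apply: sumr_ge0 => l _; rewrite sqr_ge0.
Qed.

Lemma hs2_eq0 m n (M : 'M[C]_(m, n)) : hs2 M = 0 -> M = 0.
Proof.
move=> h; apply/matrixP => i j; rewrite mxE; apply: Normc.eq0_normc; apply/eqP.
by rewrite -sqrf_eq0 eq_le sqr_ge0 andbT -h le_hs2_entry.
Qed.

Lemma hs2_row n (v : 'rV[C]_n) : (hs2 v)%:C = (v *m v^t*) 0 0.
Proof. by rewrite hs2E trace_mx11. Qed.

Lemma hs2_mulmx m n p (A : 'M[C]_(m, n)) (B : 'M[C]_(n, p)) :
  hs2 (A *m B) <= hs2 A * hs2 B.
Proof.
have cs i j : Normc.normc ((A *m B) i j) ^+ 2 <=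
    (\sum_k Normc.normc (A i k) ^+ 2) * (\sum_k Normc.normc (B k j) ^+ 2).
  have := CauchySchwarz (@dotmx C n) (row i A) ((col j B)^t*).
  case=> + _; rewrite /= !dotmxE -!hs2_row trmxCK.
  have -> : (row i A *m col j B) 0 0 = (A *m B) i j.
    by rewrite !mxE; apply: eq_bigr => k _; rewrite !mxE.

  have -> : hs2 ((col j B)^t* : 'rV[C]_n) = \sum_k Normc.normc (B k j) ^+ 2.
    by rewrite hs2_adj /hs2; apply: eq_bigr => k _; rewrite big_ord1 mxE.
  have -> : hs2 (row i A) = \sum_k Normc.normc (A i k) ^+ 2.
    by rewrite /hs2 big_ord1; apply: eq_bigr => k _; rewrite mxE.
  rewrite -add_Re2_Im2 -normc2E -rmorphM lecR mulrC //.
rewrite {1}/hs2; apply: le_trans (_ : \sum_i \sum_j (\sum_k Normc.normc (A i k) ^+ 2) * (\sum_k Normc.normc (B k j) ^+ 2) <= _).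
  by apply: ler_sum => i _; apply: ler_sum => j _; exact: cs.
rewrite /hs2 mulr_suml; apply: ler_sum => i _.
by rewrite -mulr_sumr [X in _ <= _ * X]exchange_big.
Qed.

End adjoint.

(** * Triangular matrices with positive diagonal *)

Section triangular.
Context {R : realType}.
Local Notation C := R[i].

(* position of [i] for which both kinds of triangularity become [M i j = 0]
   whenever [i] precedes [j] *)
Definition tpos n (a : 'I_2) (i : 'I_n) : nat := if a == 0 then (n - i)%N else i.

Definition triangular n a (M : 'M[C]_n) := forall i j, (tpos a i < tpos a j)%N -> M i j = 0.

Lemma tpos_inj n a : injective (@tpos n a).
Proof.
move=> i j; rewrite /tpos; case: ifP => _ h; apply: val_inj => //=.
by have := ltn_ord i; have := ltn_ord j; lia.
Qed.

Lemma triG_triangular n a (M : 'M[C]_n) :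
  triG a M <-> triangular a M /\ forall i, 0 < M i i.
Proof.
rewrite /triG /triangular /tpos /=; split=> -[h p]; split=> //; move: h; case: (a == 0).
- move/is_trig_mxP => h i j lt; have := h j i; rewrite mxE; apply.
  by have := ltn_ord i; have := ltn_ord j; lia.
- by move/is_trig_mxP.
- move=> h; apply/is_trig_mxP => i j lt; rewrite mxE; apply: h.
  by have := ltn_ord i; have := ltn_ord j; lia.
- by move=> h; apply/is_trig_mxP.
Qed.

Lemma triangular_det n a (M : 'M[C]_n) : triangular a M -> \det M = \prod_i M i i.
Proof.
rewrite /triangular /tpos; case: (a == 0) => h.
  rewrite -det_tr det_trig; first by apply: eq_bigr => i _; rewrite mxE.
  apply/is_trig_mxP => i j lt; rewrite mxE; apply: h.
  by have := ltn_ord i; have := ltn_ord j; lia.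
by rewrite det_trig //; apply/is_trig_mxP.
Qed.

Lemma triangularM_diag n a (M N : 'M[C]_n) i : triangular a M -> triangular a N ->
  (M *m N) i i = M i i * N i i.
Proof.
move=> hM hN; rewrite mxE (bigD1 i) //= big1 ?addr0 // => k ki.
case: (ltngtP (tpos a i) (tpos a k)) => [/hM ->|/hN ->|/tpos_inj ik]; rewrite ?mul0r ?mulr0 //.
by rewrite ik eqxx in ki.
Qed.

Lemma triangularM n a (M N : 'M[C]_n) : triangular a M -> triangular a N ->
  triangular a (M *m N).
Proof.
move=> hM hN i j ij; rewrite mxE big1 // => k _.
case: (ltnP (tpos a i) (tpos a k)) => [/hM ->|ki]; first by rewrite mul0r.
by rewrite (hN k j) ?mulr0 // (leq_ltn_trans ki).
Qed.

Lemma triG_mul n a (M N : 'M[C]_n) : triG a M -> triG a N -> triG a (M *m N).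
Proof.
move=> /triG_triangular [hM pM] /triG_triangular [hN pN]; apply/triG_triangular; split.
  exact: triangularM.
by move=> i; rewrite (triangularM_diag _ hM hN) mulr_gt0.
Qed.

Lemma triG_det n a (M : 'M[C]_n) : triG a M -> \det M = \prod_i M i i.
Proof. by move=> /triG_triangular [/triangular_det]. Qed.

Lemma triG_det_gt0 n a (M : 'M[C]_n) : triG a M -> 0 < \det M.
Proof. by move=> h; rewrite (triG_det h); apply: prodr_gt0 => i _; case: h. Qed.

Lemma triG_unit n a (M : 'M[C]_n) : triG a M -> M \in unitmx.
Proof. by move=> /triG_det_gt0 h; rewrite unitmxE unitfE gt_eqF. Qed.

Lemma triG1 n a : triG a (1%:M : 'M[C]_n).
Proof.
apply/triG_triangular; split=> [i j|i]; rewrite mxE; last by rewrite eqxx.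
by case: eqVneq => // ->; rewrite ltnn.
Qed.

Lemma triG_inv n a (M : 'M[C]_n) : triG a M -> triG a (invmx M).
Proof.
move=> hM; have uM := triG_unit hM; move: hM => /triG_triangular [hM pM].
have hX : triangular a (invmx M).
  (* Substitution along the order [tpos]: in the entry [i], [j] of [M *m invmx M], the terms after
     [i] vanish because [M] is triangular and those before [i] by induction. *)
  move=> i j; have [k] := ubnP (tpos a i); elim: k i => // k IH i; rewrite ltnS => ik ij.
  have := congr1 (fun A : 'M[C]_n => A i j) (mulmxV uM); rewrite !mxE.
  have /negbTE -> : i != j by apply: contraTneq ij => ->; rewrite ltnn.
  rewrite (bigD1 i) //= big1 ?addr0 => [/eqP|l li].
    by rewrite mulf_eq0 gt_eqF //= => /eqP.
  case: (ltngtP (tpos a i) (tpos a l)) => [/hM ->|il|/tpos_inj il]; rewrite ?mul0r //.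
    by rewrite IH ?mulr0 //; [exact: leq_trans il ik|exact: ltn_trans il ij].
  by rewrite il eqxx in li.
apply/triG_triangular; split=> // i.
have := congr1 (fun A : 'M[C]_n => A i i) (mulmxV uM); rewrite (triangularM_diag _ hM hX) !mxE eqxx.
by move=> e; rewrite -(@pmulr_rgt0 _ (M i i)) // e ltr01.
Qed.

(** The inverse is the adjoint and lies in the same group, so [M] is triangular in both directions,
    hence diagonal, with positive entries of modulus 1. It serves to identify two Cholesky
    factors. *)
Lemma triG_unitary n a (M : 'M[C]_n) : triG a M -> M \is unitarymx -> M = 1%:M.
Proof.
move=> hM uM; have := triG_inv hM; rewrite invmx_unitary //.
move: hM => /triG_triangular [hM pM] /triG_triangular [hI _].
have od i j : i != j -> M i j = 0.
  move=> ij; case: (ltngtP (tpos a i) (tpos a j)) => [/hM //|/hI|/tpos_inj e].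
    by rewrite adjE => /eqP; rewrite conjC_eq0 => /eqP.
  by rewrite e eqxx in ij.
apply/matrixP => i j; rewrite mxE; case: eqVneq => [<-|/od //].
have := congr1 (fun A : 'M[C]_n => A i i) (unitarymxP uM); rewrite !mxE eqxx.
rewrite (bigD1 i) //= big1 ?addr0 => [|k ki]; last by rewrite od ?mul0r // eq_sym.
rewrite !mxE geC0_conj ?ltW // -expr2 => /eqP; rewrite sqrf_eq1 => /orP[/eqP //|/eqP e].
by have := pM i; rewrite e ltr0N1.
Qed.

End triangular.

(** * Cholesky factorization *)

Section cholesky.
Context {R : realType}.
Local Notation C := R[i].

Definition posdef n (P : 'M[C]_n) := P^t* = P /\
  forall v : 'rV[C]_n, v != 0 -> 0 < (v *m P *m v^t*) 0 0.

Lemma row_sq_gt0 n (v : 'rV[C]_n) : v != 0 -> 0 < (v *m v^t*) 0 0.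
Proof.
move=> v0; rewrite -hs2_row ltcR lt_neqAle hs2_ge0 andbT eq_sym.
by apply: contra v0 => /eqP /hs2_eq0 ->.
Qed.

Lemma row_sq_ge0 n (v : 'rV[C]_n) : 0 <= (v *m v^t*) 0 0.
Proof. by rewrite -hs2_row lecR hs2_ge0. Qed.

Lemma mxsubE m n (A B : 'M[C]_(m, n)) i j : (A - B) i j = A i j - B i j.
Proof. by rewrite !mxE. Qed.

Lemma mxaddE m n (A B : 'M[C]_(m, n)) i j : (A + B) i j = A i j + B i j.
Proof. by rewrite mxE. Qed.

Lemma hs2_0 m n : hs2 (0 : 'M[C]_(m, n)) = 0.
Proof.
rewrite /hs2 big1 // => i _; rewrite big1 // => j _.
by rewrite mxE Normc.normc0 expr0n.
Qed.

Lemma posdef1D m n (A : 'M[C]_(n, m)) : posdef (1%:M + A *m A^t*).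
Proof.
split; first by rewrite adjD adj1 adjM trmxCK.
move=> v v0; rewrite mulmxDr mulmx1 mulmxDl mulmxA -mulmxA -adjM.
by rewrite mxaddE ltr_wpDr ?row_sq_gt0 ?row_sq_ge0.
Qed.

Lemma posdef_unit n (P : 'M[C]_n) : posdef P -> P \in unitmx.
Proof.
move=> [_ pP]; rewrite unitmxE unitfE; apply/det0P => -[v v0 vP].
by have := pP v v0; rewrite vP mul0mx mxE ltxx.
Qed.

Lemma posdef_inv n (P : 'M[C]_n) : posdef P -> posdef (invmx P).
Proof.
move=> hP; have uP := posdef_unit hP; case: hP => aP pP; split.
  by rewrite adj_inv aP.
move=> v v0; have -> : v *m invmx P *m v^t* = (v *m invmx P) *m P *m (v *m invmx P)^t*.
  by rewrite mulmxKV // adjM adj_inv aP -mulmxA mulmxA.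
by apply: pP; apply: contra v0 => /eqP e; rewrite -(mulmxKV uP v) e mul0mx.
Qed.

Lemma cholesky_lower n (P : 'M[C]_n) : posdef P ->
  exists2 L, triG (1 : 'I_2) L & L *m L^t* = P.
Proof.
elim: n P => [|n IH] P [aP pP].
  by exists 1%:M; [exact: triG1|apply/matrixP => -[]].
move: P aP pP; rewrite -[n.+1]/(1 + n)%N => P aP pP.
pose p := ulsubmx P 0 0; pose c := dlsubmx P; pose Q := drsubmx P.
have eP : P = block_mx p%:M (c^t*) c Q.
  rewrite -[LHS]submxK; congr block_mx; first by rewrite [LHS]mx11_scalar.
  by rewrite /c -[in LHS]aP -[P in LHS]submxK adj_block block_mxKur.
have aQ : Q^t* = Q.
  by move: aP; rewrite eP adj_block => /eq_block_mx [].
have p0 : 0 < p.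
  have v0 : row_mx 1%:M 0 != 0 :> 'rV[C]_(1 + n).
    apply/eqP => /(congr1 lsubmx); rewrite row_mxKl => /matrixP/(_ 0 0).
    by rewrite !mxE /= => /eqP; rewrite oner_eq0.
  have := pP _ v0; rewrite eP mul_row_block !mul1mx !mul0mx !addr0.
  rewrite tr_row_mx map_col_mx mul_row_col adj1 adj0 mulmx1 mulmx0 addr0 mxE eqxx mulr1n.
  exact.
(* The Schur complement of the corner [p]; its factor becomes the lower right block of the factor of
   [P]. *)
pose S := Q - p^-1 *: (c *m c^t*).
have pJ : (p^-1)^* = p^-1 by rewrite geC0_conj // invr_ge0 ltW.
have pS : posdef S.
  split; first by rewrite adjB adjZ adjM trmxCK aQ pJ.
  (* This [x] makes the first block of [row_mx x w *m P] vanish, so the form of [P] at [row_mx x w]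
     is that of [S] at [w]. *)
  move=> w w0; pose x : 'M[C]_1 := - (p^-1 *: (w *m c)).
  have v0 : row_mx x w != 0.
    by apply: contra w0 => /eqP /(congr1 rsubmx); rewrite row_mxKr linear0 => ->.
  have := pP _ v0; rewrite {1}eP mul_row_block.
  have -> : x *m p%:M + w *m c = 0.
    by rewrite mul_mx_scalar /x scalerN scalerA mulfV ?gt_eqF // scale1r addNr.
  have -> : x *m c^t* + w *m Q = w *m S.
    by rewrite /x /S mulNmx mulmxBr -scalemxAl -scalemxAr mulmxA addrC.
  by rewrite tr_row_mx map_col_mx mul_row_col mul0mx add0r.
have [L' tL' eL'] := IH _ pS.
pose s := sqrtC p; have s0 : 0 < s by rewrite sqrtC_gt0.
have ss : s * s = p by rewrite -expr2 sqrtCK.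
have sJ : s^* = s by rewrite geC0_conj // ltW.
exists (block_mx s%:M 0 (s^-1 *: c) L').
  move: tL' => [/= tL' dL']; split.
    by rewrite is_trig_block_mx //= eqxx /= tL' andbT mx11_is_trig.
  move=> i; case: (split_ordP i) => j ->.
    by rewrite block_mxEul mxE eqxx.
  by rewrite block_mxEdr.
rewrite adj_block mulmx_block adj0 mulmx0 mul0mx !mulmx0 !addr0 adjZ eL' eP /=.
rewrite !rmorphV ?unitfE ?gt_eqF //= sJ -/s.
have -> : (s%:M : 'M[C]_1)^t* = s%:M by rewrite tr_scalar_mx map_scalar_mx /= sJ.
congr block_mx.
- by rewrite -scalar_mxM ss.
- by rewrite -scalemxAr mul_scalar_mx scalerA mulVf ?gt_eqF // scale1r.
- by rewrite -scalemxAl mul_mx_scalar scalerA mulVf ?gt_eqF // scale1r.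
- rewrite -scalemxAl -scalemxAr scalerA -invfM ss /S addrC subrK //.
Qed.

Lemma invmx_mul n (A B : 'M[C]_n) : A \in unitmx -> B \in unitmx ->
  invmx (A *m B) = invmx B *m invmx A.
Proof.
move=> uA uB; have uAB : A *m B \in unitmx by rewrite unitmx_mul uA.
by rewrite -[RHS](mulKmx uAB) -(mulmxA A) mulKVmx // mulmxV // mulmx1.
Qed.

Lemma triG_adj n (M : 'M[C]_n) : triG (1 : 'I_2) M -> triG (0 : 'I_2) (M^t*).
Proof.
move=> [tM pM]; split=> [|i]; last by have h := pM i; rewrite adjE geC0_conj ?ltW.
apply/is_trig_mxP => i j ij; rewrite !mxE; move/is_trig_mxP: tM => -> //.
by rewrite conjC0.
Qed.

(** The upper triangular case comes from a lower triangular factor [L] of the inverse of [P]: the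
    inverse of [L^t*] is upper triangular and factors [P]. *)
Lemma cholesky n a (P : 'M[C]_n) : posdef P -> exists2 L, triG a L & L *m L^t* = P.
Proof.
move=> pP; have -> : a = if a == 0 then 0 else 1 :> 'I_2.
  by case: a => -[|[|//]] h; apply: val_inj.
case: ifP => _; last exact: cholesky_lower.
have [L tL eL] := cholesky_lower (posdef_inv pP).
have uL := triG_unit tL.
exists (invmx (L^t*)); first exact: triG_inv (triG_adj tL).
by rewrite adj_inv trmxCK -[RHS]invmxK -eL invmx_mul // unitmx_adj.
Qed.

End cholesky.

(** * The special unitary matrix with a given upper right block *)

Section Ymx.
Context {R : realType} {n : nat}.
Local Notation C := R[i].
Implicit Types (alpha : 'I_2 -> 'I_2) (F : 'M[C]_n) (Y : 'M[C]_(n + n)).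

(** Rescaling [x] to norm 1 turns the supremum into a quadratic bound with [q = sup S ^+ 2], from
    which positive definiteness can be read off. *)
Lemma contractiveP F : contractive F ->
  exists2 q : R, 0 <= q < 1 & forall x : 'cV[C]_n, hs2 (F *m x) <= q * hs2 x.
Proof.
rewrite /contractive /= /opnorm; set S := (X in sup X) => h.
have S0 : S 0.
  exists 0; rewrite ?mulmx0 /=.
    by rewrite -(@ler_pXn2r _ 2) ?nnegrE ?sqrtr_ge0 // hsnorm2 hs2_0 expr1n.
  by apply/eqP; rewrite -sqrf_eq0 hsnorm2 hs2_0.
have hS : has_sup S.
  split; first by exists 0.
  exists (hsnorm F) => _ [x hx <-]; rewrite -(@ler_pXn2r _ 2) ?nnegrE ?sqrtr_ge0 // !hsnorm2.
  apply: le_trans (hs2_mulmx _ _) _; rewrite ler_piMr ?hs2_ge0 // -hsnorm2.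
  by rewrite -[leRHS](expr1n _ 2) ler_pXn2r ?nnegrE ?sqrtr_ge0.
have s0 : 0 <= sup S by exact: ub_le_sup (hS.2) _ S0.
exists (sup S ^+ 2); first by rewrite sqr_ge0 /= exprn_ilt1.
move=> x; have [/hs2_eq0 ->|x0] := eqVneq (hs2 x) 0.
  by rewrite mulmx0 hs2_0 mulr0.
have xp : 0 < hs2 x by rewrite lt_neqAle eq_sym x0 hs2_ge0.
pose t := (hsnorm x)^-1; have tp : 0 < t.
  by rewrite invr_gt0 lt_neqAle sqrtr_ge0 andbT eq_sym -sqrf_eq0 hsnorm2.
have tJ : (t%:C)^* = t%:C by apply: complex_ext; rewrite ?cReJ ?cImJ /= ?oppr0.
have hZ m k (A : 'M[C]_(m, k)) : hs2 (t%:C *: A) = t ^+ 2 * hs2 A.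
  apply: (@complexI R); rewrite rmorphM !hs2E adjZ -scalemxAl -scalemxAr scalerA linearZ /=.
  by rewrite tJ -rmorphM -expr2 -(hs2E A).
have hx1 : hs2 (t%:C *: x) = 1.
  by rewrite hZ /t -hsnorm2 exprVn mulVf // sqrf_eq0 -sqrf_eq0 hsnorm2.
have : hsnorm (F *m (t%:C *: x)) <= sup S.
  apply: ub_le_sup (hS.2) _ _; exists (t%:C *: x) => //=.
  by rewrite -(@ler_pXn2r _ 2) ?nnegrE ?sqrtr_ge0 // hsnorm2 hx1 expr1n.
rewrite -(@ler_pXn2r _ 2) ?nnegrE ?sqrtr_ge0 // hsnorm2 -scalemxAr hZ.
by rewrite {1}/t exprVn hsnorm2 mulrC ler_pdivrMr.
Qed.

Lemma contractive_posdef F : contractive F -> posdef (1%:M - F^t* *m F).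
Proof.
move=> /contractiveP [q /andP[q0 q1] hq]; split; first by rewrite adjB adj1 adjM trmxCK.
move=> v v0; rewrite mulmxBr mulmx1 mulmxBl mulmxA.
have -> : v *m F^t* *m F *m v^t* = (F *m v^t*)^t* *m (F *m v^t*).
  by rewrite adjM trmxCK mulmxA.
rewrite mxsubE.
have e : ((F *m v^t*)^t* *m (F *m v^t*)) 0 0 = (hs2 (F *m v^t*))%:C.
  by rewrite -[X in _ *m X]trmxCK -hs2_row hs2_adj.
rewrite e -hs2_row -rmorphB /= ltcR subr_gt0; apply: le_lt_trans (hq _) _.
rewrite hs2_adj gtr_pMl //; have := row_sq_gt0 v0; by rewrite -hs2_row ltcR.
Qed.

(** Multiplying [Y] by the block matrix with rows [E^t*], [0] and [F^t*], [1%:M] gives a block upper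
    triangular matrix, whence [\det Y * \det E = \det H]. So [\det Y] is positive, and it has
    modulus 1: unitarity and triangularity of the blocks already put [Y] in SU(2n). *)
Lemma block_unitary_det1 a b Y : Y \is unitarymx -> triG a (ulsubmx Y) -> triG b (drsubmx Y) ->
  \det Y = 1.
Proof.
move=> uY /triG_det_gt0 dE /triG_det_gt0 dH; move: (uY) => /unitarymxP.
have e := submxK Y; set E := ulsubmx Y in dE e *; set H := drsubmx Y in dH e *.
set F := ursubmx Y in e; set G := dlsubmx Y in e.
rewrite -e adj_block mulmx_block scalar_mx_block => /eq_block_mx [e1 _ e3 _].
have h : block_mx E F G H *m block_mx (E^t*) 0 (F^t*) 1%:M = block_mx 1%:M F 0 H.
  by rewrite mulmx_block e1 e3 !mulmx0 !mulmx1 !add0r.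
move/(congr1 determinant): h; rewrite det_mulmx det_lblock det_ublock !det1 mulr1 mul1r.
rewrite e det_adj geC0_conj ?ltW // => h.
have dY0 : 0 < \det Y by rewrite -(pmulr_lgt0 _ dE) h.
have := congr1 determinant (unitarymxP uY); rewrite det_mulmx det_adj geC0_conj ?ltW // det1.
move/eqP; rewrite -expr2 sqrf_eq1 => /orP[/eqP //|/eqP e'].
by move: dY0; rewrite e' ltr0N1.
Qed.

Lemma Ymx_exists alpha F : contractive F -> exists Y, [/\ SUgroup Y, ursubmx Y = F,
  triG (alpha 0) (ulsubmx Y) & triG (alpha 1) (drsubmx Y)].
Proof.
move=> /contractive_posdef pF.
have [K tK eK] := cholesky (alpha 1) (posdef_inv pF).
have uK := triG_unit tK; have uKJ : K^t* \in unitmx by rewrite unitmx_adj.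
have uP := posdef_unit pF.
set P := 1%:M - _ in pF uP eK.
(* [X] is the inverse of [1%:M - F *m F^t*], which is thereby positive definite and has a Cholesky
   factor [E]. *)
pose X := 1%:M + F *m K *m (F *m K)^t*.
have pX : posdef X by exact: posdef1D.
have XP : X *m (1%:M - F *m F^t*) = 1%:M.
  have h : F^t* *m (1%:M - F *m F^t*) = P *m F^t*.
    by rewrite /P mulmxBr mulmxBl mulmx1 mul1mx mulmxA.
  rewrite mulmxDl mul1mx adjM !mulmxA -(mulmxA F) eK -!mulmxA h.
  by rewrite (mulKmx uP) subrK.
have [E tE eE] := cholesky (alpha 0) (posdef_inv pX).
have iX : invmx X = 1%:M - F *m F^t*.
  by rewrite -[RHS](mulKmx (posdef_unit pX)) XP mulmx1.
(* Forced by the orthogonality of the two block columns, the lower right block being [invmx K]. *)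
pose G := - (K^t* *m F^t* *m E).
exists (block_mx E F G (invmx K)).
have uY : block_mx E F G (invmx K) \is unitarymx.
  apply: unitarymx_adjP; rewrite adj_block mulmx_block scalar_mx_block.
  have GJ : G^t* = - (E^t* *m F *m K) by rewrite /G adjN !adjM !trmxCK mulmxA.
  have eHH : (invmx K)^t* *m invmx K = P.
    by rewrite adj_inv -[RHS]invmxK -eK invmx_mul.
  have e21 : E^t* *m F + G^t* *m invmx K = 0.
    by rewrite GJ mulNmx (mulmxK uK) subrr.
  have e11 : E^t* *m E + G^t* *m G = 1%:M.
    have -> : E^t* *m E + G^t* *m G = E^t* *m (X *m E).
      by rewrite GJ /G mulNmx mulmxN opprK /X mulmxDl mul1mx mulmxDr adjM !mulmxA.
    by apply: mulmx1C; rewrite -mulmxA eE iX XP.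
  have e12 : F^t* *m E + (invmx K)^t* *m G = 0.
    by rewrite -[LHS]trmxCK adjD !adjM !trmxCK e21 adj0.
  by rewrite e11 e21 e12 eHH /P addrC subrK.
have t1 : triG (alpha 0) (ulsubmx (block_mx E F G (invmx K))) by rewrite block_mxKul.
have t2 : triG (alpha 1) (drsubmx (block_mx E F G (invmx K))).
  by rewrite block_mxKdr; exact: triG_inv.
split=> //; last by rewrite block_mxKur.
by split=> //; exact: block_unitary_det1 t1 t2.
Qed.

Lemma YmxP alpha F : contractive F ->
  [/\ SUgroup (Ymx alpha F), ursubmx (Ymx alpha F) = F,
      triG (alpha 0) (ulsubmx (Ymx alpha F)) & triG (alpha 1) (drsubmx (Ymx alpha F))].
Proof. by move=> /(Ymx_exists alpha) [Y hY]; rewrite /Ymx; case: xgetP => [_ _ //|/(_ Y) /(_ hY)]. Qed.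

(** From [|F x|^2 + |H x|^2 = |x|^2] and [|x|^2 <= k * |H x|^2], the square of the norm of [F] is at
    most [1 - k^-1]; the summand 1 in [k] keeps this number nonnegative. *)
Lemma contractive_of_inv F H : H \in unitmx -> F^t* *m F + H^t* *m H = 1%:M -> contractive F.
Proof.
move=> uH e; pose k := hs2 (invmx H) + 1.
have k1 : 1 <= k by rewrite /k lerDr hs2_ge0.
have k0 : 0 < k by exact: lt_le_trans ltr01 k1.
have hx (x : 'cV[C]_n) : hs2 (F *m x) <= (1 - k^-1) * hs2 x.
  have h1 : hs2 (F *m x) + hs2 (H *m x) = hs2 x.
    have q m p (A : 'M[C]_(m, p)) : (hs2 A)%:C = \tr (A^t* *m A).
      by rewrite -hs2_adj hs2E trmxCK.
    apply: (@complexI R); rewrite rmorphD /= !q !adjM -linearD /=.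
    by rewrite !mulmxA -mulmxDl -!(mulmxA (x^t*)) -mulmxDr e mulmx1.
  have h2 : k^-1 * hs2 x <= hs2 (H *m x).
    rewrite mulrC ler_pdivrMr // mulrC; rewrite -{1}(mulKmx uH x).
    apply: le_trans (hs2_mulmx _ _) _; rewrite ler_wpM2r ?hs2_ge0 // /k lerDl //.
  lra.
rewrite /contractive /= /opnorm.
have q0 : 0 <= 1 - k^-1 by rewrite subr_ge0 invf_le1.
apply: (@le_lt_trans _ _ (Num.sqrt (1 - k^-1))); last first.
  by rewrite -[ltRHS]sqrtr1 ltr_sqrt // ltrBlDr ltrDl invr_gt0.
apply: ge_sup.
  exists (hsnorm (F *m (0 : 'cV[C]_n))); exists 0 => //=.
  by rewrite -(@ler_pXn2r _ 2) ?nnegrE ?sqrtr_ge0 // hsnorm2 hs2_0 expr1n.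
move=> _ [x hx1 <-]; rewrite -(@ler_pXn2r _ 2) ?nnegrE ?sqrtr_ge0 // hsnorm2 sqr_sqrtr //.
apply: le_trans (hx x) _; rewrite ler_piMr // -hsnorm2.
by rewrite -[leRHS](expr1n _ 2) ler_pXn2r ?nnegrE ?sqrtr_ge0.
Qed.

(** For [F = K *m H], the relation [F^t* *m F + H^t* *m H = 1%:M] amounts to [H *m H^t*] being the
    inverse of [1%:M + K^t* *m K], so [H] is taken as a Cholesky factor. The lower right block of
    [Ymx] satisfies the same relation, hence differs from [H] by a unitary matrix in the triangular
    group, which is the identity. *)
Lemma Ymx_ratio alpha (K : 'M[C]_n) : exists2 F, contractive F &
  F = K *m drsubmx (Ymx alpha F).
Proof.
have pP : posdef (1%:M + K^t* *m K).
  by have := posdef1D (K^t*); rewrite trmxCK.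
have [H tH eH] := cholesky (alpha 1) (posdef_inv pP).
have uH := triG_unit tH; have uP := posdef_unit pP.
have eF : (K *m H)^t* *m (K *m H) + H^t* *m H = 1%:M.
  have h : H *m (H^t* *m (1%:M + K^t* *m K)) = 1%:M by rewrite mulmxA eH mulVmx.
  rewrite -(mulmx1C h) mulmxDr mulmx1 mulmxDl addrC adjM !mulmxA //.
have cF := contractive_of_inv uH eF.
exists (K *m H) => //; congr (_ *m _).
have [[uY _] e1 _ tY] := YmxP alpha cF.
set Y := Ymx alpha _ in uY e1 tY *.
have eY : (K *m H)^t* *m (K *m H) + (drsubmx Y)^t* *m drsubmx Y = 1%:M.
  have := unitarymxPl uY; rewrite -[in X in X -> _](submxK Y) adj_block mulmx_block scalar_mx_block.
  by rewrite e1 => /eq_block_mx [].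
have e : (drsubmx Y)^t* *m drsubmx Y = H^t* *m H by apply: (addrI ((K *m H)^t* *m (K *m H))); rewrite eY eF.
have : drsubmx Y *m invmx H = 1%:M.
  apply: triG_unitary (triG_mul tY (triG_inv tH)) _.
  apply: unitarymx_adjP; rewrite adjM -mulmxA (mulmxA (_ ^t*) (drsubmx Y)) e.
  have uHJ : H^t* \in unitmx by rewrite unitmx_adj.
  by rewrite (mulmxK uH) adj_inv (mulVmx uHJ).
by move/(congr1 (fun A => A *m H)); rewrite mulmxKV // mul1mx.
Qed.

End Ymx.

(** * Diagonal entries of the blocks of Y *)

Section diagonal.
Context {R : realType}.
Local Notation C := R[i].
Implicit Types (alpha : 'I_2 -> 'I_2).

Lemma triangular_eigen n a (M : 'M[C]_n) i : triangular a M ->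
  exists2 v : 'rV[C]_n, v != 0 & v *m M = M i i *: v.
Proof.
move=> tM; have : \det (M - (M i i)%:M) == 0.
  have tN : triangular a (M - (M i i)%:M).
    move=> j k jk; rewrite mxsubE tM // mxE; case: eqVneq jk => [->|_ _]; first by rewrite ltnn.
    by rewrite subrr.
  by rewrite (triangular_det tN) (bigD1 i) //= mxsubE [_%:M _ _]mxE eqxx mulr1n subrr mul0r.
move/det0P => [v v0]; rewrite mulmxBr mul_mx_scalar => /eqP; rewrite subr_eq0 => /eqP h.
by exists v.
Qed.

(* The diagonal entries are eigenvalues, and on a unit eigenvector [v] of [M]
   the square of the eigenvalue is [|vM|^2 = 1 - |vX|^2]. *)
Lemma triangular_diag_ge n m a (M : 'M[C]_n) (X : 'M[C]_(n, m)) i : triangular a M ->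
  M *m M^t* + X *m X^t* = 1%:M -> 1 - hs2 X <= Normc.normc (M i i) ^+ 2.
Proof.
move=> tM e; have [v v0 hv] := triangular_eigen i tM.
have vp : 0 < hs2 v by have := row_sq_gt0 v0; rewrite -hs2_row ltcR.
have h : hs2 (v *m M) + hs2 (v *m X) = hs2 v.
  apply: (@complexI R); rewrite rmorphD /= !hs2_row !adjM -mxaddE.
  by rewrite !mulmxA -mulmxDl -!(mulmxA v) -mulmxDr e mulmx1.
have hZ : hs2 (M i i *: v) = Normc.normc (M i i) ^+ 2 * hs2 v.
  apply: (@complexI R); rewrite rmorphM /= !hs2_row normc2J adjZ -scalemxAl -scalemxAr scalerA.
  by rewrite mxE.
rewrite -(ler_pM2r vp) -hZ -hv mulrBl mul1r lerBlDr -h lerD2l mulrC.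
rewrite h; apply: le_trans (hs2_mulmx _ _) _; by [].
Qed.

Lemma triangular_adj n a (M : 'M[C]_n) : triangular a M ->
  triangular (if a == 0 then 1 else 0) (M^t*).
Proof.
move=> tM i j ij; rewrite adjE tM ?conjC0 //; move: ij; rewrite /tpos.
by have := ltn_ord i; have := ltn_ord j; case: (a == 0) => /=; lia.
Qed.

Lemma unitary_entry_le n (M : 'M[C]_n) i j : M \is unitarymx -> Normc.normc (M i j) ^+ 2 <= 1.
Proof.
move/unitarymxP/(congr1 (fun A : 'M[C]_n => A i i)); rewrite !mxE eqxx mulr1n => e.
have : (\sum_k Normc.normc (M i k) ^+ 2)%:C = 1 :> C.
  by rewrite -e rmorph_sum; apply: eq_bigr => k _; rewrite adjE -normc2J.
move/(congr1 (@complex.Re R)) => /= <-.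
by rewrite (bigD1 j) //= lerDl sumr_ge0 // => k _; rewrite sqr_ge0.
Qed.

Lemma pos_normc (x : C) : 0 < x -> x = (complex.Re x)%:C /\ 0 < complex.Re x.
Proof.
by rewrite ltcE /= => /andP[/eqP h1 h2]; split => //; apply: complex_ext; rewrite /= ?h1.
Qed.

Definition rdiag n (M : 'M[C]_n) i : R := complex.Re (M i i).

Lemma rdiag_normc n a (M : 'M[C]_n) i : triG a M -> Normc.normc (M i i) ^+ 2 = rdiag M i ^+ 2.
Proof.
move=> [_ /(_ i) /pos_normc [h _]].
by rewrite {1}h normc2E /= expr0n addr0.
Qed.

Lemma rdiag_gt0 n a (M : 'M[C]_n) i : triG a M -> 0 < rdiag M i.
Proof. by move=> [_ /(_ i) /pos_normc []]. Qed.

Lemma rdiagE n a (M : 'M[C]_n) i : triG a M -> M i i = (rdiag M i)%:C.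
Proof. by move=> [_ /(_ i) /pos_normc []]. Qed.

Lemma rdiag_mul n a (M N : 'M[C]_n) i : triG a M -> triG a N ->
  rdiag (M *m N) i = rdiag M i * rdiag N i.
Proof.
move=> tM tN; rewrite {1}/rdiag.
have /triG_triangular [hM _] := tM; have /triG_triangular [hN _] := tN.
by rewrite (triangularM_diag _ hM hN) (rdiagE _ tM) (rdiagE _ tN) -rmorphM.
Qed.

Lemma rdiag1 n i : rdiag (1%:M : 'M[C]_n) i = 1.
Proof. by rewrite /rdiag mxE eqxx. Qed.

Lemma triG_det_rdiag n a (M : 'M[C]_n) : triG a M -> \det M = (\prod_i rdiag M i)%:C.
Proof.
by move=> tM; rewrite (triG_det tM) rmorph_prod; apply: eq_bigr => i _; rewrite (rdiagE _ tM).
Qed.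

Section Ymx_bounds.
Context {n : nat} (alpha : 'I_2 -> 'I_2) (F : 'M[C]_n).
Hypothesis cF : contractive F.
Local Notation Y := (Ymx alpha F).

Lemma Ymx_unitary : Y \is unitarymx.
Proof. by have [[]] := YmxP alpha cF. Qed.

Lemma Ymx_det : \det Y = 1.
Proof. by have [[]] := YmxP alpha cF. Qed.

Lemma Ymx_ul : triG (alpha 0) (ulsubmx Y). Proof. by have [] := YmxP alpha cF. Qed.
Lemma Ymx_dr : triG (alpha 1) (drsubmx Y). Proof. by have [] := YmxP alpha cF. Qed.

Lemma Ymx_blockE : Y = block_mx (ulsubmx Y) F (dlsubmx Y) (drsubmx Y).
Proof. by rewrite -[LHS]submxK; have [_ -> _ _] := YmxP alpha cF. Qed.

Lemma Ymx_row : ulsubmx Y *m (ulsubmx Y)^t* + F *m F^t* = 1%:M.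
Proof.
have := unitarymxP Ymx_unitary; rewrite {1 2}Ymx_blockE adj_block mulmx_block scalar_mx_block.
by case/eq_block_mx.
Qed.

Lemma Ymx_col : (drsubmx Y)^t* *m drsubmx Y + F^t* *m F = 1%:M.
Proof.
have := unitarymxPl Ymx_unitary; rewrite {1 2}Ymx_blockE adj_block mulmx_block scalar_mx_block.
by move/eq_block_mx => [_ _ _]; rewrite addrC.
Qed.

Lemma Ymx_ul_le1 i : rdiag (ulsubmx Y) i <= 1.
Proof.
have := unitary_entry_le (lshift n i) (lshift n i) Ymx_unitary.
have -> : Y (lshift n i) (lshift n i) = ulsubmx Y i i by rewrite !mxE.
rewrite (rdiag_normc _ Ymx_ul) -[X in _ <= X](expr1n _ 2) ler_pXn2r // nnegrE //.
by rewrite ltW // (rdiag_gt0 _ Ymx_ul).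
Qed.

Lemma Ymx_dr_le1 i : rdiag (drsubmx Y) i <= 1.
Proof.
have := unitary_entry_le (rshift n i) (rshift n i) Ymx_unitary.
have -> : Y (rshift n i) (rshift n i) = drsubmx Y i i by rewrite !mxE.
rewrite (rdiag_normc _ Ymx_dr) -[X in _ <= X](expr1n _ 2) ler_pXn2r // nnegrE //.
by rewrite ltW // (rdiag_gt0 _ Ymx_dr).
Qed.

(** The square of the entry is at least [1 - hs2 F], and the entry is at most 1, so it dominates its
    square. The defect [hs2 F] is what is summable along an l2 sequence. *)
Lemma Ymx_ul_ge i : 1 - hs2 F <= rdiag (ulsubmx Y) i.
Proof.
have /triG_triangular [tE _] := Ymx_ul.
have := triangular_diag_ge i tE Ymx_row; rewrite (rdiag_normc _ Ymx_ul).
move=> /le_trans; apply; rewrite expr2 ler_piMr ?Ymx_ul_le1 // ltW //.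
exact: rdiag_gt0 Ymx_ul.
Qed.

(** The lower right block obeys a relation between columns, hence the passage to adjoints, which
    exchanges the two kinds of triangularity. *)
Lemma Ymx_dr_ge i : 1 - hs2 F <= rdiag (drsubmx Y) i.
Proof.
have /triG_triangular [/triangular_adj tH _] := Ymx_dr.
have := @triangular_diag_ge _ _ _ _ (F^t*) i tH; rewrite !trmxCK => /(_ Ymx_col).
rewrite hs2_adj adjE.
have -> : Normc.normc ((drsubmx Y i i)^*) ^+ 2 = Normc.normc (drsubmx Y i i) ^+ 2.
  by rewrite !normc2E cReJ cImJ sqrrN.
rewrite (rdiag_normc _ Ymx_dr) => /le_trans; apply; rewrite expr2 ler_piMr ?Ymx_dr_le1 // ltW //.
exact: rdiag_gt0 Ymx_dr.
Qed.

(** The squared diagonal entries sum to at most [hs2 (ulsubmx Y) = n - hs2 F], and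
    [x <= expR (x - 1)] bounds their product by the exponential of a sum. In this form, a lower
    bound on a product of such determinants bounds the sum of the [hs2 (F j)]. *)
Lemma Ymx_ul_prod : (\prod_i rdiag (ulsubmx Y) i) ^+ 2 <= expR (- hs2 F).
Proof.
rewrite -prodrXl.
have h : \sum_i (rdiag (ulsubmx Y) i ^+ 2 - 1) <= - hs2 F.
  have e : hs2 (ulsubmx Y) + hs2 F = n%:R.
    apply: (@complexI R); rewrite rmorphD /= !hs2E -linearD /= Ymx_row mxtrace1.
    by rewrite rmorph_nat.
  have : \sum_i rdiag (ulsubmx Y) i ^+ 2 <= hs2 (ulsubmx Y).
    apply: ler_sum => i _; rewrite -(rdiag_normc _ Ymx_ul) (bigD1 i) //= lerDl.
    by apply: sumr_ge0 => j _; rewrite sqr_ge0.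
  rewrite sumrB sumr_const card_ord -[1 *+ n]/(n%:R) -e; lra.
apply: (@le_trans _ _ (expR (\sum_i (rdiag (ulsubmx Y) i ^+ 2 - 1)))); last by rewrite ler_expR.
rewrite expR_sum; apply: ler_prod => i _; rewrite sqr_ge0 /=.
by have := expR_ge1Dx (rdiag (ulsubmx Y) i ^+ 2 - 1); lra.
Qed.

End Ymx_bounds.
End diagonal.

(** * Conjugation by powers of Z, and partial products *)

Section Zconj.
Context {R : realType} {n : nat}.
Local Notation C := R[i].
Implicit Types (z : circle R) (M : 'M[C]_(n + n)) (alpha : 'I_2 -> 'I_2) (F : nat -> 'M[C]_n).

(** [Z ^ j] times the scalar [z ^ (j / 2)], which cancels in a conjugation. *)
Definition Zd z j : 'M[C]_(n + n) := block_mx (val z ^+ j)%:M 0 0 1%:M.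

Lemma scalar_adj (a : C) m : (a%:M : 'M[C]_m)^t* = (a^*)%:M.
Proof. by rewrite tr_scalar_mx map_scalar_mx. Qed.

Lemma circle_expJ z j : val z ^+ j * (val z ^+ j)^* = 1.
Proof. by rewrite -normc2J circle_normcX expr1n. Qed.

Lemma Zd_unitary z j : Zd z j \is unitarymx.
Proof.
apply/unitarymxP; rewrite /Zd adj_block !adj0 mulmx_block !mulmx0 !mul0mx !addr0 !add0r.
by rewrite adj1 mulmx1 scalar_adj -scalar_mxM circle_expJ -scalar_mx_block.
Qed.

Lemma scalar_block_mul (a b : C) (A B D E : 'M[C]_n) :
  block_mx a%:M 0 0 1%:M *m block_mx A B D E *m block_mx b%:M 0 0 1%:M =
  block_mx ((a * b) *: A) (a *: B) (b *: D) E.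
Proof.
rewrite !mulmx_block !mulmx0 !mul0mx !addr0 !add0r !mulmx1 !mul1mx.
by rewrite !mul_scalar_mx !mul_mx_scalar scalerA (mulrC b).
Qed.

Lemma Zd_adj z j : (Zd z j)^t* = block_mx ((val z ^+ j)^*)%:M 0 0 1%:M.
Proof. by rewrite /Zd adj_block !adj0 adj1 scalar_adj. Qed.

Lemma ZconjE z j M : Zconj z j M = Zd z j *m M *m (Zd z j)^t*.
Proof.
rewrite Zd_adj -[M in RHS]submxK /Zd scalar_block_mul circle_expJ scale1r.
by rewrite rmorphXn /= circle_conjE exprVn.
Qed.

Lemma Zconj_mul z j M M' : Zconj z j (M *m M') = Zconj z j M *m Zconj z j M'.
Proof.
rewrite !ZconjE !mulmxA; congr (_ *m _ *m _).
by rewrite -[RHS]mulmxA unitarymxPl ?mulmx1 ?Zd_unitary.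
Qed.

Lemma Zconj1 z j : Zconj z j (1%:M : 'M[C]_(n + n)) = 1%:M.
Proof. by rewrite ZconjE mulmx1 (unitarymxP (Zd_unitary _ _)). Qed.

Lemma Zconj0 z M : Zconj z 0 M = M.
Proof. by rewrite /Zconj !expr0 invr1 !scale1r submxK. Qed.

Lemma ZconjD z j k M : Zconj z j (Zconj z k M) = Zconj z (j + k) M.
Proof.
rewrite /Zconj block_mxKul block_mxKur block_mxKdl block_mxKdr !scalerA -exprD.
by rewrite -invfM -exprD addnC.
Qed.

Lemma ZconjB z j M M' : Zconj z j (M - M') = Zconj z j M - Zconj z j M'.
Proof. by rewrite !ZconjE mulmxBr mulmxBl. Qed.

Lemma Zconj_unitary z j M : M \is unitarymx -> Zconj z j M \is unitarymx.
Proof.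
move=> uM; rewrite ZconjE; apply: mul_unitarymx; last by rewrite trmxC_unitary Zd_unitary.
exact: mul_unitarymx (Zd_unitary z j) uM.
Qed.

Lemma Zconj_det z j M : \det (Zconj z j M) = \det M.
Proof.
rewrite ZconjE !det_mulmx mulrC mulrA -det_mulmx unitarymxPl ?Zd_unitary //.
by rewrite det1 mul1r.
Qed.

Lemma Zconj_hs2 z j M : hs2 (Zconj z j M) = hs2 M.
Proof.
by rewrite ZconjE hs2_unitaryr ?trmxC_unitary ?Zd_unitary // hs2_unitaryl // Zd_unitary.
Qed.

Definition Zunconj z M := (Zd z 1)^t* *m M *m Zd z 1.

Lemma ZunconjK z M : Zconj z 1 (Zunconj z M) = M.
Proof.
rewrite ZconjE /Zunconj !mulmxA (unitarymxP (Zd_unitary _ _)) mul1mx -mulmxA.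
by rewrite (unitarymxP (Zd_unitary _ _)) mulmx1.
Qed.

Lemma ZunconjE z M : Zunconj z M =
  block_mx (ulsubmx M) ((val z)^* *: ursubmx M) (val z *: dlsubmx M) (drsubmx M).
Proof.
rewrite /Zunconj Zd_adj -[M in LHS]submxK /Zd scalar_block_mul !expr1.
by rewrite [X in X *: ulsubmx _]mulrC circle_conjM scale1r.
Qed.

Lemma Zunconj_unitary z M : M \is unitarymx -> Zunconj z M \is unitarymx.
Proof.
move=> uM; rewrite /Zunconj; apply: mul_unitarymx; last exact: Zd_unitary.
by apply: mul_unitarymx uM; rewrite trmxC_unitary Zd_unitary.
Qed.

Lemma Zunconj_mul z M M' : Zunconj z (M *m M') = Zunconj z M *m Zunconj z M'.
Proof.
rewrite /Zunconj !mulmxA; congr (_ *m _ *m _).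
by rewrite -[RHS]mulmxA (unitarymxP (Zd_unitary _ _)) mulmx1.
Qed.

Definition pprod alpha (F : nat -> 'M[C]_n) N z : 'M[C]_(n + n) :=
  \prod_(0 <= j < N) Zconj z j (Ymx alpha (F j)).

Lemma Zconj_prod z m N (M : nat -> 'M[C]_(n + n)) :
  Zconj z m (\prod_(0 <= j < N) M j) = \prod_(0 <= j < N) Zconj z m (M j).
Proof.
elim: N => [|N IH]; first by rewrite !big_nil [LHS]Zconj1.
by rewrite !big_nat_recr //= -IH -[in LHS]mulmxE Zconj_mul.
Qed.

Lemma pprod_cat alpha F m N z :
  pprod alpha F (m + N) z = pprod alpha F m z *m Zconj z m (pprod alpha (fun j => F (m + j)%N) N z).
Proof.
rewrite /pprod (big_cat_nat (n := m)) ?leq_addr //= Zconj_prod.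
rewrite -{2}[m]add0n big_addn addKn mulmxE; congr (_ * _); apply: eq_bigr => j _.
by rewrite ZconjD addnC.
Qed.

Lemma pprod0 alpha F z : pprod alpha F 0 z = 1%:M.
Proof. by rewrite /pprod big_nil. Qed.

Lemma pprodS alpha F N z : pprod alpha F N.+1 z =
  Ymx alpha (F 0%N) *m Zconj z 1 (pprod alpha (fun j => F j.+1) N z).
Proof. by rewrite -add1n pprod_cat /pprod big_nat1 Zconj0. Qed.

Lemma pprodSr alpha F N z : pprod alpha F N.+1 z =
  pprod alpha F N z *m Zconj z N (Ymx alpha (F N)).
Proof. by rewrite /pprod big_nat_recr //= mulmxE. Qed.

Lemma pprod_unitary alpha F N z : (forall j, contractive (F j)) ->
  pprod alpha F N z \is unitarymx.
Proof.
move=> cF; elim: N => [|N IH]; first by rewrite pprod0 unitary1.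
rewrite pprodSr; exact: mul_unitarymx IH (Zconj_unitary _ _ (Ymx_unitary _ (cF N))).
Qed.

Lemma pprod_det alpha F N z : (forall j, contractive (F j)) -> \det (pprod alpha F N z) = 1.
Proof.
move=> cF; elim: N => [|N IH]; first by rewrite pprod0 det1.
by rewrite pprodSr det_mulmx IH Zconj_det Ymx_det ?mulr1.
Qed.

End Zconj.

(** * Matrix functions and layer stripping *)

Section matrix_functions.
Context {R : realType}.
Local Notation C := R[i].
Local Notation mu := (@circle_prob R).

Definition mbm m n (M : circle R -> 'M[C]_(m, n)) := forall i j, bm (fun z => M z i j).
Definition mhol m n (M : circle R -> 'M[C]_(m, n)) := forall i j, hol (fun z => M z i j).
Definition mcint m n (M : circle R -> 'M[C]_(m, n)) : 'M[C]_(m, n) :=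
  \matrix_(i, j) cintegral (fun z => M z i j).

Lemma mhol_bm m n (M : circle R -> 'M[C]_(m, n)) : mhol M -> mbm M.
Proof. by move=> h i j; exact: hol_bm (h i j). Qed.

Lemma mbm_cst m n (A : 'M[C]_(m, n)) : mbm (fun=> A).
Proof. by move=> i j; exact: bm_cst. Qed.

Lemma mhol_cst m n (A : 'M[C]_(m, n)) : mhol (fun=> A).
Proof. by move=> i j; exact: hol_cst. Qed.

Lemma mcint_cst m n (A : 'M[C]_(m, n)) : mcint (fun=> A) = A.
Proof. by apply/matrixP => i j; rewrite mxE cint_cst. Qed.

Lemma mbmD m n (A B : circle R -> 'M[C]_(m, n)) : mbm A -> mbm B -> mbm (fun z => A z + B z).
Proof. by move=> hA hB i j; under eq_fun do rewrite mxE; exact: bmD. Qed.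

Lemma mbmB m n (A B : circle R -> 'M[C]_(m, n)) : mbm A -> mbm B -> mbm (fun z => A z - B z).
Proof. by move=> hA hB i j; under eq_fun do rewrite mxsubE; exact: bmB. Qed.

Lemma mholD m n (A B : circle R -> 'M[C]_(m, n)) :
  mhol A -> mhol B -> mhol (fun z => A z + B z).
Proof. by move=> hA hB i j; under eq_fun do rewrite mxE; exact: holD. Qed.

Lemma mcintD m n (A B : circle R -> 'M[C]_(m, n)) : mbm A -> mbm B ->
  mcint (fun z => A z + B z) = mcint A + mcint B.
Proof.
move=> hA hB; apply/matrixP => i j; rewrite !mxE -cintD //.
by congr cintegral; apply/funext => z; rewrite mxE.
Qed.

Lemma mbmM m n p (A : circle R -> 'M[C]_(m, n)) (B : circle R -> 'M[C]_(n, p)) :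
  mbm A -> mbm B -> mbm (fun z => A z *m B z).
Proof.
move=> hA hB i j; under eq_fun do rewrite mxE; apply: bm_sum => k; exact: bmM.
Qed.

Lemma mholM m n p (A : circle R -> 'M[C]_(m, n)) (B : circle R -> 'M[C]_(n, p)) :
  mhol A -> mhol B -> mhol (fun z => A z *m B z).
Proof.
move=> hA hB i j; under eq_fun do rewrite mxE; apply: hol_sum => k; exact: holM.
Qed.

Lemma mcint_holM m n p (A : circle R -> 'M[C]_(m, n)) (B : circle R -> 'M[C]_(n, p)) :
  mhol A -> mhol B -> mcint (fun z => A z *m B z) = mcint A *m mcint B.
Proof.
move=> hA hB; apply/matrixP => i j; rewrite !mxE; under eq_fun do rewrite mxE.
rewrite cint_sum => [|k]; last by apply: bmM; exact: hol_bm.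
by apply: eq_bigr => k _; rewrite cint_holM // !mxE.
Qed.

Lemma mcintMl m n p (A : 'M[C]_(m, n)) (B : circle R -> 'M[C]_(n, p)) :
  mbm B -> mcint (fun z => A *m B z) = A *m mcint B.
Proof.
move=> hB; apply/matrixP => i j; rewrite !mxE; under eq_fun do rewrite mxE.
rewrite cint_sum => [|k]; last exact: bmZ.
by apply: eq_bigr => k _; rewrite cintZ // !mxE.
Qed.

Lemma mbm_adj m n (A : circle R -> 'M[C]_(m, n)) : mbm A -> mbm (fun z => (A z)^t*).
Proof. by move=> hA i j; under eq_fun do rewrite adjE; exact: bmJ. Qed.

Lemma mcint_adj m n (A : circle R -> 'M[C]_(m, n)) : mbm A ->
  mcint (fun z => (A z)^t*) = (mcint A)^t*.
Proof.
move=> hA; apply/matrixP => i j; rewrite adjE !mxE -cintJ //.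
by congr cintegral; apply/funext => z; rewrite adjE.
Qed.

Lemma mcint_tr n (A : circle R -> 'M[C]_n) : mbm A ->
  cintegral (fun z => \tr (A z)) = \tr (mcint A).
Proof.
move=> hA; rewrite /mxtrace cint_sum // => *.
by apply: eq_bigr => i _; rewrite mxE.
Qed.

Lemma mbmZ m n (f : circle R -> C) (A : circle R -> 'M[C]_(m, n)) :
  bm f -> mbm A -> mbm (fun z => f z *: A z).
Proof. by move=> hf hA i j; under eq_fun do rewrite mxE; exact: bmM. Qed.

Lemma mhol_mulz m n (A : circle R -> 'M[C]_(m, n)) : mhol A ->
  mhol (fun z => val z *: A z) /\ mcint (fun z => val z *: A z) = 0.
Proof.
move=> hA; have h i j : hol (fun z => A z i j * val z).
  split=> [|k]; first by apply: bmM; [exact: hol_bm|exact: bm_val].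
  by under eq_fun do rewrite -mulrA -exprS; case: (hA i j) => _ ->.
split.
  by move=> i j; under eq_fun do rewrite mxE mulrC; exact: h.
apply/matrixP => i j; rewrite !mxE.
under eq_fun do rewrite mxE mulrC.
by case: (hA i j) => _ /(_ 0%N).
Qed.

(** On the circle the conjugate of [z] is its inverse, and the mean of [A] is what becomes the
    coefficient of index -1 after division by [z]. *)
Lemma mhol_divz m n (A : circle R -> 'M[C]_(m, n)) : mhol A -> mcint A = 0 ->
  mhol (fun z => (val z)^* *: A z).
Proof.
move=> hA A0 i j; split=> [|k].
  under eq_fun do rewrite mxE; apply: bmM; last exact: hol_bm.
  exact: bmJ bm_val.
have -> : (fun z : circle R => ((val z)^* *: A z) i j * val z ^+ k.+1) =
    (fun z => A z i j * val z ^+ k).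
  apply/funext => z; rewrite mxE exprS; have := circle_conjM z.
  move: (val z) (A z i j) => w a hw; rewrite [w^* * a]mulrC -mulrA (mulrA w^*) (mulrC w^*) hw mul1r //.
rewrite hol_exp //; have := congr1 (fun B : 'M[C]_(m, n) => B i j) A0; rewrite !mxE => ->.
by rewrite mulr0.
Qed.

Lemma mbm_block m1 m2 n1 n2 (A : circle R -> 'M[C]_(m1, n1)) (B : circle R -> 'M[C]_(m1, n2))
    (D : circle R -> 'M[C]_(m2, n1)) (E : circle R -> 'M[C]_(m2, n2)) :
  mbm A -> mbm B -> mbm D -> mbm E -> mbm (fun z => block_mx (A z) (B z) (D z) (E z)).
Proof.
move=> hA hB hD hE i j.
case: (split_ordP i) => k ->; case: (split_ordP j) => l ->.
- by under eq_fun do rewrite block_mxEul.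
- by under eq_fun do rewrite block_mxEur.
- by under eq_fun do rewrite block_mxEdl.
- by under eq_fun do rewrite block_mxEdr.
Qed.

Lemma mbm_ul m1 m2 n1 n2 (M : circle R -> 'M[C]_(m1 + m2, n1 + n2)) :
  mbm M -> mbm (fun z => ulsubmx (M z)).
Proof. by move=> hM i j; under eq_fun do rewrite !mxE. Qed.
Lemma mbm_ur m1 m2 n1 n2 (M : circle R -> 'M[C]_(m1 + m2, n1 + n2)) :
  mbm M -> mbm (fun z => ursubmx (M z)).
Proof. by move=> hM i j; under eq_fun do rewrite !mxE. Qed.
Lemma mbm_dl m1 m2 n1 n2 (M : circle R -> 'M[C]_(m1 + m2, n1 + n2)) :
  mbm M -> mbm (fun z => dlsubmx (M z)).
Proof. by move=> hM i j; under eq_fun do rewrite !mxE. Qed.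
Lemma mbm_dr m1 m2 n1 n2 (M : circle R -> 'M[C]_(m1 + m2, n1 + n2)) :
  mbm M -> mbm (fun z => drsubmx (M z)).
Proof. by move=> hM i j; under eq_fun do rewrite !mxE. Qed.

End matrix_functions.

(** * Unitary functions satisfying (1), and one step of stripping *)

Section regular.
Context {R : realType} {n : nat}.
Local Notation C := R[i].
Implicit Types (alpha : 'I_2 -> 'I_2) (M : circle R -> 'M[C]_(n + n)).

(** Condition (1) for functions that are unitary at every point; [admissible] functions are
    exchanged for such representatives. *)
Definition regular M :=
  [/\ forall z, M z \is unitarymx, mbm M,
      mhol (fun z => (ulsubmx (M z))^t*) /\ mhol (fun z => (dlsubmx (M z))^t*) &
      mhol (fun z => ursubmx (M z)) /\ mhol (fun z => drsubmx (M z))].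

Definition normalized alpha M :=
  triG (alpha 0) (mcint (fun z => ulsubmx (M z))) /\
  triG (alpha 1) (mcint (fun z => drsubmx (M z))).

Lemma mcint_ahol m p (A : circle R -> 'M[C]_(m, p)) : mbm A ->
  mcint A = (mcint (fun z => (A z)^t*))^t*.
Proof. by move=> hA; rewrite mcint_adj // trmxCK. Qed.

(** Conjugation by [Z] gives the off-diagonal blocks of [M] a factor [z] or its conjugate, which
    makes their means vanish (for the lower left block, by passing to the adjoint). Only the
    diagonal blocks of [M] contribute to the means of the product. *)
Lemma unstrip (Y : 'M[C]_(n + n)) M : Y \is unitarymx -> regular M ->
  let M' := fun z => Y *m Zconj z 1 (M z) in
  [/\ regular M',
      mcint (fun z => ulsubmx (M' z)) = ulsubmx Y *m mcint (fun z => ulsubmx (M z)),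
      mcint (fun z => ursubmx (M' z)) = ursubmx Y *m mcint (fun z => drsubmx (M z)) &
      mcint (fun z => drsubmx (M' z)) = drsubmx Y *m mcint (fun z => drsubmx (M z))].
Proof.
move=> uY [uM bM [hA hC] [hB hD]] M'.
set E := ulsubmx Y; set F := ursubmx Y; set G := dlsubmx Y; set H := drsubmx Y.
have eM z : M' z = block_mx
    (E *m ulsubmx (M z) + F *m ((val z)^* *: dlsubmx (M z)))
    (val z *: (E *m ursubmx (M z)) + F *m drsubmx (M z))
    (G *m ulsubmx (M z) + H *m ((val z)^* *: dlsubmx (M z)))
    (val z *: (G *m ursubmx (M z)) + H *m drsubmx (M z)).
  by rewrite /M' -[Y]submxK /Zconj mulmx_block !expr1 -circle_conjE -!scalemxAr.
have bz := mbmZ (bmJ (@bm_val R)) (mbm_dl bM).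
have bul := mbm_ul bM; have bur := mbm_ur bM; have bdr := mbm_dr bM.
have cst m p (K : 'M[C]_(m, p)) := mhol_cst (R := R) K.
have [zC zC0] := mhol_mulz hC.
have intz : mcint (fun z => (val z)^* *: dlsubmx (M z)) = 0.
  rewrite mcint_ahol // -[RHS]adj0; congr (_ ^t*); rewrite -zC0; congr mcint; apply/funext => z.
  by rewrite adjZ conjCK.
have holz : mhol (fun z => ((val z)^* *: dlsubmx (M z))^t*).
  by move=> i j; have := zC i j; congr hol; apply/funext => z; rewrite adjZ conjCK.
have lhol (K L : 'M[C]_n) : mhol (fun z => (K *m ulsubmx (M z) + L *m ((val z)^* *: dlsubmx (M z)))^t*).
  have h := mholD (mholM hA (cst _ _ (K^t*))) (mholM holz (cst _ _ (L^t*))).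
  by move=> i j; have := h i j; congr hol; apply/funext => z; rewrite adjD !adjM.
have rhol (K L : 'M[C]_n) : mhol (fun z => val z *: (K *m ursubmx (M z)) + L *m drsubmx (M z)).
  apply: mholD; last exact: mholM (cst _ _ L) hD.
  by have [] := mhol_mulz (mholM (cst _ _ K) hB).
have lint (K L : 'M[C]_n) : mcint (fun z => K *m ulsubmx (M z) + L *m ((val z)^* *: dlsubmx (M z))) =
    K *m mcint (fun z => ulsubmx (M z)).
  rewrite mcintD; [|by apply: mbmM => //; exact: mbm_cst|by apply: mbmM => //; exact: mbm_cst].
  by rewrite !mcintMl // intz mulmx0 addr0.
have rint (K L : 'M[C]_n) : mcint (fun z => val z *: (K *m ursubmx (M z)) + L *m drsubmx (M z)) =
    L *m mcint (fun z => drsubmx (M z)).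
  have [h1 h2] := mhol_mulz (mholM (cst _ _ K) hB).
  rewrite mcintD; [|exact: mhol_bm|by apply: mbmM => //; exact: mbm_cst].
  by rewrite h2 add0r mcintMl.
have eul : (fun z => ulsubmx (M' z)) = fun z => E *m ulsubmx (M z) + F *m ((val z)^* *: dlsubmx (M z)).
  by apply/funext => z; rewrite eM block_mxKul.
have eur : (fun z => ursubmx (M' z)) = fun z => val z *: (E *m ursubmx (M z)) + F *m drsubmx (M z).
  by apply/funext => z; rewrite eM block_mxKur.
have edl : (fun z => dlsubmx (M' z)) = fun z => G *m ulsubmx (M z) + H *m ((val z)^* *: dlsubmx (M z)).
  by apply/funext => z; rewrite eM block_mxKdl.
have edr : (fun z => drsubmx (M' z)) = fun z => val z *: (G *m ursubmx (M z)) + H *m drsubmx (M z).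
  by apply/funext => z; rewrite eM block_mxKdr.
split; last 3 first.
- by rewrite eul; exact: lint.
- by rewrite eur; exact: rint.
- by rewrite edr; exact: rint.
split.
- by move=> z; apply: mul_unitarymx; [exact: uY|exact: Zconj_unitary (uM z)].
- have -> : M' = fun z => block_mx (ulsubmx (M' z)) (ursubmx (M' z)) (dlsubmx (M' z)) (drsubmx (M' z)).
    by apply/funext => z; rewrite submxK.
  apply: mbm_block; rewrite ?eul ?eur ?edl ?edr.
  + by apply: mbmD; apply: mbmM => //; exact: mbm_cst.
  + exact: mhol_bm (rhol _ _).
  + by apply: mbmD; apply: mbmM => //; exact: mbm_cst.
  + exact: mhol_bm (rhol _ _).
- split; first by have := lhol E F; congr mhol; apply/funext => z; rewrite eM block_mxKul.
  by have := lhol G H; congr mhol; apply/funext => z; rewrite eM block_mxKdl.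
- by rewrite eur edr; split; exact: rhol.
Qed.

(* The mean is multiplicative on the terms of [A^* B + C^* D = 0], which are
   products of analytic functions. *)
Lemma mean_orthogonal M : regular M ->
  (mcint (fun z => ulsubmx (M z)))^t* *m mcint (fun z => ursubmx (M z)) +
  (mcint (fun z => dlsubmx (M z)))^t* *m mcint (fun z => drsubmx (M z)) = 0.
Proof.
move=> [uM bM [hA hC] [hB hD]].
rewrite -!mcint_adj; [|exact: mbm_dl|exact: mbm_ul].
rewrite -!mcint_holM // -mcintD; [|exact: mhol_bm (mholM hA hB)|exact: mhol_bm (mholM hC hD)].
rewrite -[RHS](mcint_cst (R := R)); congr mcint; apply/funext => z.
have := unitarymxPl (uM z); rewrite -{1 2}[M z]submxK adj_block mulmx_block scalar_mx_block.
by move/eq_block_mx => [_ h _ _]; exact: h.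
Qed.

Definition stripf (Y : 'M[C]_(n + n)) M z := Zunconj z (Y^t* *m M z).

Lemma stripfK (Y : 'M[C]_(n + n)) M z : Y \is unitarymx ->
  Y *m Zconj z 1 (stripf Y M z) = M z.
Proof. by move=> uY; rewrite /stripf ZunconjK mulmxA (unitarymxP uY) mul1mx. Qed.

(** Both off-diagonal blocks lose a factor [z], so two means have to vanish. For the upper right
    block this is the orthogonality of the block columns of [Y]; for the lower left block it is
    [mean_orthogonal], after cancelling [X]. A single condition on B(0) and D(0) thus serves both
    blocks. *)
Lemma strip_regular (Y : 'M[C]_(n + n)) M (X : 'M[C]_n) : Y \is unitarymx -> regular M ->
  X \in unitmx ->
  mcint (fun z => ursubmx (M z)) = ursubmx Y *m X ->
  mcint (fun z => drsubmx (M z)) = drsubmx Y *m X ->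
  regular (stripf Y M).
Proof.
move=> uY rM uX eB eD; have orth := mean_orthogonal rM; case: rM => uM bM [hA hC] [hB hD].
have eM z : stripf Y M z = block_mx
    ((ulsubmx Y)^t* *m ulsubmx (M z) + (dlsubmx Y)^t* *m dlsubmx (M z))
    ((val z)^* *: ((ulsubmx Y)^t* *m ursubmx (M z) + (dlsubmx Y)^t* *m drsubmx (M z)))
    (val z *: ((ursubmx Y)^t* *m ulsubmx (M z) + (drsubmx Y)^t* *m dlsubmx (M z)))
    ((ursubmx Y)^t* *m ursubmx (M z) + (drsubmx Y)^t* *m drsubmx (M z)).
  rewrite /stripf -[M z in LHS]submxK -[Y in LHS]submxK adj_block mulmx_block ZunconjE.
  by rewrite block_mxKul block_mxKur block_mxKdl block_mxKdr.
have eY : (ulsubmx Y)^t* *m ursubmx Y + (dlsubmx Y)^t* *m drsubmx Y = 0.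
  have := unitarymxPl uY; rewrite -{1 2}[Y]submxK adj_block mulmx_block scalar_mx_block.
  by move/eq_block_mx => [_ h _ _]; exact: h.
have cst m p (K : 'M[C]_(m, p)) := mhol_cst (R := R) K.
have bul := mbm_ul bM; have bur := mbm_ur bM; have bdl := mbm_dl bM; have bdr := mbm_dr bM.
have rhol (K L : 'M[C]_n) : mhol (fun z => K *m ursubmx (M z) + L *m drsubmx (M z)).
  by apply: mholD; [exact: mholM (cst _ _ K) hB|exact: mholM (cst _ _ L) hD].
have lhol (K L : 'M[C]_n) : mhol (fun z => (K *m ulsubmx (M z) + L *m dlsubmx (M z))^t*).
  have h := mholD (mholM hA (cst _ _ (K^t*))) (mholM hC (cst _ _ (L^t*))).
  by move=> i j; have := h i j; congr hol; apply/funext => z; rewrite adjD !adjM.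
have b2 (K L : 'M[C]_n) (A B : circle R -> 'M[C]_n) : mbm A -> mbm B ->
    mbm (fun z => K *m A z + L *m B z).
  by move=> hA' hB'; apply: mbmD; apply: mbmM => //; exact: mbm_cst.
have int2 (K L : 'M[C]_n) (A B : circle R -> 'M[C]_n) : mbm A -> mbm B ->
    mcint (fun z => K *m A z + L *m B z) = K *m mcint A + L *m mcint B.
  move=> hA' hB'; rewrite mcintD ?mcintMl //; apply: mbmM => //; exact: mbm_cst.
have hur : mhol (fun z => ursubmx (stripf Y M z)).
  have -> : (fun z => ursubmx (stripf Y M z)) = fun z => (val z)^* *:
      ((ulsubmx Y)^t* *m ursubmx (M z) + (dlsubmx Y)^t* *m drsubmx (M z)).
    by apply/funext => z; rewrite eM block_mxKur.
  apply: mhol_divz; first exact: rhol.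
  rewrite (int2 _ _ _ _ bur bdr) eB eD !mulmxA -mulmxDl eY; exact: mul0mx.
have hdl : mhol (fun z => (dlsubmx (stripf Y M z))^t*).
  have -> : (fun z => (dlsubmx (stripf Y M z))^t*) = fun z => (val z)^* *:
      ((ursubmx Y)^t* *m ulsubmx (M z) + (drsubmx Y)^t* *m dlsubmx (M z))^t*.
    by apply/funext => z; rewrite eM block_mxKdl adjZ.
  apply: mhol_divz; first exact: lhol.
  rewrite mcint_adj; last exact: b2.
  rewrite (int2 _ _ _ _ bul bdl) adjD !adjM !trmxCK.
  by apply: (can_inj (mulmxK uX)); rewrite mulmxDl -!mulmxA -eB -eD orth; exact/esym/mul0mx.
split.
- move=> z; apply: Zunconj_unitary; apply: mul_unitarymx; last exact: uM.
  by rewrite trmxC_unitary.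
- have -> : stripf Y M = fun z => block_mx (ulsubmx (stripf Y M z)) (ursubmx (stripf Y M z))
     (dlsubmx (stripf Y M z)) (drsubmx (stripf Y M z)).
    by apply/funext => z; rewrite submxK.
  apply: mbm_block.
  + by move=> i j; under eq_fun do rewrite eM block_mxKul; exact: b2.
  + exact: mhol_bm hur.
  + move=> i j; have := mbm_adj (mhol_bm hdl) i j; congr bm; apply/funext => z.
    by rewrite trmxCK.
  + by move=> i j; under eq_fun do rewrite eM block_mxKdr; exact: b2.
- split; last exact: hdl.
  have := lhol ((ulsubmx Y)^t*) ((dlsubmx Y)^t*); congr mhol; apply/funext => z.
  by rewrite eM block_mxKul.
- split; first exact: hur.
  have := rhol ((ursubmx Y)^t*) ((drsubmx Y)^t*); congr mhol; apply/funext => z.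
  by rewrite eM block_mxKdr.
Qed.

(* [F H^-1 = B(0) D(0)^-1] *)
Definition matches alpha (F : 'M[C]_n) M := exists2 X : 'M[C]_n,
  mcint (fun z => ursubmx (M z)) = F *m X &
  mcint (fun z => drsubmx (M z)) = drsubmx (Ymx alpha F) *m X.

Lemma strip alpha F M : contractive F -> regular M -> normalized alpha M ->
  matches alpha F M ->
  let Y := Ymx alpha F in let M1 := stripf Y M in
  [/\ regular M1, normalized alpha M1,
      mcint (fun z => ulsubmx (M z)) = ulsubmx Y *m mcint (fun z => ulsubmx (M1 z)) &
      mcint (fun z => drsubmx (M z)) = drsubmx Y *m mcint (fun z => drsubmx (M1 z))].
Proof.
move=> cF rM [nA nD] [X eB eD] Y M1.
have uY : Y \is unitarymx by exact: Ymx_unitary.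
have uX : X \in unitmx.
  by have := triG_unit nD; rewrite eD unitmx_mul => /andP[].
have eF : ursubmx Y = F by have [_ -> _ _] := YmxP alpha cF.
have rM1 : regular M1 by apply: strip_regular uX _ eD => //; rewrite eF.
have [_ eA _ eD'] := unstrip uY rM1.
have eM z : Y *m Zconj z 1 (M1 z) = M z by exact: stripfK.
have eA' : mcint (fun z => ulsubmx (M z)) = ulsubmx Y *m mcint (fun z => ulsubmx (M1 z)).
  by rewrite -eA; congr mcint; apply/funext => z; rewrite eM.
have eD2 : mcint (fun z => drsubmx (M z)) = drsubmx Y *m mcint (fun z => drsubmx (M1 z)).
  by rewrite -eD'; congr mcint; apply/funext => z; rewrite eM.
split; [exact: rM1| |exact: eA'|exact: eD2].
have tE := Ymx_ul alpha cF; have tH := Ymx_dr alpha cF.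
split.
  rewrite -[mcint _](mulKmx (triG_unit tE)) -eA'.
  exact: triG_mul (triG_inv tE) nA.
rewrite -[mcint _](mulKmx (triG_unit tH)) -eD2.
exact: triG_mul (triG_inv tH) nD.
Qed.

Lemma matches_exists alpha M : normalized alpha M -> exists2 F, contractive F & matches alpha F M.
Proof.
move=> [_ nD]; have uD := triG_unit nD.
have [F cF eF] := Ymx_ratio alpha
  (mcint (fun z => ursubmx (M z)) *m invmx (mcint (fun z => drsubmx (M z)))).
have uH := triG_unit (Ymx_dr alpha cF).
exists F => //; exists (invmx (drsubmx (Ymx alpha F)) *m mcint (fun z => drsubmx (M z))).
  by rewrite {1}eF !mulmxA mulmxK // mulmxKV.
by rewrite mulKVmx.
Qed.

End regular.

(** * Square mean limits *)

Section complex_limits.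
Context {R : realType}.
Local Notation C := R[i].
Implicit Types (u v : nat -> C) (l : C).

Definition ccvg u l :=
  (complex.Re (u k) @[k --> \oo] --> complex.Re l) /\
  (complex.Im (u k) @[k --> \oo] --> complex.Im l).

Lemma ccvg_cst l : ccvg (fun=> l) l.
Proof. by split; exact: cvg_cst. Qed.

Lemma ccvgD u v l l' : ccvg u l -> ccvg v l' -> ccvg (fun k => u k + v k) (l + l').
Proof.
by move=> [h1 h2] [h3 h4]; split; [rewrite cReD; under eq_fun do rewrite cReD
  |rewrite cImD; under eq_fun do rewrite cImD]; apply: cvgD.
Qed.

Lemma ccvgM u v l l' : ccvg u l -> ccvg v l' -> ccvg (fun k => u k * v k) (l * l').
Proof.
move=> [h1 h2] [h3 h4]; split.
  by rewrite cReM; under eq_fun do rewrite cReM; apply: cvgB; apply: cvgM.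
by rewrite cImM; under eq_fun do rewrite cImM; apply: cvgD; apply: cvgM.
Qed.

Lemma ccvgJ u l : ccvg u l -> ccvg (fun k => (u k)^*) (l^*).
Proof.
move=> [h1 h2]; split; first by rewrite cReJ; under eq_fun do rewrite cReJ.
by rewrite cImJ; under eq_fun do rewrite cImJ; apply: cvgN.
Qed.

Lemma ccvg_sum (I : Type) (r : seq I) (u : I -> nat -> C) (l : I -> C) :
  (forall i, ccvg (u i) (l i)) -> ccvg (fun k => \sum_(i <- r) u i k) (\sum_(i <- r) l i).
Proof.
move=> h; elim: r => [|i r IH].
  by rewrite big_nil; under eq_fun do rewrite big_nil; exact: ccvg_cst.
by rewrite big_cons; under eq_fun do rewrite big_cons; exact: ccvgD.
Qed.

Lemma ccvg_prod (I : Type) (r : seq I) (u : I -> nat -> C) (l : I -> C) :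
  (forall i, ccvg (u i) (l i)) -> ccvg (fun k => \prod_(i <- r) u i k) (\prod_(i <- r) l i).
Proof.
move=> h; elim: r => [|i r IH].
  by rewrite big_nil; under eq_fun do rewrite big_nil; exact: ccvg_cst.
by rewrite big_cons; under eq_fun do rewrite big_cons; exact: ccvgM.
Qed.

Lemma ccvg_unique u l l' : ccvg u l -> ccvg u l' -> l = l'.
Proof.
move=> [h1 h2] [h3 h4]; apply: complex_ext; [exact: (cvg_unique _ h1 h3)|exact: (cvg_unique _ h2 h4)].
Qed.

Lemma ccvg_normc u l : ccvg u l -> Normc.normc (u k - l) ^+ 2 @[k --> \oo] --> (0 : R).
Proof.
move=> [h1 h2]; under eq_fun do rewrite normc2E cReD cImD cReN cImN.
have sq (x : nat -> R) y : x k @[k --> \oo] --> y -> (x k - y) ^+ 2 @[k --> \oo] --> (0 : R).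
  move=> /subr_cvg0 hx; have := cvgM hx hx; rewrite mulr0 => h.
  by under eq_fun do rewrite expr2; exact: h.
have := cvgD (sq _ _ h1) (sq _ _ h2); rewrite addr0 => h; exact: h.
Qed.

Lemma ccvg_bound u l (b : nat -> R) : (forall k, Normc.normc (u k - l) ^+ 2 <= b k) ->
  b k @[k --> \oo] --> (0 : R) -> ccvg u l.
Proof.
move=> h hb; have sq (x : nat -> R) y : (forall k, (x k - y) ^+ 2 <= b k) ->
    x k @[k --> \oo] --> y.
  move=> hx; apply/subr_cvg0/cvgr0Pnorm_lt => e e0.
  have e2 : 0 < e ^+ 2 by rewrite exprn_gt0.
  move/cvgr_lt : hb => /(_ _ e2); apply: filterS => k hk.
  rewrite -(@ltr_pXn2r _ 2) ?nnegrE ?(ltW e0) // real_normK ?num_real //.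
  exact: le_lt_trans (hx k) hk.
split; apply: sq => k; apply: le_trans (h k); rewrite normc2E cReD cImD cReN cImN.
  by rewrite lerDl sqr_ge0.
by rewrite lerDr sqr_ge0.
Qed.

Definition mccvg m n (U : nat -> 'M[C]_(m, n)) (T : 'M[C]_(m, n)) :=
  forall i j, ccvg (fun k => U k i j) (T i j).

Lemma mccvg_det n (U : nat -> 'M[C]_n) T : mccvg U T -> ccvg (fun k => \det (U k)) (\det T).
Proof.
move=> h; apply: ccvg_sum => s; apply: ccvgM; first exact: ccvg_cst.
by apply: ccvg_prod => i; exact: h.
Qed.

Lemma mccvg_SU n (U : nat -> 'M[C]_n) T : mccvg U T -> (forall k, SUgroup (U k)) -> SUgroup T.
Proof.
move=> h hU; split; last first.
  apply: ccvg_unique (mccvg_det h) _; under eq_fun do rewrite (hU _).2.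
  exact: ccvg_cst.
apply/unitarymxP/matrixP => i j.
have e k : \sum_l U k i l * (U k j l)^* = (1%:M : 'M[C]_n) i j.
  rewrite -(unitarymxP (hU k).1) mxE; apply: eq_bigr => l _; by rewrite adjE.
apply: (@ccvg_unique (fun k => \sum_l U k i l * (U k j l)^*)); last first.
  by under eq_fun do rewrite e; exact: ccvg_cst.
rewrite mxE; apply: ccvg_sum => l; rewrite adjE.
by apply: ccvgM; [exact: h|apply: ccvgJ; exact: h].
Qed.

Lemma bounded_variation_cvg (u : nat -> R) (B : R) :
  (forall N, \sum_(0 <= k < N) `|u k.+1 - u k| <= B) -> cvgn u.
Proof.
move=> hB; have : cvgn (series (telescope u)).
  apply: normed_cvg; apply: nondecreasing_is_cvgn.
    by apply/nondecreasing_seqP => n; rewrite /normed_series_of seriesSr lerDl /= normr_ge0.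
  by exists B => _ [N _ <-]; exact: hB.
rewrite telescopeK => h; have -> : u = (fun n => (u n - u 0%N) + u 0%N).
  by apply/funext => n; rewrite subrK.
by apply: is_cvgD; [exact: h|exact: is_cvg_cst].
Qed.

End complex_limits.

(** * Square mean distance of matrix functions *)

Section L2.
Context {R : realType}.
Local Notation C := R[i].
Local Notation mu := (@circle_prob R).

Definition D2 m n (M : circle R -> 'M[C]_(m, n)) : R := \int[mu]_z hs2 (M z).

Lemma rbm_sum (I : Type) (r : seq I) (F : I -> circle R -> R) :
  (forall i, rbm (F i)) -> rbm (fun z => \sum_(i <- r) F i z).
Proof.
move=> hF; elim: r => [|i r IH]; first by under eq_fun do rewrite big_nil; exact: rbm_cst.
by under eq_fun do rewrite big_cons; exact: rbmD.
Qed.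

Lemma rbm_hs2 m n (M : circle R -> 'M[C]_(m, n)) : mbm M -> rbm (fun z => hs2 (M z)).
Proof.
by move=> hM; apply: rbm_sum => i; apply: rbm_sum => j; exact: bm_normc.
Qed.

Lemma D2_ge0 m n (M : circle R -> 'M[C]_(m, n)) : 0 <= D2 M.
Proof. by apply: Rintegral_ge0 => z _; exact: hs2_ge0. Qed.

Lemma N2_le_D2 m n (M : circle R -> 'M[C]_(m, n)) i j : mbm M ->
  N2 (fun z => M z i j) <= D2 M.
Proof.
move=> hM; apply: le_rint => [||z]; [exact: bm_normc|exact: rbm_hs2|exact: le_hs2_entry].
Qed.

Lemma hs2D m n (A B : 'M[C]_(m, n)) : hs2 (A + B) <= 2 * hs2 A + 2 * hs2 B.
Proof.
rewrite /hs2 !mulr_sumr -big_split /=; apply: ler_sum => i _.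
rewrite !mulr_sumr -big_split /=; apply: ler_sum => j _.
by rewrite mxE; exact: normc2D.
Qed.

Lemma hs2N m n (A : 'M[C]_(m, n)) : hs2 (- A) = hs2 A.
Proof. by apply: (@complexI R); rewrite !hs2E adjN mulNmx mulmxN opprK. Qed.

Lemma hs2_sym m n (A B : 'M[C]_(m, n)) : hs2 (A - B) = hs2 (B - A).
Proof. by rewrite -hs2N opprB. Qed.

Lemma D2_triangle m n (L M N : circle R -> 'M[C]_(m, n)) : mbm L -> mbm M -> mbm N ->
  D2 (fun z => L z - N z) <= 2 * D2 (fun z => L z - M z) + 2 * D2 (fun z => M z - N z).
Proof.
move=> hL hM hN; have h1 := rbm_hs2 (mbmB hL hM); have h2 := rbm_hs2 (mbmB hM hN).
have c2 := rbm_cst (2 : R).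
rewrite /D2 -!rintZ // -rintD; [|exact: rbmM|exact: rbmM].
apply: le_rint => [||z]; [exact: rbm_hs2 (mbmB hL hN)|by apply: rbmD; exact: rbmM|].
by apply: le_trans (hs2D _ _); rewrite addrA subrK.
Qed.

Lemma ae_ord m (P : 'I_m -> circle R -> Prop) :
  (forall i, {ae mu, forall z, P i z}) -> {ae mu, forall z, forall i, P i z}.
Proof.
move=> h; have : {ae mu, forall z, forall (k : nat) (km : (k < m)%N), P (Ordinal km) z}.
  apply: ae_foralln => k; case: (pselect (k < m)%N) => [km|nkm].
    by apply: filterS (h (Ordinal km)) => z Pz km'; rewrite (bool_irrelevance km' km).
  by apply: aeW => z km; exfalso.
by apply: filterS => z hz i; have := hz i (ltn_ord i); congr P; apply: val_inj.
Qed.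

Lemma D2_eq0 m n (M : circle R -> 'M[C]_(m, n)) : mbm M -> D2 M = 0 ->
  {ae mu, forall z, M z = 0}.
Proof.
move=> hM h; have e i j : {ae mu, forall z, M z i j = 0}.
  apply: N2_eq0 => //; apply/eqP; rewrite eq_le N2_ge0 andbT -h.
  exact: (N2_le_D2 _ _ hM).
have : {ae mu, forall z, forall (i : 'I_m) (j : 'I_n), M z i j = 0}.
  by apply: ae_ord => i; apply: ae_ord => j; exact: e.
by apply: filterS => z hz; apply/matrixP => i j; rewrite hz mxE.
Qed.

End L2.

(** * Completeness in square mean for functions with values in SU *)

Section riesz_fischer.
Context {R : realType}.
Local Notation C := R[i].
Local Notation mu := (@circle_prob R).

Lemma geometric_half N : \sum_(0 <= k < N) (2^-1 : R) ^+ k = 2 - 2 * 2^-1 ^+ N.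
Proof.
elim: N => [|N IH]; first by rewrite big_nil expr0 mulr1 subrr.
by rewrite big_nat_recr //= IH exprS; field.
Qed.

Lemma SU_entry_bound m (U : 'M[C]_m) i j : SUgroup U -> Normc.normc (U i j) ^+ 2 <= 1.
Proof. by case => uU _; exact: unitary_entry_le. Qed.

Lemma SU1 m : SUgroup (1%:M : 'M[C]_m).
Proof. by split; [exact: unitary1|exact: det1]. Qed.

Lemma hs2_unitary m (U : 'M[C]_m) : U \is unitarymx -> hs2 U = m%:R.
Proof.
move=> /unitarymxP uU; apply: (@complexI R).
by rewrite hs2E uU mxtrace1 rmorph_nat.
Qed.

(** By [|x| <= t + t^-1 * x ^+ 2] with [t = 2^-1 ^+ k], the weighted sum of squares bounds the total
    variation of the real and imaginary parts by [2 + B]. *)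
Lemma ccvg_variation (u : nat -> C) (B : R) :
  (forall N, \sum_(0 <= k < N) 2 ^+ k * Normc.normc (u k.+1 - u k) ^+ 2 <= B) ->
  exists l, ccvg u l.
Proof.
move=> hB.
have am (x t : R) : 0 < t -> `|x| <= t + t^-1 * x ^+ 2.
  move=> t0; rewrite -(ler_pM2l t0) mulrDr mulrA mulfV ?gt_eqF // mul1r.
  rewrite -[x ^+ 2]real_normK ?num_real //.
  have := sqr_ge0 (t - `|x|); have : 0 <= t * `|x| by rewrite mulr_ge0 // ltW.
  rewrite -!expr2 sqrrB; lra.
have key (f : C -> R) : (forall x y, f (x - y) = f x - f y) ->
    (forall x, f x ^+ 2 <= Normc.normc x ^+ 2) -> cvgn (fun k => f (u k)).
  move=> fB fle; apply: (@bounded_variation_cvg _ _ (2 + B)) => N.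
  apply: (@le_trans _ _ (\sum_(0 <= k < N) (2^-1 ^+ k + 2 ^+ k * Normc.normc (u k.+1 - u k) ^+ 2))).
    apply: ler_sum => k _; rewrite -fB; apply: le_trans (am _ (2^-1 ^+ k) _) _.
      by rewrite exprn_gt0 // invr_gt0.
    by rewrite lerD2l exprVn invrK ler_wpM2l.
  rewrite big_split /= lerD // geometric_half lerBlDr lerDl mulr_ge0 //.
have /cvg_ex [a ha] : cvgn (fun k => complex.Re (u k)).
  apply: key => [x y|x]; first by rewrite cReD cReN.
  by rewrite normc2E lerDl sqr_ge0.
have /cvg_ex [b hb] : cvgn (fun k => complex.Im (u k)).
  apply: key => [x y|x]; first by rewrite cImD cImN.
  by rewrite normc2E lerDr sqr_ge0.
by exists (Complex a b).
Qed.

Lemma hs2_cvg0 m n (U : nat -> 'M[C]_(m, n)) T : mccvg U T ->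
  hs2 (U k - T) @[k --> \oo] --> (0 : R).
Proof.
have sum0 (I : Type) (r : seq I) (u : I -> nat -> R) :
    (forall i, u i k @[k --> \oo] --> (0 : R)) -> \sum_(i <- r) u i k @[k --> \oo] --> (0 : R).
  move=> h; elim: r => [|i r IH]; first by under eq_fun do rewrite big_nil; exact: cvg_cst.
  under eq_fun do rewrite big_cons.
  have := cvgD (h i) IH; rewrite addr0 => hh; exact: hh.
move=> h; apply: (sum0) => i; apply: (sum0) => j.
by under eq_fun do rewrite mxsubE; exact: ccvg_normc.
Qed.

Lemma D2_cvg0 m n (U : nat -> circle R -> 'M[C]_(m, n)) (T : circle R -> 'M[C]_(m, n)) (K : R) :
  (forall k, mbm (U k)) -> mbm T -> (forall k z, hs2 (U k z - T z) <= K) ->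
  {ae mu, forall z, mccvg (U^~ z) (T z)} ->
  D2 (fun z => U k z - T z) @[k --> \oo] --> (0 : R).
Proof.
move=> bU bT hK hc; apply: (@rint_cvg0 _ _ K).
- by move=> k; have [] := rbm_hs2 (mbmB (bU k) bT).
- by move=> k z; rewrite ger0_norm ?hs2_ge0.
- by apply: filterS hc => z; exact: hs2_cvg0.
Qed.

Section complete.
Context {m : nat} (U : nat -> circle R -> 'M[C]_m).
Hypotheses (bU : forall k, mbm (U k)) (SU : forall k z, SUgroup (U k z))
  (dU : forall k, D2 (fun z => U k.+1 z - U k z) <= 4^-1 ^+ k).

(** The weight [2 ^+ k] grows, so that [g z < +oo] gives convergence at [z] by [ccvg_variation], but
    more slowly than [4 ^+ k], so that [g] has integral at most 2. *)
Let h k z : R := 2 ^+ k * hs2 (U k.+1 z - U k z).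
Let g z : \bar R := (\sum_(0 <= k <oo) (h k z)%:E)%E.

Let h_ge0 k z : 0 <= h k z.
Proof. by rewrite mulr_ge0 ?exprn_ge0 // hs2_ge0. Qed.

Let rbm_h k : rbm (h k).
Proof. by apply: rbmM; [exact: rbm_cst|exact: rbm_hs2 (mbmB (bU k.+1) (bU k))]. Qed.

Let mg : measurable_fun setT g.
Proof.
apply: ge0_emeasurable_sum => [k z _ _|k _]; first by rewrite lee_fin.
by apply/measurable_EFinP; have [] := rbm_h k.
Qed.

Let int_g : (\int[mu]_z g z < +oo)%E.
Proof.
have mh k : measurable_fun setT (fun z => (h k z)%:E) by apply/measurable_EFinP; have [] := rbm_h k.
rewrite integral_nneseries //; last by move=> k z _; rewrite lee_fin.
have e k : (\int[mu]_z (h k z)%:E = (2 ^+ k * D2 (fun z => U k.+1 z - U k z))%:E)%E.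
  rewrite -[LHS]fineK; last exact: integrable_fin_num (rbm_integrable (rbm_h k)).
  congr EFin; rewrite -[LHS]/(\int[mu]_z h k z) rintZ //; exact: rbm_hs2 (mbmB (bU k.+1) (bU k)).
apply: le_lt_trans (ltry 2); apply: lime_le.
  by apply: is_cvg_nneseries => k _ _; rewrite e lee_fin mulr_ge0 ?exprn_ge0 ?D2_ge0.
apply: nearW => N; under eq_bigr do rewrite e.
rewrite sumEFin lee_fin; apply: (@le_trans _ _ (\sum_(0 <= k < N) 2^-1 ^+ k)).
  apply: ler_sum => k _; apply: le_trans (ler_wpM2l _ (dU k)) _; first exact: exprn_ge0.
  rewrite -exprMn; have -> : 2 * 4^-1 = 2^-1 :> R by field.
  by [].
by rewrite geometric_half lerBlDr lerDl mulr_ge0 // exprn_ge0 // invr_ge0.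
Qed.

Let A : set (circle R) := [set z | (g z < +oo)%E].

Let mA : measurable A.
Proof. by rewrite /A -[X in measurable X]setTI; apply: emeasurable_fun_infty_o. Qed.

Let g_ge0 z : (0 <= g z)%E.
Proof. by apply: nneseries_ge0 => k _ _; rewrite lee_fin. Qed.

Let ae_A : {ae mu, forall z, A z}.
Proof.
have : mu.-integrable setT g.
  apply/integrableP; split=> //; under eq_integral do rewrite gee0_abs //; exact: int_g.
move/(integrable_ae measurableT); apply: filterS => z /(_ I).
by rewrite ge0_fin_numE.
Qed.

Let cvg_A z : A z -> forall i j, exists l, ccvg (fun k => U k z i j) l.
Proof.
move=> Az i j; apply: (@ccvg_variation _ (fine (g z))) => N.
rewrite -lee_fin fineK ?ge0_fin_numE // -sumEFin.
apply: le_trans (nneseries_lim_ge N _); last by move=> k _ _; rewrite lee_fin.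
apply: lee_sum => k _; rewrite lee_fin /h ler_wpM2l ?exprn_ge0 //.
by have := le_hs2_entry (U k.+1 z - U k z) i j; rewrite mxsubE.
Qed.

Lemma riesz_fischer : exists T : circle R -> 'M[C]_m,
  [/\ mbm T, forall z, SUgroup (T z) & D2 (fun z => U k z - T z) @[k --> \oo] --> (0 : R)].
Proof.
(* Putting the identity off the set [A] of full measure makes the limit exist at every point, with
   values in SU everywhere because this group is closed. *)
pose V k z : 'M[C]_m := if `[< A z >] then U k z else 1%:M.
have SV k z : SUgroup (V k z) by rewrite /V; case: ifP => _; [exact: SU|exact: SU1].
have ex z i j : exists l, ccvg (fun k => V k z i j) l.
  rewrite /V; case: asboolP => [Az|_]; first exact: cvg_A.
  by eexists; exact: ccvg_cst.
pose T z : 'M[C]_m := \matrix_(i, j) projT1 (cid (ex z i j)).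
have VT z : mccvg (V^~ z) (T z).
  by move=> i j; rewrite mxE; exact: projT2 (cid (ex z i j)).
have ST z : SUgroup (T z) by exact: mccvg_SU (VT z) _.
have mV k i j : cmeasurable (fun z => V k z i j).
  have hA (u v : circle R -> R) : measurable_fun setT u -> measurable_fun setT v ->
      measurable_fun setT (fun z => if `[< A z >] then u z else v z).
    move=> hu hv; apply: measurable_fun_ifT => //.
    apply: (measurable_fun_bool true).
    suff -> : (fun z => `[< A z >]) @^-1` [set true] = A by rewrite setTI.
    by apply/seteqP; split => z /= /asboolP.
  have [m1 m2] := bm_cmeasurable (bU k i j).
  split.
    have := hA _ _ m1 (measurable_cst (complex.Re ((1%:M : 'M[C]_m) i j))).
    by congr measurable_fun; apply/funext => z; rewrite /V; case: ifP.
  have := hA _ _ m2 (measurable_cst (complex.Im ((1%:M : 'M[C]_m) i j))).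
  by congr measurable_fun; apply/funext => z; rewrite /V; case: ifP.
have bT : mbm T.
  move=> i j; apply: (@bmP _ _ 1); last by move=> z; exact: SU_entry_bound.
  split.
    apply: (@measurable_fun_cvg _ _ _ _ (fun k z => complex.Re (V k z i j))).
      by move=> k; case: (mV k i j).
    by move=> z _; case: (VT z i j).
  apply: (@measurable_fun_cvg _ _ _ _ (fun k z => complex.Im (V k z i j))).
    by move=> k; case: (mV k i j).
  by move=> z _; case: (VT z i j).
exists T; split=> //.
apply: (@D2_cvg0 _ _ _ _ (2 * m%:R + 2 * m%:R)) => //.
- move=> k z; apply: le_trans (hs2D _ _) _; rewrite hs2N !hs2_unitary //.
    by case: (ST z).
  by case: (SU k z).
- apply: filterS ae_A => z Az i j; have := VT z i j; congr ccvg.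
  by apply/funext => k; rewrite /V asboolT.
Qed.

End complete.
End riesz_fischer.

(** * Partial products and their limits *)

Section limits.
Context {R : realType} {n : nat} (alpha : 'I_2 -> 'I_2).
Local Notation C := R[i].
Local Notation mu := (@circle_prob R).
Implicit Types (F : nat -> 'M[C]_n) (T M : circle R -> 'M[C]_(n + n)).

Local Notation cul M := (mcint (fun z => ulsubmx (M z))).
Local Notation cur M := (mcint (fun z => ursubmx (M z))).
Local Notation cdr M := (mcint (fun z => drsubmx (M z))).
Local Notation pprod := (pprod alpha).
Local Notation Y F j := (Ymx alpha (F j)).

Lemma block1 : (1%:M : 'M[C]_(n + n)) = block_mx 1%:M 0 0 1%:M.
Proof. exact: scalar_mx_block. Qed.

Lemma regular1 : regular (fun=> 1%:M : 'M[C]_(n + n)).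
Proof.
split; first by move=> _; exact: unitary1.
- exact: mbm_cst.
- by split; exact: mhol_cst.
- by split; exact: mhol_cst.
Qed.

Lemma pprod_regular F N : (forall j, contractive (F j)) ->
  [/\ regular (pprod F N), normalized alpha (pprod F N),
      forall i, rdiag (cul (pprod F N)) i = \prod_(0 <= j < N) rdiag (ulsubmx (Y F j)) i &
      forall i, rdiag (cdr (pprod F N)) i = \prod_(0 <= j < N) rdiag (drsubmx (Y F j)) i].
Proof.
elim: N F => [|N IH] F cF.
  have -> : pprod F 0 = fun=> 1%:M by apply/funext => z; rewrite pprod0.
  rewrite /normalized !mcint_cst block1 block_mxKul block_mxKdr.
  split.
  - by rewrite -block1; exact: regular1.
  - by split; exact: triG1.
  - by move=> i; rewrite big_nil rdiag1.
  - by move=> i; rewrite big_nil rdiag1.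
have cF' j : contractive (F j.+1) by [].
have [rT [nA nD] eA eD] := IH (fun j => F j.+1) cF'.
have uY := Ymx_unitary alpha (cF 0%N).
have [rM cA _ cD] := unstrip uY rT.
have e z : Y F 0 *m Zconj z 1 (pprod (fun j => F j.+1) N z) = pprod F N.+1 z by rewrite pprodS.
have eT : (fun z => Y F 0 *m Zconj z 1 (pprod (fun j => F j.+1) N z)) = pprod F N.+1.
  by apply/funext => z; exact: e.
rewrite /= in cA cD.
have cA' : cul (pprod F N.+1) = ulsubmx (Y F 0) *m cul (pprod (fun j => F j.+1) N).
  by rewrite -cA; congr mcint; apply/funext => z; rewrite e.
have cD' : cdr (pprod F N.+1) = drsubmx (Y F 0) *m cdr (pprod (fun j => F j.+1) N).
  by rewrite -cD; congr mcint; apply/funext => z; rewrite e.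
have tE := Ymx_ul alpha (cF 0%N); have tH := Ymx_dr alpha (cF 0%N).
split.
- by rewrite -eT; exact: rM.
- rewrite /normalized cA' cD'; split.
    exact: triG_mul tE nA.
  exact: triG_mul tH nD.
- by move=> i; rewrite cA' (rdiag_mul _ tE nA) eA big_nat_recl.
- by move=> i; rewrite cD' (rdiag_mul _ tH nD) eD big_nat_recl.
Qed.

Lemma pprod_bm F N : (forall j, contractive (F j)) -> mbm (pprod F N).
Proof. by move=> cF; have [[_ bT _ _] _ _ _] := pprod_regular N cF; exact: bT. Qed.

Lemma Re_tr m (M : 'M[C]_m) : complex.Re (\tr M) = \sum_i rdiag M i.
Proof.
rewrite /mxtrace; apply: (big_ind2 (fun (x : C) (y : R) => complex.Re x = y)) => // x1 x2 y1 y2.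
by rewrite cReD => -> ->.
Qed.

Lemma hs2_sub1 m (U : 'M[C]_m) : U \is unitarymx ->
  hs2 (U - 1%:M) = 2 * m%:R - 2 * complex.Re (\tr U).
Proof.
move=> /unitarymxP uU; apply: (@complexI R); rewrite hs2E adjB adj1.
rewrite mulmxBr mulmxBl uU mulmx1 mul1mx !linearB /= mxtrace1.
have -> : \tr (U^t*) = (\tr U)^* by rewrite /mxtrace rmorph_sum; apply: eq_bigr => i _; rewrite adjE.
apply: complex_ext; rewrite !(cReD, cReN, cReJ, cImD, cImN, cImJ) /=.
  have -> : complex.Re (m%:R : C) = m%:R by rewrite -(rmorph_nat (real_complex R)).
  ring.
have -> : complex.Im (m%:R : C) = 0 by rewrite -(rmorph_nat (real_complex R)).
ring.
Qed.

Lemma D2_unitary_sub1 m (M : circle R -> 'M[C]_m) : (forall z, M z \is unitarymx) -> mbm M ->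
  D2 (fun z => M z - 1%:M) = 2 * m%:R - 2 * \sum_i rdiag (mcint M) i.
Proof.
move=> uM bM; rewrite /D2; under eq_Rintegral do rewrite hs2_sub1 //.
have hb : bm (fun z => \tr (M z)) by apply: bm_sum => i; exact: bM.
have hr : rbm (fun z => complex.Re (\tr (M z))) by case: hb.
rewrite rintB; [|exact: rbm_cst|by apply: rbmM => //; exact: rbm_cst].
rewrite rint_cst rintZ //; congr (_ - 2 * _).
rewrite -[LHS]/(complex.Re (cintegral (fun z => \tr (M z)))).
by rewrite mcint_tr // Re_tr.
Qed.

Lemma D2_sub1 M : regular M -> D2 (fun z => M z - 1%:M) =
  2 * (n + n)%:R - 2 * (\sum_i rdiag (cul M) i + \sum_i rdiag (cdr M) i).
Proof.
move=> [uM bM _ _]; rewrite (D2_unitary_sub1 uM bM) big_split_ord /=.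
by congr (_ - 2 * (_ + _)); apply: eq_bigr => i _; rewrite /rdiag !mxE;
  congr (complex.Re (cintegral _)); apply/funext => z; rewrite !mxE.
Qed.

(** Weierstrass's product inequality; the bounds 0 and 1 on the product carry the induction. *)
Lemma prod_ge_1B (d x : nat -> R) m N : (forall j, 0 <= d j <= 1) -> (forall j, 1 - x j <= d j) ->
  0 <= \prod_(m <= j < m + N) d j <= 1 /\
  1 - \sum_(m <= j < m + N) x j <= \prod_(m <= j < m + N) d j.
Proof.
move=> d01 dx; elim: N => [|N [/andP[p0 p1] ps]].
  by rewrite addn0 !big_geq //; split; [rewrite ler01 lexx|lra].
rewrite addnS !big_nat_recr /= ?leq_addr //; set p := \prod_(_ <= _ < _) _ in p0 p1 ps *.
have /andP[d0 d1] := d01 (m + N)%N; have dxm := dx (m + N)%N.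
have h1 : 0 <= p * d (m + N)%N by exact: mulr_ge0.
have h2 : p * (1 - d (m + N)%N) <= 1 * (1 - d (m + N)%N) by rewrite ler_wpM2r // subr_ge0.
rewrite mulrBr mulr1 mul1r in h2; split; last lra.
by rewrite h1 /= mulr_ile1.
Qed.

(** By unitary invariance this is the distance from a tail product to the identity, that is [4 * n]
    minus twice the traces of the means of its diagonal blocks. Each of the [2 * n] diagonal entries
    is at least [1 - s], with [s] the sum of the [hs2 (F j)], which leaves [4 * n * s]. *)
Lemma D2_pprod F m N : (forall j, contractive (F j)) ->
  D2 (fun z => pprod F (m + N)%N z - pprod F m z) <=
  (4 * n%:R) * \sum_(m <= j < m + N) hs2 (F j).
Proof.
move=> cF; pose S := pprod (fun j => F (m + j)%N) N.
have cF' j : contractive (F (m + j)%N) by [].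
have [rS _ eA eD] := pprod_regular N cF'.
have -> : D2 (fun z => pprod F (m + N)%N z - pprod F m z) = D2 (fun z => S z - 1%:M).
  apply: eq_Rintegral => z _; rewrite pprod_cat -/(S z).
  rewrite -[X in _ - X]mulmx1 -mulmxBr hs2_unitaryl; last exact: pprod_unitary.
  have <- : Zconj z m (S z - 1%:M) = Zconj z m (S z) - 1%:M by rewrite ZconjB Zconj1.
  by rewrite Zconj_hs2.
rewrite D2_sub1 //.
have es : \sum_(0 <= j < 0 + N) hs2 (F (m + j)%N) = \sum_(m <= j < m + N) hs2 (F j).
  rewrite -{2}[m]add0n big_addn addKn add0n; apply: eq_bigr => j _; by rewrite addnC.
rewrite -es; set s := \sum_(_ <= _ < _) _.
have hA i : 1 - s <= rdiag (cul S) i.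
  rewrite eA -{1}[N]add0n; have [] := @prod_ge_1B (fun j => rdiag (ulsubmx (Y F (m + j))) i)
    (fun j => hs2 (F (m + j)%N)) 0 N => // [j|j].
    by rewrite Ymx_ul_le1 // ltW // (rdiag_gt0 _ (Ymx_ul alpha _)).
  exact: Ymx_ul_ge.
have hD i : 1 - s <= rdiag (cdr S) i.
  rewrite eD -{1}[N]add0n; have [] := @prod_ge_1B (fun j => rdiag (drsubmx (Y F (m + j))) i)
    (fun j => hs2 (F (m + j)%N)) 0 N => // [j|j].
    by rewrite Ymx_dr_le1 // ltW // (rdiag_gt0 _ (Ymx_dr alpha _)).
  exact: Ymx_dr_ge.
have sA : n%:R * (1 - s) <= \sum_i rdiag (cul S) i.
  rewrite -[n in n%:R]card_ord mulr_natl -sumr_const; exact: ler_sum.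
have sD : n%:R * (1 - s) <= \sum_i rdiag (cdr S) i.
  rewrite -[n in n%:R]card_ord mulr_natl -sumr_const; exact: ler_sum.
rewrite natrD; lra.
Qed.

End limits.

(** * Existence of the limit of the partial products *)

Section nlft_limit.
Context {R : realType} {n : nat} (alpha : 'I_2 -> 'I_2).
Local Notation C := R[i].
Local Notation mu := (@circle_prob R).
Implicit Types (F : nat -> 'M[C]_n) (T M : circle R -> 'M[C]_(n + n)).

Local Notation cul M := (mcint (fun z => ulsubmx (M z))).
Local Notation cur M := (mcint (fun z => ursubmx (M z))).
Local Notation cdr M := (mcint (fun z => drsubmx (M z))).
Local Notation pprod := (pprod alpha).
Local Notation Y F j := (Ymx alpha (F j)).

Lemma ell2_tail F (e : R) : ell2_contractive F -> 0 < e ->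
  exists m, forall a b, (m <= a <= b)%N -> \sum_(a <= j < b) hs2 (F j) < e.
Proof.
move=> [_ hF] e0; pose s N := \sum_(0 <= j < N) hs2 (F j).
have nds : nondecreasing_seq s.
  by apply/nondecreasing_seqP => N; rewrite /s big_nat_recr //= lerDl hs2_ge0.
have cs : cvgn s.
  apply: nondecreasing_is_cvgn => //.
  set t := (X in (X < +oo)%E) in hF; exists (fine t) => _ [N _ <-].
  have t0 : (0 <= t)%E by apply: nneseries_ge0 => k _ _; rewrite lee_fin sqr_ge0.
  rewrite -lee_fin fineK ?ge0_fin_numE // /s -sumEFin.
  apply: le_trans (nneseries_lim_ge N _); last by move=> k _ _; rewrite lee_fin sqr_ge0.
  by apply: lee_sum => k _; rewrite hsnorm2.
have hl : limn s - e < limn s by rewrite ltrBlDr ltrDl.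
have := cvgr_gt _ cs _ hl => -[m _ hm]; exists m => a b /andP[ma ab].
have -> : \sum_(a <= j < b) hs2 (F j) = s b - s a.
  by rewrite /s (@big_cat_nat _ _ _ a 0 b) //= addrAC subrr add0r.
have := hm m (leqnn m); have := nds _ _ ma; have := nondecreasing_cvgn_le nds cs b.
rewrite /=; lra.
Qed.

Definition plim F T := D2 (fun z => pprod F k z - T z) @[k --> \oo] --> (0 : R).

Lemma plim_exists F : ell2_contractive F ->
  exists T, [/\ mbm T, forall z, SUgroup (T z) & plim F T].
Proof.
move=> hF; have [cF _] := hF.
have tail (e : R) : 0 < e -> exists m, forall a b, (m <= a <= b)%N ->
    D2 (fun z => pprod F b z - pprod F a z) < e.
  move=> e0; have k0 : 0 < 4 * n%:R + 1 :> R by rewrite ltr_wpDl ?mulr_ge0.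
  have [m hm] := ell2_tail hF (divr_gt0 e0 k0).
  exists m => a b mab; have := hm _ _ mab; rewrite ltr_pdivlMr //.
  have /andP[_ ab] := mab; apply: le_lt_trans.
  rewrite -{1}(subnKC ab); apply: le_trans (D2_pprod _ _ _ cF) _.
  rewrite subnKC // mulrC ler_wpM2l //; last by rewrite lerDl.
  by apply: sumr_ge0 => j _; exact: hs2_ge0.
have p4 k : 0 < (4^-1 : R) ^+ k by rewrite exprn_gt0 // invr_gt0.
have ex k : exists m, forall a b, (m <= a <= b)%N ->
  D2 (fun z => pprod F b z - pprod F a z) < 4^-1 ^+ k by exact: tail.
pose ms k := projT1 (cid (ex k)).
have hms k : forall a b, (ms k <= a <= b)%N ->
  D2 (fun z => pprod F b z - pprod F a z) < 4^-1 ^+ k by exact: (projT2 (cid (ex k))).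
(* These sums are nondecreasing in [k] and dominate both [ms k] and [k]; along them, consecutive
   partial products are as close as [riesz_fischer] asks. *)
pose Ns k := (\sum_(0 <= i < k.+1) (ms i).+1)%N.
have NsS k : (Ns k <= Ns k.+1)%N by rewrite /Ns [X in (_ <= X)%N]big_nat_recr //= leq_addr.
have msN k : (ms k <= Ns k)%N.
  by rewrite /Ns big_nat_recr //= (leq_trans (leqnSn _)) // leq_addl.
have kN k : (k <= Ns k)%N.
  rewrite /Ns; elim: k => [|k IH]; first by [].
  by rewrite big_nat_recr //=; lia.
have [T [bT ST hT]] := @riesz_fischer _ _ (fun k => pprod F (Ns k))
  (fun k => pprod_bm _ (Ns k) cF)
  (fun k z => conj (pprod_unitary alpha (Ns k) z cF) (pprod_det alpha (Ns k) z cF))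
  (fun k => ltW (hms k _ _ (introT andP (conj (msN k) (NsS k))))).
exists T; split; [exact: bT|exact: ST|].
(* The Cauchy estimate [tail] extends the convergence from the subsequence [Ns] to all partial
   products. *)
apply/cvgr0Pnorm_lt => e e0; have e4 : 0 < e / 4 by rewrite divr_gt0.
have [m hm] := tail _ e4.
move/cvgr0Pnorm_lt : hT => /(_ _ e4) [k1 _ hk1].
pose k := maxn k1 m; exists (Ns k) => // N /= kN'.
have := hk1 k (leq_maxl _ _); rewrite /= !ger0_norm ?D2_ge0 // => h1.
have h2 : D2 (fun z => pprod F N z - pprod F (Ns k) z) < e / 4.
  by apply: hm; rewrite kN' andbT (leq_trans _ (kN k)) // leq_maxr.
apply: le_lt_trans (D2_triangle (pprod_bm _ N cF) (pprod_bm _ (Ns k) cF) bT) _.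
by lra.
Qed.

Lemma mcint_cvg m p (U : nat -> circle R -> 'M[C]_(m, p)) (T : circle R -> 'M[C]_(m, p)) :
  (forall k, mbm (U k)) -> mbm T ->
  D2 (fun z => U k z - T z) @[k --> \oo] --> (0 : R) ->
  mccvg (fun k => mcint (U k)) (mcint T).
Proof.
move=> bU bT h i j; apply: ccvg_bound h => k; rewrite !mxE -cintB; [|exact: bU|exact: bT].
apply: le_trans (normc_cint (bmB (bU k i j) (bT i j))) _.
have := N2_le_D2 i j (mbmB (bU k) bT); congr (_ <= _); congr N2.
by apply/funext => z; rewrite mxsubE.
Qed.

Lemma sub_cvg (p q : nat) (sub : 'M[C]_(n + n) -> 'M[C]_(p, q))
    (f : 'I_p -> 'I_(n + n)) (g : 'I_q -> 'I_(n + n))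
    (U : nat -> circle R -> 'M[C]_(n + n)) T :
  (forall A i j, sub A i j = A (f i) (g j)) ->
  (forall k, mbm (U k)) -> mbm T ->
  D2 (fun z => U k z - T z) @[k --> \oo] --> (0 : R) ->
  mccvg (fun k => mcint (fun z => sub (U k z))) (mcint (fun z => sub (T z))).
Proof.
move=> hsub bU bT h i j; have := mcint_cvg bU bT h (f i) (g j); rewrite !mxE => hc.
have e M : (fun z => sub (M z) i j) = (fun z : circle R => M z (f i) (g j)).
  by apply/funext => z; rewrite hsub.
rewrite e; move: hc; congr ccvg; apply/funext => k.
by rewrite !mxE e.
Qed.

Lemma hol_D2_lim m p (U : nat -> circle R -> 'M[C]_(m, p)) (T : circle R -> 'M[C]_(m, p))
    (f : nat -> circle R -> C) g :
  bm g -> (forall k, hol (f k)) -> (forall k, N2 (fun z => f k z - g z) <= D2 (fun z => U k z - T z)) ->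
  D2 (fun z => U k z - T z) @[k --> \oo] --> (0 : R) -> hol g.
Proof.
move=> bg hf hle hD; apply: hol_lim => // e e0.
move/cvgr_lt : hD => /(_ _ e0) [k _ /(_ k (leqnn k)) /= hk].
by exists (f k) => //; rewrite N2_sym; apply: le_lt_trans (hle k) hk.
Qed.

Lemma regular_lim (U : nat -> circle R -> 'M[C]_(n + n)) T :
  (forall k, regular (U k)) -> mbm T -> (forall z, T z \is unitarymx) ->
  D2 (fun z => U k z - T z) @[k --> \oo] --> (0 : R) -> regular T.
Proof.
move=> rU bT uT hD.
have bU k : mbm (U k) by have [_ h _ _] := rU k; exact: h.
have ent i j : (forall k, hol (fun z => U k z i j)) -> hol (fun z => T z i j).
  move=> hk; apply: (hol_D2_lim (bT i j) hk) hD => k.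
  have := N2_le_D2 i j (mbmB (bU k) bT); congr (_ <= _); congr N2.
  by apply/funext => z; rewrite mxsubE.
have entJ i j : (forall k, hol (fun z => (U k z i j)^*)) -> hol (fun z => (T z i j)^*).
  move=> hk; apply: (hol_D2_lim (bmJ (bT i j)) hk) hD => k.
  have := N2_le_D2 i j (mbmB (bU k) bT); congr (_ <= _).
  apply: eq_Rintegral => z _; rewrite mxsubE !normc2E !(cReD, cImD, cReN, cImN, cReJ, cImJ).
  by rewrite -opprD sqrrN.
split=> //; split=> i j.
- under eq_fun do rewrite adjE !mxE; apply: entJ => k; have [_ _ [h _] _] := rU k.
  by have := h i j; congr hol; apply/funext => z; rewrite adjE !mxE.
- under eq_fun do rewrite adjE !mxE; apply: entJ => k; have [_ _ [_ h] _] := rU k.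
  by have := h i j; congr hol; apply/funext => z; rewrite adjE !mxE.
- under eq_fun do rewrite !mxE; apply: ent => k; have [_ _ _ [h _]] := rU k.
  by have := h i j; congr hol; apply/funext => z; rewrite !mxE.
- under eq_fun do rewrite !mxE; apply: ent => k; have [_ _ _ [_ h]] := rU k.
  by have := h i j; congr hol; apply/funext => z; rewrite !mxE.
Qed.

End nlft_limit.

(** * Regularity, normalization and first coefficient of the limit *)

Section nlft_properties.
Context {R : realType} {n : nat} (alpha : 'I_2 -> 'I_2).
Local Notation C := R[i].
Local Notation mu := (@circle_prob R).
Implicit Types (F : nat -> 'M[C]_n) (T M : circle R -> 'M[C]_(n + n)).

Local Notation cul M := (mcint (fun z => ulsubmx (M z))).
Local Notation cur M := (mcint (fun z => ursubmx (M z))).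
Local Notation cdr M := (mcint (fun z => drsubmx (M z))).
Local Notation pprod := (pprod alpha).
Local Notation plim := (plim alpha).
Local Notation Y F j := (Ymx alpha (F j)).

Lemma plim_cul F T : (forall j, contractive (F j)) -> mbm T -> plim F T ->
  mccvg (fun k => cul (pprod F k)) (cul T).
Proof.
move=> cF bT h; apply: (@sub_cvg _ _ _ _ (@ulsubmx C n n n n) (lshift n) (lshift n)) => //.
  by move=> A i j; rewrite !mxE.
by move=> k; exact: pprod_bm.
Qed.

Lemma plim_cur F T : (forall j, contractive (F j)) -> mbm T -> plim F T ->
  mccvg (fun k => cur (pprod F k)) (cur T).
Proof.
move=> cF bT h; apply: (@sub_cvg _ _ _ _ (@ursubmx C n n n n) (lshift n) (@rshift n n)) => //.
  by move=> A i j; rewrite !mxE.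
by move=> k; exact: pprod_bm.
Qed.

Lemma plim_cdr F T : (forall j, contractive (F j)) -> mbm T -> plim F T ->
  mccvg (fun k => cdr (pprod F k)) (cdr T).
Proof.
move=> cF bT h; apply: (@sub_cvg _ _ _ _ (@drsubmx C n n n n) (@rshift n n) (@rshift n n)) => //.
  by move=> A i j; rewrite !mxE.
by move=> k; exact: pprod_bm.
Qed.

Lemma plim_regular F T : (forall j, contractive (F j)) -> mbm T ->
  (forall z, T z \is unitarymx) -> plim F T -> regular T.
Proof.
move=> cF bT uT h; apply: (regular_lim _ bT uT h) => k.
by have [hr _ _ _] := pprod_regular alpha k cF; exact: hr.
Qed.

(** Triangularity is a closed condition, but positivity of the diagonal is not: the uniform lower
    bound [c] preserves it in the limit. *)
Lemma triG_lim m a (U : nat -> 'M[C]_m) (T : 'M[C]_m) (c : R) : 0 < c ->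
  (forall k, triG a (U k)) -> (\forall k \near \oo, forall i, c <= rdiag (U k) i) ->
  mccvg U T -> triG a T.
Proof.
move=> c0 tU hc h; apply/triG_triangular; split=> [i j ij|i].
  apply: ccvg_unique (h i j) _.
  have -> : (fun k => U k i j) = fun=> 0; last exact: ccvg_cst.
  by apply/funext => k; have /triG_triangular [tk _] := tU k; exact: tk.
have [h1 h2] := h i i.
rewrite ltcE /=; apply/andP; split.
  apply/eqP/esym/(cvg_unique _ _ h2) => //.
  have -> : (fun k => complex.Im (U k i i)) = fun=> 0; last exact: cvg_cst.
  by apply/funext => k; rewrite (rdiagE i (tU k)).
apply: lt_le_trans c0 _; rewrite -(cvg_lim _ h1) //; apply: limr_ge.
  by apply/cvg_ex; eexists; exact: h1.
by apply: filterS hc => k; exact.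
Qed.

Lemma prod_inf_gt0 F (d : nat -> 'I_n -> R) : ell2_contractive F ->
  (forall j i, 0 < d j i <= 1) -> (forall j i, 1 - hs2 (F j) <= d j i) ->
  exists2 c : R, 0 < c & \forall k \near \oo, forall i, c <= \prod_(0 <= j < k) d j i.
Proof.
move=> hF d01 dge.
have half : 0 < 2^-1 :> R by rewrite invr_gt0.
have [m hm] := ell2_tail hF half.
pose p i := \prod_(0 <= j < m) d j i.
have p0 i : 0 < p i by rewrite /p; apply: prodr_gt0 => j _; case/andP: (d01 j i).
have p1 i : p i <= 1.
  have [|/andP[_]] // := @prod_ge_1B _ (fun j => d j i) (fun j => hs2 (F j)) 0 m _ (dge^~ i).
  by move=> j; have /andP[/ltW -> ->] := d01 j i.
(* The factors beyond [m] have product at least 1/2, and the product over all [i] is a lower bound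
   for every [p i], since each [p i] is at most 1. *)
exists ((\prod_i p i) / 2); first by rewrite divr_gt0 // prodr_gt0.
exists m => // k /= mk i.
rewrite (@big_cat_nat _ _ _ m) //= -/(p i).
have h : 2^-1 <= \prod_(m <= j < k) d j i.
  rewrite -(subnKC mk).
  have [|_] := @prod_ge_1B _ (fun j => d j i) (fun j => hs2 (F j)) m (k - m) _ (dge^~ i).
    by move=> j; have /andP[/ltW -> ->] := d01 j i.
  apply: le_trans; have := hm m (m + (k - m))%N; rewrite leqnn leq_addr => /(_ isT); lra.
apply: ler_pM => //.
  by rewrite prodr_ge0 // => j _; rewrite ltW.
rewrite (bigD1 i) //= ler_piMr ?(ltW (p0 i)) //.
by apply: prodr_ile1 => j _; rewrite p1 ltW.
Qed.

Lemma plim_normalized F T : ell2_contractive F -> mbm T -> plim F T -> normalized alpha T.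
Proof.
move=> hF bT h; have [cF _] := hF; split.
- have [||c c0 hc] := @prod_inf_gt0 F (fun j i => rdiag (ulsubmx (Y F j)) i) hF.
  + by move=> j i; rewrite (rdiag_gt0 _ (Ymx_ul alpha (cF j))) Ymx_ul_le1.
  + by move=> j i; exact: Ymx_ul_ge.
  apply: (triG_lim c0) (plim_cul cF bT h) => [k|].
    by have [_ [] ] := pprod_regular alpha k cF.
  apply: filterS hc => k hk i.
  by have [_ _ -> _] := pprod_regular alpha k cF.
- have [||c c0 hc] := @prod_inf_gt0 F (fun j i => rdiag (drsubmx (Y F j)) i) hF.
  + by move=> j i; rewrite (rdiag_gt0 _ (Ymx_dr alpha (cF j))) Ymx_dr_le1.
  + by move=> j i; exact: Ymx_dr_ge.
  apply: (triG_lim c0) (plim_cdr cF bT h) => [k|].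
    by have [_ [] ] := pprod_regular alpha k cF.
  apply: filterS hc => k hk i.
  by have [_ _ _ ->] := pprod_regular alpha k cF.
Qed.

Lemma mccvgMl m p q (A : 'M[C]_(m, p)) (U : nat -> 'M[C]_(p, q)) (T : 'M[C]_(p, q)) :
  mccvg U T -> mccvg (fun k => A *m U k) (A *m T).
Proof.
move=> h i j; rewrite mxE; under eq_fun do rewrite mxE.
by apply: ccvg_sum => l; apply: ccvgM; [exact: ccvg_cst|exact: h].
Qed.

Lemma mccvg_unique m p (U : nat -> 'M[C]_(m, p)) (T T' : 'M[C]_(m, p)) : mccvg U T -> mccvg U T' -> T = T'.
Proof. by move=> h h'; apply/matrixP => i j; exact: ccvg_unique (h i j) (h' i j). Qed.

Lemma mccvg_shift m p (U : nat -> 'M[C]_(m, p)) (T : 'M[C]_(m, p)) : mccvg U T -> mccvg (fun k => U k.+1) T.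
Proof.
move=> h i j; have [h1 h2] := h i j; split.
  by rewrite (cvg_shiftS (fun k => complex.Re (U k i j))).
by rewrite (cvg_shiftS (fun k => complex.Im (U k i j))).
Qed.

(** The linear relation between the means of the two right blocks holds for each partial product
    that contains the factor of index 0, hence the shift to [k.+1], and it passes to the limit. *)
Lemma plim_matches F T : (forall j, contractive (F j)) -> mbm T -> plim F T ->
  matches alpha (F 0%N) T.
Proof.
move=> cF bT h; have uH := triG_unit (Ymx_dr alpha (cF 0%N)).
exists (invmx (drsubmx (Y F 0)) *m cdr T); last by rewrite mulKVmx.
have e k : cur (pprod F k.+1) = F 0%N *m invmx (drsubmx (Y F 0)) *m cdr (pprod F k.+1).
  have cF' j : contractive (F j.+1) by [].
  have [rS _ _ _] := pprod_regular alpha k cF'.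
  have [_ _ eB eD] := unstrip (Ymx_unitary alpha (cF 0%N)) rS.
  rewrite /= in eB eD.
  have -> : cur (pprod F k.+1) = ursubmx (Y F 0) *m cdr (pprod (fun j => F j.+1) k).
    by rewrite -eB; congr mcint; apply/funext => z; rewrite pprodS.
  have -> : cdr (pprod F k.+1) = drsubmx (Y F 0) *m cdr (pprod (fun j => F j.+1) k).
    by rewrite -eD; congr mcint; apply/funext => z; rewrite pprodS.
  by have [_ -> _ _] := YmxP alpha (cF 0%N); rewrite mulmxA mulmxKV.
have h1 := mccvg_shift (plim_cur cF bT h).
have h2 := mccvgMl (F 0%N *m invmx (drsubmx (Y F 0))) (mccvg_shift (plim_cdr cF bT h)).
rewrite mulmxA; apply: (mccvg_unique h1).
by have -> : (fun k => cur (pprod F k.+1)) =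
  fun k => F 0%N *m invmx (drsubmx (Y F 0)) *m cdr (pprod F k.+1) by apply/funext => k; exact: e.
Qed.

Lemma plim_strip F T : (forall j, contractive (F j)) -> plim F T ->
  plim (fun j => F j.+1) (stripf (Y F 0) T).
Proof.
move=> cF h; have uY := Ymx_unitary alpha (cF 0%N).
have e k : D2 (fun z => pprod (fun j => F j.+1) k z - stripf (Y F 0) T z) =
    D2 (fun z => pprod F k.+1 z - T z).
  apply: eq_Rintegral => z _.
  rewrite pprodS -(stripfK T z uY) -mulmxBr hs2_unitaryl //.
  by rewrite -ZconjB Zconj_hs2.
move: h; rewrite /plim -(cvg_shiftS (fun k => D2 (fun z => pprod F k z - T z))) => h.
by under eq_fun do rewrite e; exact: h.
Qed.

End nlft_properties.

(** * Factorizations *)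

Section factorization.
Context {R : realType} {n : nat} (alpha : 'I_2 -> 'I_2).
Local Notation C := R[i].
Local Notation mu := (@circle_prob R).
Implicit Types (F : nat -> 'M[C]_n) (T M : circle R -> 'M[C]_(n + n)).

Local Notation cul M := (mcint (fun z => ulsubmx (M z))).
Local Notation cur M := (mcint (fun z => ursubmx (M z))).
Local Notation cdr M := (mcint (fun z => drsubmx (M z))).
Local Notation pprod := (pprod alpha).
Local Notation plim := (plim alpha).
Local Notation Y F j := (Ymx alpha (F j)).

Lemma mcint_ae m p (A B : circle R -> 'M[C]_(m, p)) : mbm A -> mbm B ->
  {ae mu, forall z, A z = B z} -> mcint A = mcint B.
Proof.
move=> bA bB h; apply/matrixP => i j; rewrite !mxE; apply: cint_ae.
- exact: bm_cmeasurable (bA i j).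
- exact: bm_cmeasurable (bB i j).
- by apply: filterS h => z ->.
Qed.

Lemma rdiag_mcint_le1 m (M : circle R -> 'M[C]_m) i : mbm M ->
  (forall z, Normc.normc (M z i i) ^+ 2 <= 1) -> rdiag (mcint M) i <= 1.
Proof.
move=> bM h; have h1 : Normc.normc (mcint M i i) ^+ 2 <= 1.
  by rewrite mxE; apply: le_trans (normc_cint (bM i i)) (N2_bound (bM i i) h).
apply: le_trans (ler_norm _) _; rewrite -(@ler_pXn2r _ 2) ?nnegrE // expr1n real_normK ?num_real //.
by apply: le_trans h1; rewrite normc2E lerDl sqr_ge0.
Qed.

Lemma cul_le1 M i : regular M -> rdiag (cul M) i <= 1.
Proof.
move=> [uM bM _ _]; apply: rdiag_mcint_le1; first exact: mbm_ul.
by move=> z; rewrite !mxE; exact: unitary_entry_le.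
Qed.

Lemma cdr_le1 M i : regular M -> rdiag (cdr M) i <= 1.
Proof.
move=> [uM bM _ _]; apply: rdiag_mcint_le1; first exact: mbm_dr.
by move=> z; rewrite !mxE; exact: unitary_entry_le.
Qed.

(** [F] is tied to the functions only through [matches]. The notion thus covers both the stripping
    of [M] by coefficients chosen for it and its stripping by the coefficients of another function
    [T]. *)
Definition chain F (Ms : nat -> circle R -> 'M[C]_(n + n)) := forall k,
  [/\ regular (Ms k), normalized alpha (Ms k), contractive (F k), matches alpha (F k) (Ms k)
    & Ms k.+1 = stripf (Y F k) (Ms k)].

Lemma prodr_le1 m (d : 'I_m -> R) : (forall i, 0 <= d i <= 1) -> 0 <= \prod_i d i <= 1.
Proof.
move=> h; rewrite prodr_ge0 => [|i _]; last by case/andP: (h i).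
by apply: prodr_ile1 => i _.
Qed.

Lemma chain_bound F Ms k : chain F Ms ->
  \prod_i rdiag (cul (Ms 0%N)) i <= \prod_(0 <= j < k) \prod_i rdiag (ulsubmx (Y F j)) i /\
  \prod_i rdiag (cdr (Ms 0%N)) i <= \prod_(0 <= j < k) \prod_i rdiag (drsubmx (Y F j)) i.
Proof.
move=> hc.
suff [e1 e2] : \prod_i rdiag (cul (Ms 0%N)) i =
    (\prod_(0 <= j < k) \prod_i rdiag (ulsubmx (Y F j)) i) * \prod_i rdiag (cul (Ms k)) i /\
  \prod_i rdiag (cdr (Ms 0%N)) i =
    (\prod_(0 <= j < k) \prod_i rdiag (drsubmx (Y F j)) i) * \prod_i rdiag (cdr (Ms k)) i.
  have [rM [nA nD] _ _ _] := hc k; rewrite e1 e2.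
  split; apply: ler_piMr.
  - apply: prodr_ge0 => j _; apply: prodr_ge0 => i _; apply/ltW.
    by have [_ _ cF _ _] := hc j; exact: rdiag_gt0 (Ymx_ul alpha cF).
  - have /andP[] // : 0 <= \prod_i rdiag (cul (Ms k)) i <= 1.
    by apply: prodr_le1 => i; rewrite cul_le1 // ltW // (rdiag_gt0 _ nA).
  - apply: prodr_ge0 => j _; apply: prodr_ge0 => i _; apply/ltW.
    by have [_ _ cF _ _] := hc j; exact: rdiag_gt0 (Ymx_dr alpha cF).
  - have /andP[] // : 0 <= \prod_i rdiag (cdr (Ms k)) i <= 1.
    by apply: prodr_le1 => i; rewrite cdr_le1 // ltW // (rdiag_gt0 _ nD).
elim: k => [|k [IH1 IH2]]; first by rewrite !big_nil !mul1r.
have [rM nM cF mF eS] := hc k.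
have [r1 [nA nD] eA eD] := strip cF rM nM mF.
rewrite -eS in r1 nA nD eA eD.
rewrite IH1 IH2 !(@big_nat_recr _ _ _ _ 0 _ (leq0n k)) /= -!mulrA; split; congr (_ * _).
  rewrite -big_split /=; apply: eq_bigr => i _.
  by rewrite eA (rdiag_mul _ (Ymx_ul alpha cF) nA).
rewrite -big_split /=; apply: eq_bigr => i _.
by rewrite eD (rdiag_mul _ (Ymx_dr alpha cF) nD).
Qed.

Definition factored T M I1 I2 := {ae mu, forall z, T z = M z *m block_mx (I1 z) 0 0 (I2 z)}.

Lemma mul_block_diag m (A : 'M[C]_(m + m)) (B D : 'M[C]_m) : A *m block_mx B 0 0 D =
  block_mx (ulsubmx A *m B) (ursubmx A *m D) (dlsubmx A *m B) (drsubmx A *m D).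
Proof. by rewrite -{1}[A]submxK mulmx_block !mulmx0 !addr0 !add0r. Qed.

Lemma factored_means T M I1 I2 : regular T -> regular M ->
  mhol (fun z => (I1 z)^t*) -> mhol I2 -> factored T M I1 I2 ->
  [/\ cul T = cul M *m mcint I1, cur T = cur M *m mcint I2 & cdr T = cdr M *m mcint I2].
Proof.
move=> [_ bT _ _] [_ bM [hA hC] [hB hD]] h1 h2 hf.
have bI1 : mbm I1.
  by move=> i j; have := mbm_adj (mhol_bm h1) i j; congr bm; apply/funext => z; rewrite trmxCK.
have bI2 := mhol_bm h2.
split.
- rewrite (@mcint_ae _ _ _ (fun z => ulsubmx (M z) *m I1 z)); last 3 first.
  + exact: mbm_ul.
  + by apply: mbmM => //; exact: mbm_ul.
  + by apply: filterS hf => z ->; rewrite mul_block_diag block_mxKul.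
  rewrite [LHS]mcint_ahol; last by apply: mbmM => //; exact: mbm_ul.
  have -> : (fun z => (ulsubmx (M z) *m I1 z)^t*) = fun z => (I1 z)^t* *m (ulsubmx (M z))^t*.
    by apply/funext => z; rewrite adjM.
  rewrite (mcint_holM h1 hA) adjM -(mcint_ahol bI1) -mcint_ahol //; exact: mbm_ul.
- rewrite (@mcint_ae _ _ _ (fun z => ursubmx (M z) *m I2 z)); last 3 first.
  + exact: mbm_ur.
  + by apply: mbmM => //; exact: mbm_ur.
  + by apply: filterS hf => z ->; rewrite mul_block_diag block_mxKur.
  exact: mcint_holM hB h2.
- rewrite (@mcint_ae _ _ _ (fun z => drsubmx (M z) *m I2 z)); last 3 first.
  + exact: mbm_dr.
  + by apply: mbmM => //; exact: mbm_dr.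
  + by apply: filterS hf => z ->; rewrite mul_block_diag block_mxKdr.
  exact: mcint_holM hD h2.
Qed.

(** [mcint I2] is a common right factor of both means, so it cancels in B(0) D(0)^-1; it is
    invertible because D(0) is invertible for [T]. *)
Lemma factored_matches T M I1 I2 (F : 'M[C]_n) : regular T -> regular M ->
  mhol (fun z => (I1 z)^t*) -> mhol I2 -> factored T M I1 I2 ->
  normalized alpha T -> matches alpha F T -> matches alpha F M.
Proof.
move=> rT rM h1 h2 hf [_ nD] [X eB eD].
have [_ e2 e3] := factored_means rT rM h1 h2 hf.
have u2 : mcint I2 \in unitmx by have := triG_unit nD; rewrite e3 unitmx_mul => /andP[].
exists (X *m invmx (mcint I2)).
  by rewrite mulmxA -eB e2 mulmxK.
by rewrite mulmxA -eD e3 mulmxK.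
Qed.

(** Stripping multiplies on the left by a constant and conjugates by [Z], and block diagonal
    matrices commute with [Z]. *)
Lemma factored_strip Y T M I1 I2 : factored T M I1 I2 ->
  factored (stripf Y T) (stripf Y M) I1 I2.
Proof.
apply: filterS => z e; rewrite /stripf e mulmxA Zunconj_mul; congr (_ *m _).
by rewrite ZunconjE block_mxKul block_mxKur block_mxKdl block_mxKdr !scaler0.
Qed.

Fixpoint strips F M k := if k is k'.+1 then stripf (Y F k') (strips F M k') else M.

(** Only [T] is known to be a limit of partial products. At each stage [M] inherits the matching
    coefficient from [T], because the inner factors are unchanged by stripping. *)
Lemma strips_inv F T M I1 I2 : (forall j, contractive (F j)) -> plim F T ->
  regular T -> normalized alpha T -> regular M -> normalized alpha M ->
  mhol (fun z => (I1 z)^t*) -> mhol I2 -> factored T M I1 I2 ->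
  chain F (strips F M).
Proof.
move=> cF hT rT nT rM nM h1 h2 hf.
have inv k : [/\ regular (strips F T k), normalized alpha (strips F T k),
    plim (fun j => F (k + j)%N) (strips F T k) & factored (strips F T k) (strips F M k) I1 I2] /\
    (regular (strips F M k) /\ normalized alpha (strips F M k)).
  elim: k => [|k [[rTk nTk hTk hfk] [rMk nMk]]]; first by [].
  have mT : matches alpha (F k) (strips F T k).
    have [_ bTk _ _] := rTk.
    by have := @plim_matches _ _ _ (fun j => F (k + j)%N) _ (fun j => cF _) bTk hTk; rewrite addn0.
  have mM := factored_matches rTk rMk h1 h2 hfk nTk mT.
  have [r1 n1 _ _] := strip (cF k) rTk nTk mT.
  have [r2 n2 _ _] := strip (cF k) rMk nMk mM.
  split; last by split; [exact: r2|exact: n2].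
  split; [exact: r1|exact: n1| |exact: factored_strip].
  have := @plim_strip _ _ _ (fun j => F (k + j)%N) _ (fun j => cF _) hTk; rewrite addn0.
  have -> : (fun j => F (k + j.+1)%N) = (fun j => F (k.+1 + j)%N) by apply/funext => j; rewrite addnS.
  exact.
move=> k; have [[rTk nTk hTk hfk] [rMk nMk]] := inv k.
have mT : matches alpha (F k) (strips F T k).
  have [_ bTk _ _] := rTk.
  by have := @plim_matches _ _ _ (fun j => F (k + j)%N) _ (fun j => cF _) bTk hTk; rewrite addn0.
split; [exact: rMk|exact: nMk|exact: cF| |by []].
exact: factored_matches rTk rMk h1 h2 hfk nTk mT.
Qed.

Lemma ccvg_real_ge m a (U : nat -> 'M[C]_m) (T : 'M[C]_m) (c : R) :
  (forall k, triG a (U k)) -> triG a T -> mccvg U T ->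
  (forall k, c <= \prod_i rdiag (U k) i) -> c <= \prod_i rdiag T i.
Proof.
move=> tU tT h hc; have [h1 _] := mccvg_det h.
have -> : \prod_i rdiag T i = complex.Re (\det T) by rewrite (triG_det_rdiag tT).
rewrite -(cvg_lim _ h1) //; apply: limr_ge; first by apply/cvg_ex; eexists; exact: h1.
by apply: nearW => k; rewrite (triG_det_rdiag (tU k)) /=.
Qed.

Lemma prod_eq1 m (d : 'I_m -> R) : (forall i, 0 < d i <= 1) -> 1 <= \prod_i d i ->
  forall i, d i = 1.
Proof.
move=> h h1 i; apply/eqP; rewrite eq_le; have /andP[d0 ->] := h i; rewrite /=.
apply: le_trans h1 _; rewrite (bigD1 i) //= ler_piMr ?(ltW d0) //.
by apply: prodr_ile1 => j _; have /andP[/ltW -> ->] := h j.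
Qed.

(** The mean of [I] is [invmx A *m B], hence in the triangular group. Its diagonal entries are at
    most 1 while their product is at least 1, so all of them are 1. *)
Lemma inner_trivial a (I : circle R -> 'M[C]_n) (A B : 'M[C]_n) :
  (forall z, I z \is unitarymx) -> mbm I -> triG a A -> triG a B -> B = A *m mcint I ->
  \prod_i rdiag A i <= \prod_i rdiag B i -> {ae mu, forall z, I z = 1%:M}.
Proof.
move=> uI bI tA tB e hle.
have tI : triG a (mcint I).
  have -> : mcint I = invmx A *m B by rewrite e mulKmx // (triG_unit tA).
  by apply: triG_mul => //; exact: triG_inv.
have d01 i : 0 < rdiag (mcint I) i <= 1.
  rewrite (rdiag_gt0 _ tI) /=; apply: rdiag_mcint_le1 => // z; exact: unitary_entry_le.
have pA : 0 < \prod_i rdiag A i by apply: prodr_gt0 => i _; exact: rdiag_gt0 tA.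
have h1 : 1 <= \prod_i rdiag (mcint I) i.
  rewrite -(ler_pM2l pA) mulr1 -big_split /=; apply: le_trans hle _.
  by rewrite e le_eqVlt; apply/orP; left; apply/eqP/eq_bigr => i _; rewrite (rdiag_mul _ tA tI).
have bI1 : mbm (fun z => I z - 1%:M) by apply: mbmB => //; exact: mbm_cst.
have : D2 (fun z => I z - 1%:M) = 0.
  rewrite (D2_unitary_sub1 uI bI) (eq_bigr (fun=> 1)) => [|i _]; last exact: prod_eq1.
  by rewrite sumr_const card_ord subrr.
by move/(D2_eq0 bI1); apply: filterS => z /eqP; rewrite subr_eq0 => /eqP.
Qed.

Lemma plim_outer F T M I1 I2 : ell2_contractive F -> mbm T -> (forall z, T z \is unitarymx) ->
  plim F T -> regular M -> normalized alpha M ->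
  (forall z, I1 z \is unitarymx) -> (forall z, I2 z \is unitarymx) ->
  mhol (fun z => (I1 z)^t*) -> mhol I2 -> factored T M I1 I2 ->
  {ae mu, forall z, I1 z = 1%:M} /\ {ae mu, forall z, I2 z = 1%:M}.
Proof.
move=> hF bT uT hT rM nM u1 u2 h1 h2 hf; have [cF _] := hF.
have rT := plim_regular cF bT uT hT; have nT := plim_normalized hF bT hT.
have hc := strips_inv cF hT rT nT rM nM h1 h2 hf.
have [e1 _ e3] := factored_means rT rM h1 h2 hf.
have [nTA nTD] := nT; have [nMA nMD] := nM.
have bI1 : mbm I1.
  by move=> i j; have := mbm_adj (mhol_bm h1) i j; congr bm; apply/funext => z; rewrite trmxCK.
split.
- apply: (inner_trivial u1 bI1 nMA nTA e1).
  apply: (ccvg_real_ge _ nTA (plim_cul cF bT hT)) => k.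
    by have [_ [] ] := pprod_regular alpha k cF.
  have [_ _ ep _] := pprod_regular alpha k cF.
  rewrite [X in _ <= X](eq_bigr _ (fun i _ => ep i)).
  by rewrite exchange_big /=; have [] := chain_bound k hc.
- apply: (inner_trivial u2 (mhol_bm h2) nMD nTD e3).
  apply: (ccvg_real_ge _ nTD (plim_cdr cF bT hT)) => k.
    by have [_ [] ] := pprod_regular alpha k cF.
  have [_ _ _ ep] := pprod_regular alpha k cF.
  rewrite [X in _ <= X](eq_bigr _ (fun i _ => ep i)).
  by rewrite exchange_big /=; have [] := chain_bound k hc.
Qed.

End factorization.

(** * Existence of the factorization T diag(I1, I2) *)

Section factor_exists.
Context {R : realType} {n : nat} (alpha : 'I_2 -> 'I_2).
Local Notation C := R[i].
Local Notation mu := (@circle_prob R).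
Implicit Types (F : nat -> 'M[C]_n) (T M : circle R -> 'M[C]_(n + n)).

Local Notation cul M := (mcint (fun z => ulsubmx (M z))).
Local Notation pprod := (pprod alpha).
Local Notation plim := (plim alpha).
Local Notation Y F j := (Ymx alpha (F j)).

Lemma chain_exists M : regular M -> normalized alpha M ->
  exists F Ms, Ms 0%N = M /\ chain alpha F Ms.
Proof.
move=> rM nM.
(* The coefficient is chosen for every matrix function at once, so that [Ms] becomes a plain
   recursion; off the normalized functions nothing is claimed and the witness is 0. *)
have : forall M', exists K, normalized alpha M' -> contractive K /\ matches alpha K M'.
  move=> M'; case: (pselect (normalized alpha M')) => [h|nh]; last by exists 0.
  by have [K cK mK] := matches_exists h; exists K.
move=> /choice [f hf].
pose Ms := fix Ms k := if k is k'.+1 then stripf (Ymx alpha (f (Ms k'))) (Ms k') else M.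
have inv k : regular (Ms k) /\ normalized alpha (Ms k).
  elim: k => [|k [rk nk]]; first by [].
  have [cK mK] := hf _ nk; have [r1 n1 _ _] := strip cK rk nk mK.
  by split; [exact: r1|exact: n1].
exists (fun k => f (Ms k)), Ms; split=> // k; have [rk nk] := inv k.
by have [cK mK] := hf _ nk; split; [exact: rk|exact: nk|exact: cK|exact: mK|].
Qed.

Lemma chain_pprod F Ms k z : chain alpha F Ms -> Ms 0%N z = pprod F k z *m Zconj z k (Ms k z).
Proof.
move=> hc; elim: k => [|k ->]; first by rewrite pprod0 mul1mx Zconj0.
have [_ _ cF _ eS] := hc k.
rewrite pprodSr -mulmxA -(addn1 k) -ZconjD -Zconj_mul addn1 eS.
by rewrite stripfK //; exact: Ymx_unitary.
Qed.

Lemma chain_ell2 F Ms : chain alpha F Ms -> ell2_contractive F.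
Proof.
move=> hc; have cF j : contractive (F j) by have [] := hc j.
split=> //; pose p := \prod_i rdiag (cul (Ms 0%N)) i.
have p0 : 0 < p.
  by apply: prodr_gt0 => i _; have [_ [nA _] _ _ _] := hc 0%N; exact: rdiag_gt0 nA.
(* The squared determinant for index [j] is at most [expR (- hs2 (F j))], and the product of these
   squares is at least [p ^+ 2]. *)
have hs k : \sum_(0 <= j < k) hs2 (F j) <= - ln (p ^+ 2).
  have [h1 _] := chain_bound k hc.
  have : p ^+ 2 <= expR (- \sum_(0 <= j < k) hs2 (F j)).
    rewrite -sumrN expR_sum.
    apply: (@le_trans _ _ (\prod_(0 <= j < k) (\prod_i rdiag (ulsubmx (Y F j)) i) ^+ 2)).
      by rewrite prodrXl ler_pXn2r // nnegrE ltW // (lt_le_trans p0).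
    by apply: ler_prod => j _; rewrite sqr_ge0 Ymx_ul_prod.
  move=> h2; rewrite lerNr -[X in _ <= X]expRK ler_ln // posrE ?exprn_gt0 // expR_gt0 //.
apply: le_lt_trans (ltry (- ln (p ^+ 2))); apply: lime_le.
  by apply: is_cvg_nneseries => k _ _; rewrite lee_fin sqr_ge0.
apply: nearW => k; rewrite sumEFin lee_fin; under eq_bigr do rewrite hsnorm2.
exact: hs.
Qed.

(* [f] has no Fourier coefficients: those of [z^k g_k] of index less than [k]
   vanish. *)
Lemma shifted_lim_eq0 (f : circle R -> C) (g : nat -> circle R -> C) (d : nat -> R) :
  bm f -> (forall k, hol (g k)) -> (forall k, N2 (fun z => f z - val z ^+ k * g k z) <= d k) ->
  d k @[k --> \oo] --> (0 : R) -> {ae mu, forall z, f z = 0}.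
Proof.
move=> bf hg hd d0.
have bz (k : nat) := @bm_exp R k.
have zg k m : cintegral (fun z => val z ^+ k * g k z * val z ^+ m.+1) = 0.
  under eq_fun do rewrite mulrC mulrA -exprD mulrC.
  by have := hol_exp (m.+1 + k) (hg k); rewrite addSn expr0n mul0r.
have zgJ k m : (m < k)%N -> cintegral (fun z => val z ^+ k * g k z * ((val z)^*) ^+ m) = 0.
  move=> mk; have -> : (fun z : circle R => val z ^+ k * g k z * ((val z)^*) ^+ m) =
      fun z => g k z * val z ^+ (k - m).
    apply/funext => z; rewrite -{1}(subnK (ltnW mk)) exprD.
    have : val z ^+ m * (val z)^* ^+ m = 1 by rewrite -exprMn circle_conjM expr1n.
    move: (val z ^+ m) ((val z)^* ^+ m) (val z ^+ (k - m)) (g k z) => x y u v xy.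
    by transitivity (x * y * (v * u)); [ring|rewrite xy mul1r].
  rewrite (hol_exp _ (hg k)) expr0n subn_eq0 leqNgt mk mul0r //.
have lim0 (u : circle R -> C) k0 : bm u -> (forall z, Normc.normc (u z) ^+ 2 <= 1) ->
    (forall k, (k0 < k)%N -> cintegral (fun z => val z ^+ k * g k z * u z) = 0) ->
    cintegral (fun z => f z * u z) = 0.
  move=> bu u1 hu; apply: (@small_eq0 _ _ 1) => e e0.
  move/cvgr_lt : d0 => /(_ _ e0) [N _ hN].
  pose k := maxn N k0.+1; have dk : d k < e by apply: hN; rewrite /= leq_maxl.
  have bk : bm (fun z => val z ^+ k * g k z) by apply: bmM => //; exact: hol_bm.
  have bfk := bmB bf bk.
  have -> : cintegral (fun z => f z * u z) = cintegral (fun z => u z * (f z - val z ^+ k * g k z)).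
    rewrite -[LHS]subr0 -(hu k); last by rewrite /k leq_max ltnSn orbT.
    rewrite -cintB; [|exact: bmM|exact: bmM].
    by congr cintegral; apply/funext => z; rewrite -mulrBl mulrC.
  apply: le_trans (normc_cint (bmM bu bfk)) _.
  apply: le_trans (N2Ml bu bfk u1) _; rewrite ler_wpM2l //.
  by apply: le_trans (hd k) (ltW dk).
have hf : hol f.
  split=> // m; apply: (lim0 _ 0%N) => [||k _]; [exact: bm_exp| |exact: zg].
  by move=> z; rewrite circle_normcX expr1n.
have bzJ m : bm (fun z : circle R => (val z)^* ^+ m).
  by have := bmJ (bz m); congr bm; apply/funext => z; rewrite rmorphXn.
have nJ m (z : circle R) : Normc.normc ((val z)^* ^+ m) ^+ 2 <= 1.
  by rewrite -rmorphXn normc2E cReJ cImJ sqrrN -normc2E circle_normcX expr1n.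
have hfJ : hol (fun z => (f z)^*).
  split=> [|m]; first exact: bmJ.
  have -> : (fun z : circle R => (f z)^* * val z ^+ m.+1) = (fun z => (f z * (val z)^* ^+ m.+1)^*).
    by apply/funext => z; rewrite rmorphM rmorphXn /= conjCK.
  rewrite cintJ; last exact: bmM.
  by rewrite (lim0 _ m.+1) ?conjC0 // => k; exact: zgJ.
have f0 : cintegral f = 0.
  have -> : cintegral f = cintegral (fun z => f z * 1).
    by congr cintegral; apply/funext => z; rewrite mulr1.
  apply: (lim0 (fun=> 1) 0%N (bm_cst 1)) => [z|k k0].
    by rewrite Normc.normc1 expr1n.
  by have := zgJ k 0%N k0; congr (cintegral _ = _); apply/funext => z; rewrite expr0.
by have := hol_conj_cst hf hfJ; rewrite f0.
Qed.

Lemma ulE (A : 'M[C]_(n + n)) i j : ulsubmx A i j = A (lshift n i) (lshift n j).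
Proof. by rewrite !mxE. Qed.
Lemma urE (A : 'M[C]_(n + n)) i j : ursubmx A i j = A (lshift n i) (@rshift n n j).
Proof. by rewrite !mxE. Qed.
Lemma dlE (A : 'M[C]_(n + n)) i j : dlsubmx A i j = A (@rshift n n i) (lshift n j).
Proof. by rewrite !mxE. Qed.
Lemma drE (A : 'M[C]_(n + n)) i j : drsubmx A i j = A (@rshift n n i) (@rshift n n j).
Proof. by rewrite !mxE. Qed.

Lemma ae_mx0 p q (A : circle R -> 'M[C]_(p, q)) :
  (forall i j, {ae mu, forall z, A z i j = 0}) -> {ae mu, forall z, A z = 0}.
Proof.
move=> h; have : {ae mu, forall z, forall (i : 'I_p) (j : 'I_q), A z i j = 0}.
  by apply: ae_ord => i; apply: ae_ord => j; exact: h.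
by apply: filterS => z hz; apply/matrixP => i j; rewrite hz mxE.
Qed.

Lemma factor_exists M : regular M -> normalized alpha M ->
  exists F T I1 I2, [/\ ell2_contractive F,
    [/\ mbm T, forall z, SUgroup (T z) & plim F T],
    mhol (fun z => (I1 z)^t*) /\ mhol I2,
    {ae mu, forall z, Ugroup (I1 z)} /\ {ae mu, forall z, Ugroup (I2 z)} &
    factored M T I1 I2].
Proof.
move=> rM nM; have [F [Ms [e0 hc]]] := chain_exists rM nM.
have hF := chain_ell2 hc; have [cF _] := hF.
have [T [bT ST hT]] := plim_exists alpha hF.
have [uM bM _ _] := rM.
pose W z := (T z)^t* *m M z.
have uT z : T z \is unitarymx by case: (ST z).
have uW z : W z \is unitarymx by apply: mul_unitarymx => //; rewrite trmxC_unitary.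
have bW : mbm W by apply: mbmM => //; exact: mbm_adj.
pose d k := D2 (fun z => pprod F k z - T z).
have bk k : mbm (Ms k) by have [[_ h _ _] _ _ _ _] := hc k; exact: h.
(* [W z - Zconj z k (Ms k z)] is the adjoint of [T z - pprod F k z] times the unitary matrix [M z],
   so the convergence of the partial products carries over to the conjugates of the stripped
   functions. *)
have eW k z : hs2 (W z - Zconj z k (Ms k z)) = hs2 (pprod F k z - T z).
  have uP := pprod_unitary alpha k z cF.
  have -> : Zconj z k (Ms k z) = (pprod F k z)^t* *m M z.
    by rewrite -e0 (chain_pprod k z hc) mulmxA unitarymxPl // mul1mx.
  rewrite /W -mulmxBl (hs2_unitaryr _ (uM z)) -adjB hs2_adj; exact: hs2_sym.
have ent k (p q : 'I_(n + n)) (f : circle R -> C) : (forall z, f z = Zconj z k (Ms k z) p q) ->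
    bm f -> N2 (fun z => W z p q - f z) <= d k.
  move=> ef bf; apply: le_rint => [||z].
  - by apply: bm_normc; apply: bmB => //; exact: bW.
  - by apply: rbm_hs2; apply: mbmB => //; exact: pprod_bm.
  - by rewrite -eW ef -mxsubE; exact: le_hs2_entry.
have rk k := let: And5 h _ _ _ _ := hc k in h.
have hI1 : mhol (fun z => (ulsubmx (W z))^t*).
  move=> i j; under eq_fun do rewrite adjE ulE.
  pose p := lshift n j; pose q := lshift n i.
  have [_ _ _ _] := rk 0%N.
  apply: (hol_D2_lim (U := fun k => pprod F k) (T := T) (f := fun k z => (Ms k z p q)^*)) hT.
  - by apply: bmJ; exact: bW.
  - move=> k; have [_ _ [h _] _] := rk k.
    by have := h i j; congr hol; apply/funext => z; rewrite adjE !mxE.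
  - move=> k; have := @ent k p q (fun z => Ms k z p q) _ (bk k p q); rewrite -/(d k).
    have -> : N2 (fun z => (Ms k z p q)^* - (W z p q)^*) = N2 (fun z => W z p q - Ms k z p q).
      apply: eq_Rintegral => z _; rewrite !normc2E !(cReD, cImD, cReN, cImN, cReJ, cImJ).
      ring.
    by apply=> z; rewrite /Zconj block_mxEul !mxE.
have hI2 : mhol (fun z => drsubmx (W z)).
  move=> i j; under eq_fun do rewrite drE.
  pose p := @rshift n n i; pose q := @rshift n n j.
  apply: (hol_D2_lim (U := fun k => pprod F k) (T := T) (f := fun k z => Ms k z p q)) hT.
  - exact: bW.
  - move=> k; have [_ _ _ [_ h]] := rk k.
    by have := h i j; congr hol; apply/funext => z; rewrite !mxE.
  - move=> k; rewrite N2_sym; apply: ent; last exact: bk.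
    by move=> z; rewrite /Zconj block_mxEdr !mxE.
have W12 : {ae mu, forall z, ursubmx (W z) = 0}.
  apply: ae_mx0 => i j; pose p := lshift n i; pose q := @rshift n n j.
  suff : {ae mu, forall z, W z p q = 0} by apply: filterS => z h; rewrite urE.
  apply: (shifted_lim_eq0 (g := fun k z => Ms k z p q) (bW p q)) hT.
  - move=> k; have [_ _ _ [h _]] := rk k.
    by have := h i j; congr hol; apply/funext => z; rewrite !mxE.
  - move=> k; apply: ent; last by apply: bmM; [exact: bm_exp|exact: bk].
    by move=> z; rewrite /Zconj block_mxEur !mxE.
(* The lower left block of the conjugate is [z ^- k] times that of [Ms k]; conjugating the entries
   turns it into [z ^+ k] times an analytic function. *)
have W21 : {ae mu, forall z, dlsubmx (W z) = 0}.
  apply: ae_mx0 => i j; pose p := @rshift n n i; pose q := lshift n j.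
  suff : {ae mu, forall z, (W z p q)^* = 0}.
    by apply: filterS => z /eqP; rewrite conjC_eq0 dlE => /eqP.
  apply: (shifted_lim_eq0 (g := fun k z => (Ms k z p q)^*) (bmJ (bW p q))) hT.
  - move=> k; have [_ _ [_ h] _] := rk k.
    by have := h j i; congr hol; apply/funext => z; rewrite adjE !mxE.
  - move=> k; have := @ent k p q (fun z => val z ^- k * Ms k z p q) _ _; rewrite -/(d k).
    have -> : N2 (fun z => W z p q - val z ^- k * Ms k z p q) =
        N2 (fun z => (W z p q)^* - val z ^+ k * (Ms k z p q)^*).
      apply: eq_Rintegral => z _.
      have -> : (W z p q)^* - val z ^+ k * (Ms k z p q)^* = (W z p q - val z ^- k * Ms k z p q)^*.
        by rewrite rmorphB rmorphM /= -exprVn -circle_conjE rmorphXn /= conjCK.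
      by rewrite !normc2E cReJ cImJ sqrrN.
    apply; last by apply: bmM; [exact: bm_expV|exact: bk].
    by move=> z; rewrite /Zconj block_mxEdl !mxE.
have eWd : {ae mu, forall z, W z = block_mx (ulsubmx (W z)) 0 0 (drsubmx (W z))}.
  by near=> z; rewrite -[LHS]submxK (near W12 z) ?(near W21 z).
have dU : {ae mu, forall z, ulsubmx (W z) *m (ulsubmx (W z))^t* = 1%:M /\
    drsubmx (W z) *m (drsubmx (W z))^t* = 1%:M}.
  apply: filterS eWd => z e; have := unitarymxP (uW z); rewrite e adj_block mulmx_block.
  rewrite block_mxKul block_mxKdr !adj0 !mulmx0 !mul0mx !addr0 !add0r scalar_mx_block.
  by move/eq_block_mx => [h1 _ _ h2].
exists F, T, (fun z => ulsubmx (W z)), (fun z => drsubmx (W z)); split.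
- exact: hF.
- by split; [exact: bT|exact: ST|exact: hT].
- by split; [exact: hI1|exact: hI2].
- by split; apply: filterS dU => z [h1 h2]; apply/unitarymxP; [exact: h1|exact: h2].
- apply: filterS eWd => z <-; rewrite /W mulmxA (unitarymxP (uT z)) mul1mx //.
Unshelve. all: by end_near. Qed.

End factor_exists.

(** * Functions up to null sets, and the equality of the spaces *)

Section outer_spaces.
Context {R : realType} {n : nat} (alpha : 'I_2 -> 'I_2).
Local Notation C := R[i].
Local Notation mu := (@circle_prob R).
Implicit Types (F : nat -> 'M[C]_n) (T M : circle R -> 'M[C]_(n + n)).

Local Notation cul M := (mcint (fun z => ulsubmx (M z))).
Local Notation cdr M := (mcint (fun z => drsubmx (M z))).
Local Notation pprod := (pprod alpha).
Local Notation plim := (plim alpha).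

Lemma mx_disc_ext0 p q (A : circle R -> 'M[C]_(p, q)) : mx_disc_ext A 0 = mcint A.
Proof. by apply/matrixP => i j; rewrite !mxE disc_ext0. Qed.

Lemma cmeasurable_adj (f : circle R -> C) : cmeasurable f -> cmeasurable (fun z => (f z)^*).
Proof.
move=> [h1 h2]; split; first by under eq_fun do rewrite cReJ.
by under eq_fun do rewrite cImJ; apply: measurableT_comp h2.
Qed.

Lemma mcint_ae_meas p q (A B : circle R -> 'M[C]_(p, q)) : mx_measurable A -> mx_measurable B ->
  {ae mu, forall z, A z = B z} -> mcint A = mcint B.
Proof.
move=> bA bB h; apply/matrixP => i j; rewrite !mxE; apply: cint_ae => //.
by apply: filterS h => z ->.
Qed.

Lemma mx_measurable_adj p q (A : circle R -> 'M[C]_(p, q)) : mx_measurable A ->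
  mx_measurable (fun z => (A z)^t*).
Proof. by move=> h i j; under eq_fun do rewrite adjE; exact: cmeasurable_adj. Qed.

Lemma at_infty_ae p q (A B : circle R -> 'M[C]_(p, q)) : mx_measurable A -> mbm B ->
  {ae mu, forall z, A z = B z} -> at_infty A = mcint B.
Proof.
move=> mA bB h; rewrite /at_infty mx_disc_ext0 (mcint_ahol bB); congr (_ ^t*).
apply: mcint_ae_meas.
- exact: mx_measurable_adj.
- by move=> i j; exact: bm_cmeasurable (mbm_adj bB i j).
- by apply: filterS h => z ->.
Qed.

Lemma unitary_mbm m (M : circle R -> 'M[C]_m) : mx_measurable M ->
  (forall z, M z \is unitarymx) -> mbm M.
Proof.
by move=> mM uM i j; apply: (@bmP _ _ 1) => // z; exact: unitary_entry_le.
Qed.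

(** Resetting the values to the identity on a measurable null set gives a representative that is
    unitary at every point, hence bounded. *)
Lemma everywhere_version m (G : set 'M[C]_m) (M : circle R -> 'M[C]_m) : G 1%:M ->
  (forall A, G A -> A \is unitarymx) -> mx_measurable M -> {ae mu, forall z, G (M z)} ->
  exists N, [/\ mbm N, forall z, G (N z) & {ae mu, forall z, M z = N z}].
Proof.
move=> G1 GU mM [B [mB B0 hB]].
pose N z : 'M[C]_m := if `[< B z >] then 1%:M else M z.
have GN z : G (N z).
  rewrite /N; case: asboolP => // nBz; apply: contrapT => nG.
  by apply: nBz; apply: hB => h; apply: nG; exact: h.
exists N; split=> //; last first.
  exists B; split=> // z h; apply: contrapT => nBz; apply: h.
  by rewrite /= /N; case: asboolP.
apply: unitary_mbm; last by move=> z; exact: GU (GN z).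
have hA (u v : circle R -> R) : measurable_fun setT u -> measurable_fun setT v ->
    measurable_fun setT (fun z => if `[< B z >] then u z else v z).
  move=> hu hv; apply: measurable_fun_ifT => //.
  apply: (measurable_fun_bool true).
  suff -> : (fun z => `[< B z >]) @^-1` [set true] = B by rewrite setTI.
  by apply/seteqP; split => z /= /asboolP.
move=> i j; have [m1 m2] := mM i j; split.
  have := hA _ _ (measurable_cst (complex.Re ((1%:M : 'M[C]_m) i j))) m1.
  by congr measurable_fun; apply/funext => z; rewrite /N; case: ifP.
have := hA _ _ (measurable_cst (complex.Im ((1%:M : 'M[C]_m) i j))) m2.
by congr measurable_fun; apply/funext => z; rewrite /N; case: ifP.
Qed.

Lemma mxH2_mhol p q (A B : circle R -> 'M[C]_(p, q)) :
  {ae mu, forall z, A z = B z} -> mxH2 A -> mbm B -> mhol B.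
Proof.
move=> h hA bB i j; apply: H2_hol (hA i j) (bB i j).
by apply: filterS h => z ->.
Qed.

Lemma mhol_mxH2 p q (A B : circle R -> 'M[C]_(p, q)) : mx_measurable A ->
  {ae mu, forall z, A z = B z} -> mhol B -> mxH2 A.
Proof.
move=> mA h hB i j; apply: hol_H2 (mA i j) _ (hB i j).
by apply: filterS h => z ->.
Qed.

Lemma meas_ul M : mx_measurable M -> mx_measurable (fun z => ulsubmx (M z)).
Proof. by move=> h i j; under eq_fun do rewrite !mxE; exact: h. Qed.
Lemma meas_ur M : mx_measurable M -> mx_measurable (fun z => ursubmx (M z)).
Proof. by move=> h i j; under eq_fun do rewrite !mxE; exact: h. Qed.
Lemma meas_dl M : mx_measurable M -> mx_measurable (fun z => dlsubmx (M z)).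
Proof. by move=> h i j; under eq_fun do rewrite !mxE; exact: h. Qed.
Lemma meas_dr M : mx_measurable M -> mx_measurable (fun z => drsubmx (M z)).
Proof. by move=> h i j; under eq_fun do rewrite !mxE; exact: h. Qed.

(** * Regular representatives of admissible functions *)

Section group.
Context (G : set 'M[C]_(n + n)) (SUG : @SUgroup R (n + n) `<=` G)
  (GU : G `<=` @Ugroup R (n + n)).

Lemma admissible_regular M : admissible G alpha M -> exists M',
  [/\ regular M', normalized alpha M', forall z, G (M' z) & {ae mu, forall z, M z = M' z}].
Proof.
move=> [mM gM [hA hC hB hD] [nA nD]].
have G1 : G (1%:M : 'M[C]_(n + n)) by apply: SUG; exact: (@SU1 R (n + n)).
have hGU (A : 'M[C]_(n + n)) : G A -> A \is unitarymx by move=> GA; exact: GU GA.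
have [M' [bM GM e]] := @everywhere_version (n + n) G M G1 hGU mM gM.
have uM z : M' z \is unitarymx by exact: GU (GM z).
have eA : {ae mu, forall z, ulsubmx (M z) = ulsubmx (M' z)} by apply: filterS e => z ->.
have eB : {ae mu, forall z, ursubmx (M z) = ursubmx (M' z)} by apply: filterS e => z ->.
have eD : {ae mu, forall z, drsubmx (M z) = drsubmx (M' z)} by apply: filterS e => z ->.
have eAJ : {ae mu, forall z, (ulsubmx (M z))^t* = (ulsubmx (M' z))^t*} by apply: filterS e => z ->.
have eCJ : {ae mu, forall z, (dlsubmx (M z))^t* = (dlsubmx (M' z))^t*} by apply: filterS e => z ->.
exists M'; split; [|split|exact: GM|exact: e].
- split; [exact: uM|exact: bM| |].
    split; first exact: mxH2_mhol eAJ hA (mbm_adj (mbm_ul bM)).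
    exact: mxH2_mhol eCJ hC (mbm_adj (mbm_dl bM)).
  split; first exact: mxH2_mhol eB hB (mbm_ur bM).
  exact: mxH2_mhol eD hD (mbm_dr bM).
- by rewrite -(at_infty_ae (meas_ul mM) (mbm_ul bM) eA).
- rewrite -(@mcint_ae_meas _ _ (fun z => drsubmx (M z))) -?mx_disc_ext0 //; first exact: meas_dr.
  by move=> i j; exact: bm_cmeasurable (mbm_dr bM i j).
Qed.

Lemma regular_admissible M M' : mx_measurable M -> regular M' -> normalized alpha M' ->
  (forall z, G (M' z)) -> {ae mu, forall z, M z = M' z} -> admissible G alpha M.
Proof.
move=> mM [uM bM [hA hC] [hB hD]] [nA nD] GM e.
have eA : {ae mu, forall z, ulsubmx (M z) = ulsubmx (M' z)} by apply: filterS e => z ->.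
have eB : {ae mu, forall z, ursubmx (M z) = ursubmx (M' z)} by apply: filterS e => z ->.
have eD : {ae mu, forall z, drsubmx (M z) = drsubmx (M' z)} by apply: filterS e => z ->.
have eAJ : {ae mu, forall z, (ulsubmx (M z))^t* = (ulsubmx (M' z))^t*} by apply: filterS e => z ->.
have eCJ : {ae mu, forall z, (dlsubmx (M z))^t* = (dlsubmx (M' z))^t*} by apply: filterS e => z ->.
split=> //.
- by apply: filterS e => z ->.
- split.
  + exact: mhol_mxH2 (mx_measurable_adj (meas_ul mM)) eAJ hA.
  + exact: mhol_mxH2 (mx_measurable_adj (meas_dl mM)) eCJ hC.
  + exact: mhol_mxH2 (meas_ur mM) eB hB.
  + exact: mhol_mxH2 (meas_dr mM) eD hD.
- rewrite (at_infty_ae (meas_ul mM) (mbm_ul bM) eA) mx_disc_ext0; split=> //.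
  rewrite (@mcint_ae_meas _ _ _ (fun z => drsubmx (M' z))) //; first exact: meas_dr.
  by move=> i j; exact: bm_cmeasurable (mbm_dr bM i j).
Qed.

End group.

Lemma det_infty_ae M M' : mx_measurable M -> mbm M' -> {ae mu, forall z, M z = M' z} ->
  det_infty M = \det (cul M').
Proof.
move=> mM bM e; rewrite /det_infty (at_infty_ae (meas_ul mM) (mbm_ul bM)) //.
by apply: filterS e => z ->.
Qed.

Lemma measurable_hs2 p q (A : circle R -> 'M[C]_(p, q)) : mx_measurable A ->
  measurable_fun setT (fun z => hs2 (A z)).
Proof.
move=> mA; apply: measurable_sum => i; apply: measurable_sum => j.
under eq_fun do rewrite normc2E.
by have [h1 h2] := mA i j; apply: measurable_funD; exact: measurable_funX.
Qed.

Lemma mx_measurableB p q (A B : circle R -> 'M[C]_(p, q)) : mx_measurable A -> mx_measurable B ->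
  mx_measurable (fun z => A z - B z).
Proof.
move=> mA mB i j; have [a1 a2] := mA i j; have [b1 b2] := mB i j; split.
  by under eq_fun do rewrite mxsubE cReD cReN; exact: measurable_funB.
by under eq_fun do rewrite mxsubE cImD cImN; exact: measurable_funB.
Qed.

Lemma mbm_measurable p q (A : circle R -> 'M[C]_(p, q)) : mbm A -> mx_measurable A.
Proof. by move=> h i j; exact: bm_cmeasurable (h i j). Qed.

Lemma D2_EFin p q (A : circle R -> 'M[C]_(p, q)) : mbm A ->
  (\int[mu]_z (hs2 (A z))%:E = (D2 A)%:E)%E.
Proof.
by move=> hA; rewrite /D2 /Rintegral fineK //; exact: integrable_fin_num (rbm_integrable (rbm_hs2 hA)).
Qed.

Lemma nlft_truncE F N : nlft_trunc alpha F N = pprod F N.+1.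
Proof. by []. Qed.

(** The logarithmic term converges because the determinants of the means tend to a positive limit.
    The index is shifted since the truncation at [N] keeps [N.+1] factors. *)
Lemma plim_is_nlft F T M : ell2_contractive F -> mbm T -> (forall z, T z \is unitarymx) ->
  plim F T -> mx_measurable M -> {ae mu, forall z, M z = T z} -> is_nlft alpha F M.
Proof.
move=> hF bT uT hT mM e; have [cF _] := hF.
have rT := plim_regular cF bT uT hT; have [nTA nTD] := plim_normalized hF bT hT.
have dT : det_infty M = \det (cul T) by exact: det_infty_ae.
split.
  split=> //; last by rewrite dT; exact: triG_det_gt0 nTA.
  have [_ _ [hA _] _] := rT.
  apply: mhol_mxH2 (mx_measurable_adj (meas_ul mM)) _ hA.
  by apply: filterS e => z ->.
pose d N := Num.sqrt (D2 (fun z => pprod F N.+1 z - T z)) +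
  `|ln (complex.Re (\det (cul (pprod F N.+1)))) - ln (complex.Re (\det (cul T)))|.
have -> : (fun N => nlft_dist (nlft_trunc alpha F N) M) = fun N => (d N)%:E.
  apply/funext => N; rewrite /nlft_dist dT nlft_truncE.
  have bP := pprod_bm alpha N.+1 cF.
  rewrite (det_infty_ae (mbm_measurable bP) bP (aeW _ (fun=> erefl))).
  have -> : (\int[mu]_z (hsnorm (pprod F N.+1 z - M z) ^+ 2)%:E =
      \int[mu]_z (hs2 (pprod F N.+1 z - T z))%:E)%E.
    under eq_integral do rewrite hsnorm2.
    apply: ae_eq_integral => //.
    - apply/measurable_EFinP; exact: measurable_hs2 (mx_measurableB (mbm_measurable bP) mM).
    - apply/measurable_EFinP; exact: measurable_hs2 (mbm_measurable (mbmB bP bT)).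
    - by apply: filterS e => z -> _.
  by rewrite (D2_EFin (mbmB bP bT)) poweR_EFin powR12_sqrt ?D2_ge0.
apply/fine_cvgP; split; first exact: nearW.
rewrite -[X in _ --> X]/(0 : R).
have h1 : Num.sqrt (D2 (fun z => pprod F N.+1 z - T z)) @[N --> \oo] --> (0 : R).
  rewrite -[X in _ --> X]sqrtr0; apply: continuous_cvg; first exact: sqrt_continuous.
  by rewrite (cvg_shiftS (fun k => D2 (fun z => pprod F k z - T z))).
have h2 : ln (complex.Re (\det (cul (pprod F N.+1)))) @[N --> \oo] -->
    ln (complex.Re (\det (cul T))).
  apply: continuous_cvg.
    apply: continuous_ln.
    by have := triG_det_gt0 nTA; rewrite ltcE => /andP[].
  have [h _] := mccvg_det (plim_cul cF bT hT).
  by rewrite (cvg_shiftS (fun k => complex.Re (\det (cul (pprod F k))))).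
have h3 : `|ln (complex.Re (\det (cul (pprod F N.+1)))) - ln (complex.Re (\det (cul T)))|
    @[N --> \oo] --> `|ln (complex.Re (\det (cul T))) - ln (complex.Re (\det (cul T)))|.
  by apply: cvg_norm; apply: cvgB; [exact: h2|exact: cvg_cst].
move: h3; rewrite subrr normr0 => h3; rewrite -[X in _ --> X](addr0 (0 : R)).
exact: cvgD h1 h3.
Qed.

(** [metric_dom] makes [M] measurable and only its block A square integrable, so the triangle
    inequality is carried out in the extended reals; finiteness comes from the distance to a partial
    product. *)
Lemma is_nlft_plim F T M : ell2_contractive F -> mbm T -> plim F T -> is_nlft alpha F M ->
  mx_measurable M /\ {ae mu, forall z, M z = T z}.
Proof.
move=> [cF _] bT hT [[mM _ _] hd]; split=> //.
have mMT := mx_measurableB mM (mbm_measurable bT).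
have m2 := measurable_hs2 mMT.
have small (e : R) : 0 < e -> (\int[mu]_z (hs2 (M z - T z))%:E <= e%:E)%E.
  move=> e0; have e4 : 0 < e / 4 by rewrite divr_gt0.
  have s0 : 0 < Num.sqrt (e / 4) by rewrite sqrtr_gt0.
  have [N1 _ hN1] : \forall N \near \oo, (nlft_dist (nlft_trunc alpha F N) M < (Num.sqrt (e / 4))%:E)%E.
    have /fine_cvgP [hfin /cvgr_lt /(_ _ s0) hfine] := hd.
    by apply: filterS2 hfin hfine => N fN lN; rewrite -(fineK fN) lte_fin.
  move: hT; rewrite /plim => /cvgr_lt /(_ _ e4) [N2 _ hN2].
  pose N := maxn N1 N2.
  have bP := pprod_bm alpha N.+1 cF; have mP := mbm_measurable bP.
  have mMP := measurable_hs2 (mx_measurableB mM mP).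
  have mPT := measurable_hs2 (mx_measurableB mP (mbm_measurable bT)).
  have i0 : (0 <= \int[mu]_z (hs2 (M z - pprod F N.+1 z))%:E)%E.
    by apply: integral_ge0 => z _; rewrite lee_fin hs2_ge0.
  have h1 : (\int[mu]_z (hs2 (M z - pprod F N.+1 z))%:E <= (e / 4)%:E)%E.
    have := hN1 N (leq_maxl _ _); rewrite /= /nlft_dist nlft_truncE.
    have -> : (\int[mu]_z (hsnorm (pprod F N.+1 z - M z) ^+ 2)%:E =
        \int[mu]_z (hs2 (M z - pprod F N.+1 z))%:E)%E.
      by apply: eq_integral => z _; rewrite hsnorm2 hs2_sym.
    move=> h; have : ((\int[mu]_z (hs2 (M z - pprod F N.+1 z))%:E) `^ 2^-1 <
        (Num.sqrt (e / 4))%:E)%E.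
      by apply: le_lt_trans h; rewrite leeDl // lee_fin.
    move: i0; case: (\int[mu]_z _)%E => [r r0|_|//].
      rewrite poweR_EFin powR12_sqrt // lte_fin ltr_sqrt // lee_fin; exact: ltW.
    by rewrite poweRyr ?gt_eqF ?invr_gt0 // ltNge leey.
  have h2 : (\int[mu]_z (hs2 (pprod F N.+1 z - T z))%:E <= (e / 4)%:E)%E.
    by rewrite (D2_EFin (mbmB bP bT)) lee_fin ltW // hN2 //= (leq_trans (leq_maxr N1 N2)).
  apply: (@le_trans _ _ (\int[mu]_z ((2 * hs2 (M z - pprod F N.+1 z))%:E +
      (2 * hs2 (pprod F N.+1 z - T z))%:E))%E).
    apply: ge0_le_integral => //.
    - by move=> z _; rewrite lee_fin hs2_ge0.
    - exact/measurable_EFinP.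
    - apply/measurable_EFinP; apply: measurable_funD;
        by apply: measurable_funM; [exact: measurable_cst|].
    - move=> z _; rewrite -EFinD lee_fin; apply: le_trans (hs2D _ _).
      by rewrite addrA subrK.
  rewrite ge0_integralD //=; last 4 first.
  - by move=> z _; rewrite lee_fin mulr_ge0 ?hs2_ge0.
  - by apply/measurable_EFinP; apply: measurable_funM.
  - by move=> z _; rewrite lee_fin mulr_ge0 ?hs2_ge0.
  - by apply/measurable_EFinP; apply: measurable_funM.
  under eq_integral do rewrite EFinM; rewrite ge0_integralZl //=; last 2 first.
  - exact/measurable_EFinP.
  - by move=> z _; rewrite lee_fin hs2_ge0.
  under [X in (_ + X)%E]eq_integral do rewrite EFinM; rewrite ge0_integralZl //=; last 2 first.
  - exact/measurable_EFinP.
  - by move=> z _; rewrite lee_fin hs2_ge0.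
  apply: (@le_trans _ _ (2%:E * (e / 4)%:E + 2%:E * (e / 4)%:E)%E).
    by apply: leeD; [exact: lee_wpmul2l|exact: lee_wpmul2l].
  by rewrite -!EFinM -EFinD lee_fin; lra.
have i0 : (\int[mu]_z `|(hs2 (M z - T z))%:E| = 0)%E.
  under eq_integral do rewrite gee0_abs ?lee_fin ?hs2_ge0 //.
  apply/eqP; rewrite eq_le; apply/andP; split; last first.
    by apply: integral_ge0 => z _; rewrite lee_fin hs2_ge0.
  by apply/lee_addgt0Pr => e e0; rewrite add0e; exact: small.
have mE : measurable_fun setT (fun z => (hs2 (M z - T z))%:E) by exact/measurable_EFinP.
move/(ae_eq_integral_abs _ measurableT mE) : i0; apply: filterS => z /(_ Logic.I) /= [].
by move/hs2_eq0/eqP; rewrite subr_eq0 => /eqP.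
Qed.

(** The limit [T] has values in SU(2n), so it is admissible for every such [G] and can be the
    competitor in the outer condition for [M]. Conversely, [plim_outer] rules out nontrivial inner
    factors for all competitors with unitary values. The right-hand side does not depend on [G],
    which is how the two outer spaces get compared. *)
Lemma outer_space_image (G : set 'M[C]_(n + n)) : @SUgroup R (n + n) `<=` G ->
  G `<=` @Ugroup R (n + n) ->
  outer_space G alpha = nlft_image R n alpha.
Proof.
move=> SUG GU; apply/seteqP; split => M.
- move=> [aM oM]; have [M' [rM nM GM e]] := admissible_regular SUG GU aM.
  have [F [T [I1 [I2 [hF [bT ST hT] [h1 h2] [u1 u2] hf]]]]] := factor_exists rM nM.
  have [cF _] := hF; have uT z : T z \is unitarymx by case: (ST z).
  have rT := plim_regular cF bT uT hT; have nT := plim_normalized hF bT hT.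
  have aT : admissible G alpha T.
    apply: (regular_admissible (mbm_measurable bT) rT nT) => [z|]; last exact: aeW.
    exact: SUG (ST z).
  have eM : {ae mu, forall z, M z = T z *m block_mx (I1 z) 0 0 (I2 z)}.
    by near=> z; rewrite (near e z) // (near hf z).
  have hh1 : mxH2 (fun z => (I1 z)^t*).
    exact: mhol_mxH2 (mbm_measurable (mhol_bm h1)) (aeW _ (fun=> erefl)) h1.
  have hh2 : mxH2 I2.
    exact: mhol_mxH2 (mbm_measurable (mhol_bm h2)) (aeW _ (fun=> erefl)) h2.
  have [e1 e2] := oM I1 I2 T hh1 hh2 u1 u2 aT eM.
  exists F => //; apply: (plim_is_nlft hF bT uT hT); first by case: aM.
  near=> z; rewrite (near eM z) // (near e1 z) // (near e2 z) //.
  by rewrite -scalar_mx_block mulmx1.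
- move=> [F hF hM]; have [T [bT ST hT]] := plim_exists alpha hF.
  have [cF _] := hF; have uT z : T z \is unitarymx by case: (ST z).
  have rT := plim_regular cF bT uT hT; have nT := plim_normalized hF bT hT.
  have [mM e] := is_nlft_plim hF bT hT hM.
  split.
    by apply: (regular_admissible mM rT nT) => // z; exact: SUG (ST z).
  move=> I1 I2 M' h1 h2 u1 u2 aM' eM.
  have [M2 [rM2 nM2 GM2 e2]] := admissible_regular SUG GU aM'.
  have mI1 : mx_measurable I1.
    by move=> i j; have [mf _ _] := h1 j i; have := cmeasurable_adj mf; congr cmeasurable;
      apply/funext => z; rewrite adjE conjCK.
  have mI2 : mx_measurable I2 by move=> i j; have [] := h2 i j.
  have U1 : @Ugroup R n 1%:M by exact: unitary1.
  have hU (A : 'M[C]_n) : Ugroup A -> A \is unitarymx by [].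
  have [J1 [bJ1 uJ1 eJ1]] := @everywhere_version n (@Ugroup R n) I1 U1 hU mI1 u1.
  have [J2 [bJ2 uJ2 eJ2]] := @everywhere_version n (@Ugroup R n) I2 U1 hU mI2 u2.
  have k1 : mhol (fun z => (J1 z)^t*).
    apply: mxH2_mhol _ h1 (mbm_adj bJ1).
    by apply: filterS eJ1 => z ->.
  have k2 : mhol J2 by exact: mxH2_mhol eJ2 h2 bJ2.
  have hf : factored T M2 J1 J2.
    by near=> z; rewrite -(near e z) // (near eM z) // (near e2 z) // (near eJ1 z) // (near eJ2 z).
  have [r1 r2] := plim_outer hF bT uT hT rM2 nM2 uJ1 uJ2 k1 k2 hf.
  by split; near=> z; [rewrite (near eJ1 z) // (near r1 z)|rewrite (near eJ2 z) // (near r2 z)].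
Unshelve. all: by end_near. Qed.

End outer_spaces.

Theorem corollary4p16 (R : realType) (n : nat) (hn : (0 < n)%N)
    (alpha : 'I_2 -> 'I_2) :
  Hplus R n alpha = Uplus R n alpha /\ Uplus R n alpha = nlft_image R n alpha.
Proof.
have hU : Uplus R n alpha = nlft_image R n alpha.
  by apply: outer_space_image => [A []|].
by split=> //; rewrite hU; apply: outer_space_image => [|A []].
Qed.
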